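(* Let $x:M\to\mathbb{R}^3$ be a stationary rotating surface (with respect to the $x_3$-axis) with non-empty boundary, whose mean curvature satisfies $2H(x)=ar^2+b$, $a,b\in\mathbb{R}$. Then $$\int_{\partial M}(ar^2+2b)\,\langle x\wedge\alpha',E_3\rangle\,ds=-4\int_{\partial M}\nu_3\,ds.$$ In particular, $$a\int_{\partial M}r^2\,\langle x\wedge\alpha',E_3\rangle\,ds\le 4\bigl(L(\partial M)-b\,a(\partial M)\bigr),$$ where $L(\partial M)$ is the length of $\partial M$ and $a(\partial M)=\frac12\int_{\partial M}\langle x\wedge\alpha',E_3\rangle\,ds$ is the algebraic area of $\partial M$.
   Context: Coordinates of $\mathbb{R}^3$ are $(x_1,x_2,x_3)$, $E_3=(0,0,1)$, $\wedge$ is the vector product of $\mathbb{R}^3$, and $r=\sqrt{x_1^2+x_2^2}$. A stationary rotating surface (with respect to the $x_3$-axis) is an oriented compact connected surface $M$ smoothly immersed in $\mathbb{R}^3$ by $x$, with Gauss map $N$, whose mean curvature $H$ satisfies $2H(x)=ar^2+b$ at every point for some constants $a,b\in\mathbb{R}$. Here $2H$ is the sum of the principal curvatures with respect to $N$, with the sign convention $\Delta x=2HN$. $\alpha$ is an arc-length parametrization of $\partial M$ giving the orientation on $\partial M$ induced from $M$, $ds$ is the arc-length element, $\nu$ is the inward unit conormal vector field of $M$ along $\partial M$, and $\nu_3=\langle\nu,E_3\rangle$. *)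

(* Defs.v *)
From HB Require Import structures.
From mathcomp Require Import all_boot all_order all_algebra.
From mathcomp Require Import all_classical all_reals all_analysis.
From mathcomp Require Import ring.
Set Implicit Arguments.
Unset Strict Implicit.
Unset Printing Implicit Defensive.
Import Order.TTheory GRing.Theory Num.Theory.
Import numFieldNormedType.Exports.
Local Open Scope classical_set_scope.
Local Open Scope ring_scope.

Section EuclideanSpace.
Variable R : realType.
Implicit Types u v : 'rV[R]_3.

(* The library norm `|u| on row vectors is the sup norm, hence [enorm]. *)
Definition dot u v : R := (u *m v^T) 0 0.
Definition enorm u : R := Num.sqrt (dot u u).

Definition vec3 (p q r : R) : 'rV[R]_3 := \row_(i < 3) [:: p; q; r]`_i.

Definition cross u v : 'rV[R]_3 :=
  vec3 (u 0 1 * v 0 2 - u 0 2 * v 0 1)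
       (u 0 2 * v 0 0 - u 0 0 * v 0 2)
       (u 0 0 * v 0 1 - u 0 1 * v 0 0).

Definition E3 : 'rV[R]_3 := vec3 0 0 1.

Definition axis_dist u : R := Num.sqrt (u 0 0 ^+ 2 + u 0 1 ^+ 2).

End EuclideanSpace.
Arguments E3 {R}.

Section Smoothness.
Variables (R : realType) (V W : normedModType R).

(* C^oo on an open set U: all iterated directional derivatives are Frechet
   differentiable (in particular continuous) at every point of U. *)
Definition smooth_on (U : set V) (f : V -> W) :=
  forall (vs : seq V) (q : V), U q ->
    differentiable (foldr (fun v g => 'D_v g) f vs) q.

(* C^oo on an arbitrary set A: local extension to smooth functions on open
   sets. *)
Definition smooth_upto (A : set V) (f : V -> W) :=
  forall q, A q -> exists (U : set V) (g : V -> W),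
    [/\ open U, U q, smooth_on U g & forall q', A q' -> U q' -> f q' = g q'].

(* One-sided derivative of f at q in the direction v. *)
Definition rderive (f : V -> W) (v q : V) : W :=
  lim ((h^-1 *: (f (q + h *: v) - f q)) @[h --> 0^'+]).

End Smoothness.

(* The half-plane is stable under q |-> q + h e_i for h >= 0 and i = 0, 1.  So
   for f smooth on a relatively open subset of it, the one-sided [partial i f]
   is the usual partial derivative, at boundary points too, where it agrees
   with that of any smooth extension of f. *)
Definition halfplane (R : realType) : set 'rV[R]_2 := [set q | 0 <= q 0 1].
Arguments halfplane : clear implicits.

Definition partial (R : realType) (W : normedModType R) (i : 'I_2)
    (f : 'rV[R]_2 -> W) : 'rV[R]_2 -> W :=
  rderive f (delta_mx 0 i).

(* The i-th row is the i-th partial derivative of f. *)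
Definition jac (R : realType) (n : nat) (f : 'rV[R]_2 -> 'rV[R]_n.+1)
    (q : 'rV[R]_2) : 'M[R]_(2, n.+1) :=
  \matrix_(i < 2) partial i f q.

(* [chart_inv] is only meaningful on the image [cimg] of the chart. *)
Record chart (R : realType) (M : topologicalType) := Chart {
  cdom : set M;
  cmap : M -> 'rV[R]_2;
  chart_inv : 'rV[R]_2 -> M;
  cdom_open : open cdom;
  cimg_open : exists2 W : set 'rV[R]_2,
    open W & cmap @` cdom = W `&` halfplane R;
  cmapK : forall p, cdom p -> chart_inv (cmap p) = p;
  cmap_continuous : {within cdom, continuous cmap};
  chart_inv_continuous : {within cmap @` cdom, continuous chart_inv} }.

Definition cimg (R : realType) (M : topologicalType) (c : chart R M) :
  set 'rV[R]_2 := cmap c @` cdom c.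

(* Smooth oriented atlas of a surface with boundary.  Every chart takes values
   in the half-plane; a chart avoiding the line q 0 1 = 0 is an interior one. *)
Record oriented_atlas (R : realType) (M : topologicalType) := OrientedAtlas {
  charts : set (chart R M);
  charts_cover : forall p, exists2 c, charts c & cdom c p;
  transition_smooth : forall c c', charts c -> charts c' ->
    smooth_upto (cmap c @` (cdom c `&` cdom c')) (cmap c' \o chart_inv c);
  transition_positive : forall c c' p,
    charts c -> charts c' -> cdom c p -> cdom c' p ->
    0 < \det (jac (cmap c' \o chart_inv c) (cmap c p)) }.

Section Surface.
Variables (R : realType) (M : topologicalType) (A : oriented_atlas R M).
Implicit Types (c : chart R M) (x N nu : M -> 'rV[R]_3) (p : M).

Definition surface_boundary : set M :=
  [set p | exists c, [/\ charts A c, cdom c p & cmap c p 0 1 = 0]].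

Definition local_repr x c : 'rV[R]_2 -> 'rV[R]_3 := x \o chart_inv c.

(* The rows span the tangent plane of the immersed surface at p. *)
Definition tangent x c p : 'M[R]_(2, 3) := jac (local_repr x c) (cmap c p).

Definition smooth_immersion x :=
  (forall c, charts A c -> smooth_upto (cimg c) (local_repr x c)) /\
  (forall c p, charts A c -> cdom c p -> row_free (tangent x c p)).

Definition gauss_map x N :=
  forall c p, charts A c -> cdom c p ->
    let n := cross (row 0 (tangent x c p)) (row 1 (tangent x c p)) in
    N p = (enorm n)^-1 *: n.

Definition first_form x c p : 'M[R]_2 := tangent x c p *m (tangent x c p)^T.

(* Taking the second derivatives along + N gives the sign convention
   Delta x = 2 H N. *)
Definition second_form x N c p : 'M[R]_2 :=
  \matrix_(i < 2, j < 2)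
    dot (partial i (partial j (local_repr x c)) (cmap c p)) (N p).

Definition shape_operator x N c p : 'M[R]_2 :=
  invmx (first_form x c p) *m second_form x N c p.

Definition mean_curvature x N (H : M -> R) :=
  forall c p, charts A c -> cdom c p ->
    H p = 2^-1 * \tr (shape_operator x N c p).

(* The trace is the sum of the principal curvatures, i.e. of the eigenvalues of
   the shape operator. *)
Lemma mean_curvature_principal x N H c p (k1 k2 : R) :
  mean_curvature x N H -> charts A c -> cdom c p ->
  char_poly (shape_operator x N c p) = ('X - k1%:P) * ('X - k2%:P) ->
  2 * H p = k1 + k2.
Proof.
move=> hH Ac cp e; rewrite (hH c p Ac cp) mulrA divff ?mul1r ?pnatr_eq0 //.
have := @char_poly_trace _ 2 (shape_operator x N c p) isT.
rewrite e /= => /eqP; rewrite eq_sym eqr_oppLR => /eqP ->.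
rewrite mulrBl coefB coefXM coefCM !coefB !coefX !coefC /=.
by ring.
Qed.

Definition stationary_rotating x N (a b : R) :=
  exists2 H, mean_curvature x N H &
    forall p, 2 * H p = a * axis_dist (x p) ^+ 2 + b.

(* At a boundary point p, [row 0 (tangent x c p)] spans the tangent line of the
   boundary, and the tangent vectors w *m tangent x c p with 0 < w 0 1 are the
   inward pointing ones.  No condition on nu off the boundary. *)
Definition inward_conormal x nu :=
  forall c p, charts A c -> cdom c p -> surface_boundary p ->
    [/\ exists2 w : 'rV[R]_2, 0 < w 0 1 & nu p = w *m tangent x c p,
        dot (nu p) (row 0 (tangent x c p)) = 0 &
        enorm (nu p) = 1].

(* Arc-length parametrization of the boundary: one periodic curve for each of
   its finitely many connected components. *)
Record arclength_boundary x := ArclengthBoundary {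
  ncomp : nat;
  clen : 'I_ncomp -> R;
  curve : 'I_ncomp -> R -> M;
  clen_gt0 : forall i, 0 < clen i;
  curve_periodic : forall i s, curve i (s + clen i) = curve i s;
  curve_inj : forall i j (s t : R),
    0 <= s < clen i -> 0 <= t < clen j ->
    curve i s = curve j t -> i = j /\ s = t;
  curve_cover : forall p, surface_boundary p <-> exists i s, curve i s = p;
  curve_continuous : forall i, continuous (curve i);
  curve_smooth : forall i c, charts A c ->
    smooth_on (curve i @^-1` cdom c) (cmap c \o curve i : R^o -> 'rV[R]_2);
  curve_speed : forall i s, enorm (derive1 (x \o curve i) s) = 1 }.
Arguments clen {x} a i.
Arguments curve {x} a i s.

Definition velocity x (g : arclength_boundary x) (i : 'I_(ncomp g)) (s : R) :
  'rV[R]_3 := derive1 (x \o curve g i) s.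
Arguments velocity {x} g i s.

(* Outward conormal first: (- nu, alpha') is a positive basis of the tangent
   plane, that is (- nu) /\ alpha' is a positive multiple of N. *)
Definition induced_orientation x N nu (g : arclength_boundary x) :=
  forall i s,
    0 < dot (cross (- nu (curve g i s)) (velocity g i s)) (N (curve g i s)).

(* Integral ds over the boundary of f (alpha, alpha'). *)
Definition boundary_integral x (g : arclength_boundary x)
    (f : M -> 'rV[R]_3 -> R) : R :=
  \sum_(i < ncomp g)
    Rintegral (@lebesgue_measure R) `[0, clen g i]
      (fun s => f (curve g i s) (velocity g i s)).

Definition boundary_length x (g : arclength_boundary x) : R :=
  boundary_integral g (fun _ _ => 1).

Definition algebraic_area x (g : arclength_boundary x) : R :=
  2^-1 * boundary_integral g (fun p T => dot (cross (x p) T) E3).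

End Surface.

(* Main.v *)
(* Let [eta] be the 1-form <N /\ dx, E3> + (a r^2 / 4 + b / 2) <x /\ dx, E3> on M.
   Since N_u /\ x_v - N_v /\ x_u = - 2H x_u /\ x_v, the differential of its first term is
   - 2H times <x_u /\ x_v, E3> du /\ dv, and that of the second one is (a r^2 + b) times it;
   so [eta] is closed and, by Stokes' theorem, its integral over the boundary is 0.  Along
   the boundary N /\ alpha' = nu, and this is the first claim; the second one follows
   from nu_3 >= -1.

   Stokes' theorem is reduced by partitions of unity to Green's formula on rectangles.
   The charts are compared by a change of variables formula, which Lax's argument
   also reduces to Green's formula. *)

From HB Require Import structures.
Require Import Defs.
From mathcomp Require Import all_boot all_order all_algebra.
From mathcomp Require Import all_classical all_reals all_analysis.
From mathcomp Require Import ring lra.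
Set Implicit Arguments.
Unset Strict Implicit.
Unset Printing Implicit Defensive.
Import Order.TTheory GRing.Theory Num.Theory.
Import numFieldNormedType.Exports.
Local Open Scope classical_set_scope.
Local Open Scope ring_scope.

(** * Integrals over segments *)

Section SegmentIntegral.
Variable R : realType.
Implicit Types (a b c x : R) (f g F : R -> R).
Local Notation mu := (@lebesgue_measure R).

(** The [partial] of the statement is one-sided, and boundary charts fill relatively open pieces of
    a half-plane. Differentiability is therefore set up within a set, in Caratheodory's form, for
    sets that contain, near each of their points, all that is not below it; interior and boundary
    points then share one calculus. A double integral is an iterated one, with the vertical integral
    inside. The order of integration is never exchanged: differentiation under the integral sign
    does the work, even for the symmetry of second derivatives. No integral of 2-forms on the
    surface is defined. For [f] of small support, Green's formula turns the boundary integral of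
    [f eta] into the integral of [df /\ eta] in one chart, and a partition of unity leaves such
    terms in many charts; this is where the change of variables comes in. It is applied only to
    supports near a given point, where the transition map is nearly affine: the edges of a small
    rectangle are then mapped off the support, apart from an edge on the boundary line, which the
    transition map preserves. *)

Definition rint a b f : R := Rintegral mu `[a, b] f.
Definition cont_on a b f := {within `[a, b], continuous f}.

Lemma cont_on_integrable a b f : cont_on a b f -> mu.-integrable `[a, b] (EFin \o f).
Proof. by move=> cf; apply: continuous_compact_integrable => //; exact: segment_compact. Qed.

Lemma cont_onP a b f : cont_on a b f <->
  (forall x, a <= x <= b -> f @ within `[a, b] (nbhs x) --> f x).
Proof.
split=> [/subspace_continuousP h x xab|h]; first exact: h.
by apply/subspace_continuousP => x /= ; rewrite in_itv/=; exact: h.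
Qed.

Lemma continuous_cont_on a b f : continuous f -> cont_on a b f.
Proof. exact: continuous_subspaceT. Qed.

Lemma cont_on_sub a b c d f : a <= c -> d <= b -> cont_on a b f -> cont_on c d f.
Proof.
move=> ac db; apply: continuous_subspaceW.
by move=> x /=; rewrite !in_itv/= => /andP[cx xd]; rewrite (le_trans ac cx) (le_trans xd db).
Qed.

Lemma cont_onD a b f g : cont_on a b f -> cont_on a b g -> cont_on a b (fun x => f x + g x).
Proof.
move=> /cont_onP cf /cont_onP cg; apply/cont_onP => x xab.
by apply: cvgD; [exact: cf|exact: cg].
Qed.

Lemma cont_onM a b f g : cont_on a b f -> cont_on a b g -> cont_on a b (fun x => f x * g x).
Proof.
move=> /cont_onP cf /cont_onP cg; apply/cont_onP => x xab.
by apply: cvgM; [exact: cf|exact: cg].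
Qed.

Lemma cont_on_cst a b k : cont_on a b (fun=> k).
Proof. by apply/cont_onP => x xab; apply: cvg_cst. Qed.

Lemma cont_onN a b f : cont_on a b f -> cont_on a b (fun x => - f x).
Proof.
by move=> /cont_onP cf; apply/cont_onP => x xab; apply: cvgN; exact: cf.
Qed.

Lemma cont_onB a b f g : cont_on a b f -> cont_on a b g -> cont_on a b (fun x => f x - g x).
Proof. by move=> cf cg; apply: cont_onD => //; exact: cont_onN. Qed.

Lemma cont_on_ext a b f g : (forall x, a <= x <= b -> f x = g x) -> cont_on a b f -> cont_on a b g.
Proof.
move=> fg /cont_onP cf; apply/cont_onP => x xab.
rewrite -fg//; apply: cvg_trans (cf x xab); apply: near_eq_cvg.
by near=> y; rewrite fg//; have : `[a, b]%classic y by near: y; exact: withinT; rewrite /= in_itv.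
Unshelve. all: by end_near. Qed.

Lemma rint_ext a b f g : (forall x, a <= x <= b -> f x = g x) -> rint a b f = rint a b g.
Proof. by move=> fg; apply: eq_Rintegral => x; rewrite inE/= in_itv/= => /fg. Qed.

Lemma rintD a b f g : cont_on a b f -> cont_on a b g ->
  rint a b (fun x => f x + g x) = rint a b f + rint a b g.
Proof. by move=> cf cg; apply: RintegralD => //; exact: cont_on_integrable. Qed.

Lemma rintB a b f g : cont_on a b f -> cont_on a b g ->
  rint a b (fun x => f x - g x) = rint a b f - rint a b g.
Proof. by move=> cf cg; apply: RintegralB => //; exact: cont_on_integrable. Qed.

Lemma rintZ a b k f : cont_on a b f -> rint a b (fun x => k * f x) = k * rint a b f.
Proof. by move=> cf; apply: RintegralZl => //; exact: cont_on_integrable. Qed.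

Lemma rintN a b f : cont_on a b f -> rint a b (fun x => - f x) = - rint a b f.
Proof.
by move=> cf; rewrite -mulN1r -rintZ//; apply: rint_ext => x _; rewrite mulN1r.
Qed.

Lemma rint_sum a b n (f : 'I_n -> R -> R) : (forall i, cont_on a b (f i)) ->
  cont_on a b (fun x => \sum_(i < n) f i x) /\
  rint a b (fun x => \sum_(i < n) f i x) = \sum_(i < n) rint a b (f i).
Proof.
elim: n f => [|n IH] f cf.
  split; first by under eq_fun do rewrite big_ord0; exact: cont_on_cst.
  rewrite big_ord0 (@rint_ext _ _ _ (fun=> 0)); last by move=> x _; rewrite big_ord0.
  by rewrite /rint Rintegral_cst// mul0r.
have [c e] := IH (fun i => f (lift ord0 i)) (fun i => cf _).
have E x : \sum_(i < n.+1) f i x = f ord0 x + \sum_(i < n) f (lift ord0 i) x.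
  by rewrite big_ord_recl.
split; first by under eq_fun do rewrite E; exact: cont_onD.
by rewrite (rint_ext (fun x _ => E x)) rintD// e big_ord_recl.
Qed.

Lemma rint0 a b f : (forall x, a <= x <= b -> f x = 0) -> rint a b f = 0.
Proof.
move=> f0; rewrite (@rint_ext _ _ _ (fun=> 0))//.
by rewrite /rint Rintegral_cst// mul0r.
Qed.

Lemma rint_cst a b k : a <= b -> rint a b (fun=> k) = k * (b - a).
Proof.
move=> ab; rewrite /rint Rintegral_cst//=; congr (_ * _).
have -> : mu `[a, b]%classic = (b - a)%:E.
  rewrite lebesgue_measure_itv/= lte_fin.
  case: ltP => [//|ba]; have -> : a = b by apply/eqP; rewrite eq_le ab.
  by rewrite subrr.
by [].
Qed.

Lemma le_rint a b f g : cont_on a b f -> cont_on a b g ->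
  (forall x, a <= x <= b -> f x <= g x) -> rint a b f <= rint a b g.
Proof.
move=> cf cg fg; by apply: le_Rintegral => //; exact: cont_on_integrable.
Qed.

Lemma rint_le_norm a b f k : a <= b -> cont_on a b f ->
  (forall x, a <= x <= b -> `|f x| <= k) -> `|rint a b f| <= k * (b - a).
Proof.
move=> ab cf fk; rewrite ler_norml -mulNr -!(rint_cst _ ab); apply/andP; split;
  apply: le_rint => //; try exact: cont_on_cst.
  by move=> x /fk; rewrite ler_norml => /andP[].
by move=> x /fk; rewrite ler_norml => /andP[].
Qed.

Lemma rint_point a f : rint a a f = 0.
Proof. by rewrite /rint set_itv1 Rintegral_set1. Qed.

Lemma rint_cat a b c f : a <= c -> c <= b -> cont_on a b f ->
  rint a b f = rint a c f + rint c b f.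
Proof.
move=> ac cb cf; have := @Rintegral_itvB R f (BLeft a) (BRight b) c (cont_on_integrable cf).
rewrite !bnd_simp => /(_ ac cb) h.
rewrite Rintegral_itv_obnd_cbnd in h; first by rewrite /rint -h addrC subrK.
apply: (@integrableS _ _ _ mu `[a, b]) => //; last exact: cont_on_integrable.
by apply: subset_itv; rewrite bnd_simp.
Qed.

Lemma rint_FTC2 a b f F : a <= b -> cont_on a b f -> cont_on a b F ->
  (forall x, a < x < b -> is_derive x 1 F (f x)) -> rint a b f = F b - F a.
Proof.
rewrite le_eqVlt => /orP[/eqP <-|ab] cf cF dF; first by rewrite rint_point subrr.
have h := @continuous_FTC2 R f F a b ab cf _ _.
rewrite /rint /Rintegral h//.
- move/(continuous_within_itvP _ ab): cF => [_ c2 c3].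
  by split=> // x; rewrite in_itv/= => xab; have := dF x xab; move=> [].
- by move=> x; rewrite in_itv/= => xab; have := dF x xab; move=> [_]; rewrite derive1E.
Qed.

Lemma rint_FTC1 a b f x : cont_on a b f -> a < x < b ->
  is_derive x 1 (fun y => rint a y f) (f x).
Proof.
move=> cf /andP[ax xb].
have fx : {for x, continuous f}.
  by apply: (within_continuous_continuous (lt_trans ax xb) cf); rewrite in_itv/= ax xb.
have [h1 h2] := @continuous_FTC1_closed R f a x b xb (cont_on_integrable cf) ax fx.
by split; [exact: h1|rewrite -derive1E; exact: h2].
Qed.

Lemma rint_prim_cont a b f : cont_on a b f -> cont_on a b (fun y => rint a y f).
Proof.
move=> cf; have [ab|ba] := leP a b; last first.
  by apply/cont_onP => x /andP[h1 h2]; have := le_trans h1 h2; rewrite leNgt ba.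
exact: parameterized_integral_continuous ab (cont_on_integrable cf).
Qed.

Lemma RintT_box a b f : (forall x, f x != 0 -> a <= x <= b) -> Rintegral mu setT f = rint a b f.
Proof.
move=> f0; rewrite /rint [RHS]Rintegral_mkcond.
congr (Rintegral _ _ _); apply/funext => x.
rewrite patchE; case: ifPn => //; rewrite mem_setE in_itv/= => h.
by apply/eqP; apply: contraNT h => /f0.
Qed.

Lemma rint_sub a b c d f : a <= c -> d <= b -> (forall x, a <= x <= b -> f x != 0 -> c <= x <= d) ->
  rint a b f = rint c d f.
Proof.
move=> ac db f0; rewrite /rint Rintegral_mkcond [RHS]Rintegral_mkcond.
congr (Rintegral _ _ _); apply/funext => x; rewrite !patchE !mem_setE !in_itv/=.
case: ifPn => h1; case: ifPn => h2//.
  by apply/eqP; apply: contraNT h2 => /(f0 _ h1).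
by case/andP: h2 => h3 h4; move: h1; rewrite (le_trans ac h3) (le_trans h4 db).
Qed.

End SegmentIntegral.

(** * One-sided differentiability in the half-plane *)

(* Locked, for unification not to unfold the limit. *)
HB.lock Definition pd (R : realType) (i : 'I_2) (f : 'rV[R]_2 -> R) : 'rV[R]_2 -> R := partial i f.
Arguments pd {R} i f q.

Section Differentiability.
Variable R : realType.
Local Notation V := 'rV[R]_2.
Implicit Types (A B : set V) (q : V) (f g : V -> R) (T : V -> V).

Definition pt (u v : R) : V := \row_(i < 2) (if i == 0 then u else v).

Lemma pt0 u v : pt u v 0 0 = u. Proof. by rewrite mxE. Qed.
Lemma pt1 u v : pt u v 0 1 = v. Proof. by rewrite mxE. Qed.

Lemma ord2P (P : 'I_2 -> Prop) : P 0 -> P 1 -> forall i, P i.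
Proof.
move=> P0 P1 [[|[|m]] hm]//; [suff -> : Ordinal hm = 0 by []|suff -> : Ordinal hm = 1 by []];
  exact: val_inj.
Qed.

Lemma ptE q : pt (q 0 0) (q 0 1) = q.
Proof. by apply/rowP; apply: ord2P; rewrite mxE. Qed.

Lemma eq_pt q q' : q 0 0 = q' 0 0 -> q 0 1 = q' 0 1 -> q = q'.
Proof. by move=> h0 h1; rewrite -(ptE q) h0 h1 ptE. Qed.

Lemma coord_le_norm n (q : 'rV[R]_n) i : `|q 0 i| <= `|q|.
Proof.
rewrite [leRHS]/Num.Def.normr/= mx_normrE.
by apply: le_trans; last exact: (le_bigmax _ _ (0, i)).
Qed.

Lemma norm_lt_coord q e : `|q 0 0| < e -> `|q 0 1| < e -> `|q| < e.
Proof.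
move=> h0 h1; have e0 : 0 < e by exact: le_lt_trans h0.
rewrite [ltLHS]/Num.Def.normr/= mx_normrE.
by apply/bigmax_ltP; split => // -[i j] _ /=; rewrite (ord1 i); move: j; apply: ord2P.
Qed.

Lemma near_ptP q (P : set V) : (\forall q' \near q, P q') <->
  exists2 e : R, 0 < e & forall q', `|q' 0 0 - q 0 0| < e -> `|q' 0 1 - q 0 1| < e -> P q'.
Proof.
split=> [/nbhs_normP[e /= e0 eP]|[e e0 eP]].
  exists e => // q' h0 h1; apply: eP; rewrite /= distrC.
  by apply: norm_lt_coord; rewrite !mxE.
apply/nbhs_normP; exists e => //= q' /= qq'; rewrite distrC in qq'.
by apply: eP; apply: le_lt_trans qq'; apply: le_trans (coord_le_norm _ _); rewrite !mxE.
Qed.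

Lemma near_all q (P : set V) : (forall q', P q') -> \forall q' \near q, P q'.
Proof. by move=> h; apply/near_ptP; exists 1. Qed.

Definition cont (W : topologicalType) A (f : V -> W) q := f @ within A (nbhs q) --> f q.

Lemma cont_cst A k q : cont A (fun=> k : R) q.
Proof. exact: cvg_cst. Qed.

Lemma cont_coord n A (f : V -> 'rV[R]_n) i q : cont A f q -> cont A (fun q => f q 0 i) q.
Proof. by move=> cf; exact: (cvg_comp _ _ cf (@coord_continuous _ _ _ 0 i (f q))). Qed.

Lemma cont_id A q : cont A id q.
Proof. exact: cvg_within. Qed.

Lemma contD A f g q : cont A f q -> cont A g q -> cont A (fun q => f q + g q) q.
Proof. exact: cvgD. Qed.

Lemma contN A f q : cont A f q -> cont A (fun q => - f q) q.
Proof. exact: cvgN. Qed.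

Lemma contB A f g q : cont A f q -> cont A g q -> cont A (fun q => f q - g q) q.
Proof. exact: cvgB. Qed.

Lemma contM A f g q : cont A f q -> cont A g q -> cont A (fun q => f q * g q) q.
Proof. exact: cvgM. Qed.

Lemma cont_sub (W : topologicalType) A B (f : V -> W) q : B `<=` A -> cont A f q -> cont B f q.
Proof.
move=> BA cf P /cf h; have {}h : \forall q' \near q, A q' -> P (f q') by exact: h.
suff : \forall q' \near q, B q' -> P (f q') by [].
by apply: filterS h => x hx /BA; exact: hx.
Qed.

Lemma cont_near_ext (W : topologicalType) A (f g : V -> W) q : A q ->
  (\forall q' \near q, A q' -> f q' = g q') -> cont A f q -> cont A g q.
Proof.
move=> Aq fg cf; rewrite /cont -(nbhs_singleton fg Aq) => P /cf h.
have {}h : \forall q' \near q, A q' -> P (f q') by exact: h.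
suff : \forall q' \near q, A q' -> P (g q') by [].
by apply: filterS2 fg h => x fgx hx Ax; rewrite -fgx//; exact: hx.
Qed.

Lemma cont_ext (W : topologicalType) A (f g : V -> W) q : A q ->
  (forall q', A q' -> f q' = g q') -> cont A f q -> cont A g q.
Proof. by move=> Aq fg; apply: cont_near_ext => //; apply: near_all => q'; exact: fg. Qed.

Lemma cont_vec A T q : cont A (fun q => T q 0 0) q -> cont A (fun q => T q 0 1) q ->
  cont A T q.
Proof.
move=> c0 c1; apply/(@cvgrPdist_lt _ _ _ _ _) => e e0.
have h0 := (@cvgrPdist_lt _ _ _ _ _ _ _).1 c0 _ e0.
have h1 := (@cvgrPdist_lt _ _ _ _ _ _ _).1 c1 _ e0.
have {}h0 : \forall q' \near q, A q' -> `|T q 0 0 - T q' 0 0| < e by exact: h0.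
have {}h1 : \forall q' \near q, A q' -> `|T q 0 1 - T q' 0 1| < e by exact: h1.
suff : \forall q' \near q, A q' -> `|T q - T q'| < e by [].
by apply: filterS2 h0 h1 => x h0 h1 Ax; apply: norm_lt_coord; rewrite !mxE; [exact: h0|exact: h1].
Qed.

Lemma cont_comp (W : topologicalType) A B T (f : V -> W) q :
  (\forall q' \near q, A q' -> B (T q')) ->
  cont A T q -> cont B f (T q) -> cont A (f \o T) q.
Proof.
move=> AB cT cf; apply: cvg_comp cf => P.
move=> /cT h; have {}h : \forall q' \near q, A q' -> B (T q') -> P (f (T q')) by exact: h.
suff : \forall q' \near q, A q' -> P (f (T q')) by [].
by apply: filterS2 AB h => x ABx hx Ax; apply: hx => //; exact: ABx.
Qed.

Lemma cont_comp1 A f (k : R -> R) q : cont A f q -> {for f q, continuous k} ->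
  cont A (k \o f) q.
Proof. by move=> cf ck; apply: cvg_comp cf _; exact: ck. Qed.

(* Caratheodory's form of differentiability within [A]. *)
Definition wd A f q (a b : R) := exists phi psi : V -> R,
  [/\ cont A phi q, cont A psi q, phi q = a, psi q = b &
   \forall q' \near q, A q' ->
     f q' = f q + phi q' * (q' 0 0 - q 0 0) + psi q' * (q' 0 1 - q 0 1)].

(* This covers open sets as well as relatively open subsets of the half-plane. *)
Definition adm A := forall q, A q -> nbhs q (fun q' : V => q 0 1 <= q' 0 1 -> A q').

Lemma wd_cont A f q a b : A q -> wd A f q a b -> cont A f q.
Proof.
move=> Aq [phi [psi [c1 c2 p1 p2 h]]].
have : cont A (fun q' => f q + phi q' * (q' 0 0 - q 0 0) + psi q' * (q' 0 1 - q 0 1)) q.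
  by repeat (first [exact: cont_cst|exact: c1|exact: c2|apply: contD|apply: contN|apply: contM]);
    apply: cont_coord; exact: cont_id.
by apply: cont_near_ext => //; near=> x => Ax; symmetry; apply: (near h x).
Unshelve. all: by end_near. Qed.

Lemma wd_near_ext A f g q a b : A q -> (\forall q' \near q, A q' -> f q' = g q') ->
  wd A f q a b -> wd A g q a b.
Proof.
move=> Aq fg [phi [psi [c1 c2 p1 p2 h]]]; exists phi, psi; split => //.
near=> x => Ax; rewrite -(nbhs_singleton fg Aq) -(near fg x) //; exact: (near h x).
Unshelve. all: by end_near. Qed.

Lemma wd_sub A B f q a b : B `<=` A -> wd A f q a b -> wd B f q a b.
Proof.
move=> BA [phi [psi [c1 c2 p1 p2 h]]]; exists phi, psi; split => //; try exact: cont_sub BA _.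
by near=> x => Bx; apply: (near h x) => //; exact: BA.
Unshelve. all: by end_near. Qed.

Lemma wd_cst A k q : wd A (fun=> k) q 0 0.
Proof.
exists (fun=> 0), (fun=> 0); split => //; try exact: cont_cst.
by apply: near_all => x _; rewrite !mul0r !addr0.
Qed.

Lemma wd_x A q : wd A (fun q => q 0 0) q 1 0.
Proof.
exists (fun=> 1), (fun=> 0); split => //; try exact: cont_cst.
by apply: near_all => x _; ring.
Qed.

Lemma wd_y A q : wd A (fun q => q 0 1) q 0 1.
Proof.
exists (fun=> 0), (fun=> 1); split => //; try exact: cont_cst.
by apply: near_all => x _; ring.
Qed.

Lemma wdD A f g q a b a' b' : wd A f q a b -> wd A g q a' b' ->
  wd A (fun q => f q + g q) q (a + a') (b + b').
Proof.
move=> [phi [psi [c1 c2 p1 p2 h]]] [phi' [psi' [c1' c2' p1' p2' h']]].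
exists (fun q => phi q + phi' q), (fun q => psi q + psi' q); split.
- exact: contD.
- exact: contD.
- by rewrite p1 p1'.
- by rewrite p2 p2'.
- by near=> x => Ax; rewrite (near h x)// (near h' x)//; ring.
Unshelve. all: by end_near. Qed.

(** From [f g - f(q) g(q) = (f - f(q)) g + f(q) (g - g(q))]: the factor [g] stays at the moving
    point, so its continuity at [q] makes the new Caratheodory factors continuous. *)
Lemma wdM A f g q a b a' b' : A q -> wd A f q a b -> wd A g q a' b' ->
  wd A (fun q => f q * g q) q (a * g q + f q * a') (b * g q + f q * b').
Proof.
move=> Aq wf wg; have cg := wd_cont Aq wg.
move: wf wg => [phi [psi [c1 c2 p1 p2 h]]] [phi' [psi' [c1' c2' p1' p2' h']]].
exists (fun x => phi x * g x + f q * phi' x), (fun x => psi x * g x + f q * psi' x); split.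
- by apply: contD; apply: contM => //; exact: cont_cst.
- by apply: contD; apply: contM => //; exact: cont_cst.
- by rewrite p1 p1'.
- by rewrite p2 p2'.
- apply: filterS2 h h' => x h h' Ax; have E := h Ax; have E' := h' Ax.
  transitivity (f q * g x + (phi x * (x 0 0 - q 0 0) + psi x * (x 0 1 - q 0 1)) * g x).
    by rewrite E; ring.
  by rewrite {1}E'; ring.
Qed.

Lemma wd_comp A B T f q a b a1 b1 a2 b2 :
  (\forall q' \near q, A q' -> B (T q')) -> A q ->
  wd A (fun q => T q 0 0) q a1 b1 -> wd A (fun q => T q 0 1) q a2 b2 ->
  wd B f (T q) a b -> wd A (f \o T) q (a * a1 + b * a2) (a * b1 + b * b2).
Proof.
move=> AB Aq w1 w2; have cT : cont A T q by apply: cont_vec; [exact: wd_cont w1|exact: wd_cont w2].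
move: w1 w2 => [phi1 [psi1 [c1 c1' p1 p1' h1]]] [phi2 [psi2 [c2 c2' p2 p2' h2]]].
move=> [phi [psi [c c' p p' h]]].
have cphi : cont A (phi \o T) q by exact: cont_comp AB cT c.
have cpsi : cont A (psi \o T) q by exact: cont_comp AB cT c'.
exists (fun x => phi (T x) * phi1 x + psi (T x) * phi2 x),
  (fun x => phi (T x) * psi1 x + psi (T x) * psi2 x); split.
- by apply: contD; apply: contM.
- by apply: contD; apply: contM.
- by rewrite p p' p1 p2.
- by rewrite p p' p1' p2'.
- have {}h : \forall q' \near q, A q' -> B (T q') -> f (T q') =
      f (T q) + phi (T q') * (T q' 0 0 - T q 0 0) + psi (T q') * (T q' 0 1 - T q 0 1).
    exact: cT h.
  near=> x => Ax; have E : B (T x) by apply: (near AB x).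
  have {}E := near h x _ Ax E; rewrite /= E//.
  by rewrite (near h1 x _ Ax)// (near h2 x _ Ax)//; ring.
Unshelve. all: by end_near. Qed.

Lemma wd_comp1 A f (k : R -> R) q a b k' : A q -> wd A f q a b ->
  is_derive (f q) 1 k k' -> wd A (k \o f) q (k' * a) (k' * b).
Proof.
move=> Aq wf dk; have cf := wd_cont Aq wf.
(* The difference quotient of [k] based at [f q], continued by [k']; its continuity there is the
   derivability of [k]. *)
pose kap y := if y == f q then k' else (k y - k (f q)) / (y - f q).
have ckap : {for f q, continuous kap}.
  have [dk1 dk2] := dk.
  rewrite /prop_for /continuous_at {2}/kap eqxx.
  have := dk1; rewrite /derivable => /cvg_ex[/= l hl].
  have l' : l = k' by rewrite -dk2 /derive; symmetry; exact: cvg_lim hl.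
  rewrite l' in hl.
  apply/cvgrPdist_lt => e e0; move/cvgrPdist_lt : hl => /(_ _ e0).
  move=> /nbhs_normP[d /= d0 hd]; apply/nbhs_normP; exists d => //= y yd.
  rewrite /kap; case: eqP => [_|/eqP yq]; first by rewrite subrr normr0.
  have yd' : `|0 - (y - f q)| < d by rewrite sub0r normrN distrC.
  have yq' : y - f q != 0 by rewrite subr_eq0.
  have /= := hd _ yd' yq'.
  by rewrite [_ *: 1]mulr1 subrK [_ *: _]mulrC.
have kE y : k y = k (f q) + kap y * (y - f q).
  rewrite /kap; case: eqP => [->|/eqP yq]; first by rewrite subrr mulr0 addr0.
  by rewrite divfK ?subr_eq0// addrC subrK.
have ck : cont A (kap \o f) q by exact: cont_comp1 cf _.
move: wf => [phi [psi [c c' p p' h]]].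
exists (fun x => kap (f x) * phi x), (fun x => kap (f x) * psi x); split.
- exact: contM.
- exact: contM.
- by rewrite p /kap eqxx.
- by rewrite p' /kap eqxx.
- by near=> x => Ax; rewrite /= kE {2}(near h x)//; ring.
Unshelve. all: by end_near. Qed.

Lemma scaleRE (t y : R) : t *: y = t * y. Proof. by []. Qed.

Lemma addv0E q h : q + h *: delta_mx 0 0 = pt (q 0 0 + h) (q 0 1).
Proof.
by apply: eq_pt; rewrite ?pt0 ?pt1 !mxE !eqxx/= ?mulr1 ?mulr0 ?addr0.
Qed.

Lemma addv1E q h : q + h *: delta_mx 0 1 = pt (q 0 0) (q 0 1 + h).
Proof.
by apply: eq_pt; rewrite ?pt0 ?pt1 !mxE !eqxx/= ?mulr1 ?mulr0 ?addr0.
Qed.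

Lemma adm_line0 A q : adm A -> A q ->
  \forall h \near (0 : R), A (q + h *: delta_mx 0 0).
Proof.
move=> admA /admA /near_ptP[e e0 eP]; apply/nbhs_normP; exists e => // h.
by rewrite /ball_/= distrC subr0 addv0E => he; apply: eP; rewrite ?pt0 ?pt1// ?subrr ?normr0// addrAC subrr add0r.
Qed.

Lemma adm_line1 A q : adm A -> A q ->
  \forall h \near (0 : R), 0 <= h -> A (q + h *: delta_mx 0 1).
Proof.
move=> admA /admA /near_ptP[e e0 eP]; apply/nbhs_normP; exists e => // h.
rewrite /ball_/= distrC subr0 addv1E => he h0; apply: eP;
  by rewrite ?pt0 ?pt1// ?subrr ?normr0 ?lerDl// addrAC subrr add0r.
Qed.

(** Along the ray the difference quotient is [G] at the moving point, so its limit is the continuity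
    of [G] within [A]. *)
Lemma rderive_cvg f (G : V -> R) (v : V) A q : A q ->
  (\forall h \near (0 : R)^'+, A (q + h *: v)) -> cont A G q ->
  (\forall h \near (0 : R)^'+, f (q + h *: v) - f q = h *: G (q + h *: v)) ->
  (h^-1 *: (f (q + h *: v) - f q)) @[h --> 0^'+] --> G q.
Proof.
move=> Aq hA cG hF.
have line : (q + h *: v) @[h --> (0 : R)^'+] --> q.
  rewrite -[X in _ --> X]addr0 -[X in _ --> q + X](scale0r v).
  apply: cvgD; first exact: cvg_cst.
  by apply: cvgZr_tmp; apply: cvg_at_right_filter; exact: cvg_id.
suff : G (q + h *: v) @[h --> (0 : R)^'+] --> G q.
  apply: cvg_trans; apply: near_eq_cvg; near=> h.
  by rewrite (near hF h)// scalerA mulVf ?scale1r.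
move=> P /cG h; have {}h : \forall q' \near q, A q' -> P (G q') by exact: h.
have {}h := line _ h.
by apply: filterS2 hA h => x Ax /(_ Ax).
Unshelve. all: by end_near. Qed.

Lemma wd_cvg A f q a b : adm A -> A q -> wd A f q a b ->
  (h^-1 *: (f (q + h *: delta_mx 0 0) - f q)) @[h --> 0^'+] --> a /\
  (h^-1 *: (f (q + h *: delta_mx 0 1) - f q)) @[h --> 0^'+] --> b.
Proof.
move=> admA Aq [phi [psi [c c' <- <- h]]].
have line v : (q + h *: v) @[h --> (0 : R)^'+] --> q.
  rewrite -[X in _ --> X]addr0 -[X in _ --> q + X](scale0r v).
  apply: cvgD; first exact: cvg_cst.
  by apply: cvgZr_tmp; apply: cvg_at_right_filter; exact: cvg_id.
have A0 : \forall h \near (0 : R)^'+, A (q + h *: delta_mx 0 0).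
  exact/cvg_at_right_filter/adm_line0.
have A1 : \forall h \near (0 : R)^'+, A (q + h *: delta_mx 0 1).
  suff : \forall h \near (0 : R), 0 < h -> A (q + h *: delta_mx 0 1) by [].
  by apply: filterS (adm_line1 admA Aq) => t At /ltW; exact: At.
split.
- apply: (@rderive_cvg f phi (delta_mx 0 0) A q Aq A0 c); pose y t := q + t *: delta_mx 0 0.
  have {}h : \forall t \near (0 : R)^'+, A (y t) -> f (y t) =
      f q + phi (y t) * (y t 0 0 - q 0 0) + psi (y t) * (y t 0 1 - q 0 1).
    exact: (line (delta_mx 0 0) _ h).
  apply: filterS2 h A0 => t h At; rewrite h// /y.
  by rewrite addv0E pt0 pt1 scaleRE; ring.
- apply: (@rderive_cvg f psi (delta_mx 0 1) A q Aq A1 c'); pose y t := q + t *: delta_mx 0 1.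
  have {}h : \forall t \near (0 : R)^'+, A (y t) -> f (y t) =
      f q + phi (y t) * (y t 0 0 - q 0 0) + psi (y t) * (y t 0 1 - q 0 1).
    exact: (line (delta_mx 0 1) _ h).
  apply: filterS2 h A1 => t h At; rewrite h// /y.
  by rewrite addv1E pt0 pt1 scaleRE; ring.
Qed.

(** This ties Caratheodory's coefficients to the one-sided [partial], and shows that they are
    unique: for [adm] sets the rays in both coordinate directions stay in [A] for small positive
    time. *)
Lemma wd_partial A f q a b : adm A -> A q -> wd A f q a b ->
  pd 0 f q = a /\ pd 1 f q = b.
Proof.
rewrite !pd.unlock => admA Aq w; have [h0 h1] := wd_cvg admA Aq w.
by split; exact: cvg_lim.
Qed.

Definition C1 A f := forall q, A q ->
  [/\ wd A f q (pd 0 f q) (pd 1 f q), cont A (pd 0 f) q & cont A (pd 1 f) q].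

Definition C2 A f := [/\ C1 A f, C1 A (pd 0 f) & C1 A (pd 1 f)].

(** The way into the C^1 calculus: continuous candidates for the two coefficients give at once the
    regularity and the values of the partial derivatives. *)
Lemma C1I A f f1 f2 : adm A ->
  (forall q, A q -> wd A f q (f1 q) (f2 q)) ->
  (forall q, A q -> cont A f1 q) -> (forall q, A q -> cont A f2 q) ->
  [/\ C1 A f, forall q, A q -> pd 0 f q = f1 q & forall q, A q -> pd 1 f q = f2 q].
Proof.
move=> admA w c1 c2; have e q : A q -> pd 0 f q = f1 q /\ pd 1 f q = f2 q.
  by move=> Aq; apply: wd_partial (w q Aq).
split=> [q Aq|q /e[]//|q /e[]//].
have [-> ->] := e q Aq; split; first exact: w.
  by apply: cont_ext (c1 q Aq) => // q' /e[].
by apply: cont_ext (c2 q Aq) => // q' /e[].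
Qed.

Lemma C1_cont A f q : C1 A f -> A q -> cont A f q.
Proof. by move=> cf Aq; have [w _ _] := cf q Aq; exact: wd_cont w. Qed.

Lemma C1_cont0 A f q : C1 A f -> A q -> cont A (pd 0 f) q.
Proof. by move=> cf Aq; have [] := cf q Aq. Qed.

Lemma C1_cont1 A f q : C1 A f -> A q -> cont A (pd 1 f) q.
Proof. by move=> cf Aq; have [] := cf q Aq. Qed.

Lemma C1_wd A f q : C1 A f -> A q -> wd A f q (pd 0 f q) (pd 1 f q).
Proof. by move=> cf Aq; have [] := cf q Aq. Qed.

Lemma C1_extE A f g : adm A -> C1 A f -> (forall q, A q -> f q = g q) ->
  [/\ C1 A g, forall q, A q -> pd 0 g q = pd 0 f q
   & forall q, A q -> pd 1 g q = pd 1 f q].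
Proof.
move=> admA cf fg; apply: C1I => // q Aq; [|exact: C1_cont0|exact: C1_cont1].
by apply: wd_near_ext (C1_wd cf Aq) => //; apply: near_all => q'; exact: fg.
Qed.

Lemma C1_ext A f g : adm A -> (forall q, A q -> f q = g q) -> C1 A f -> C1 A g.
Proof. by move=> admA fg cf; have [] := C1_extE admA cf fg. Qed.

Lemma C1_subE A B f : adm A -> adm B -> B `<=` A -> C1 A f -> C1 B f.
Proof.
move=> admA admB BA cf q Bq; have [w c c'] := cf q (BA _ Bq).
by split; [exact: wd_sub w|exact: cont_sub c|exact: cont_sub c'].
Qed.

Lemma C1_cst A k : adm A ->
  [/\ C1 A (fun=> k), forall q, A q -> pd 0 (fun=> k) q = 0 & forall q, A q -> pd 1 (fun=> k) q = 0].
Proof. by move=> admA; apply: C1I => // q Aq; [exact: wd_cst|exact: cont_cst|exact: cont_cst]. Qed.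

Lemma C1_x A : adm A ->
  [/\ C1 A (fun q => q 0 0), forall q, A q -> pd 0 (fun q : V => q 0 0) q = 1
    & forall q, A q -> pd 1 (fun q : V => q 0 0) q = 0].
Proof.
by move=> admA; apply: (C1I (f1 := fun=> 1) (f2 := fun=> 0)) => // q Aq; [exact: wd_x|exact: cont_cst|exact: cont_cst].
Qed.

Lemma C1_y A : adm A ->
  [/\ C1 A (fun q => q 0 1), forall q, A q -> pd 0 (fun q : V => q 0 1) q = 0
    & forall q, A q -> pd 1 (fun q : V => q 0 1) q = 1].
Proof.
by move=> admA; apply: (C1I (f1 := fun=> 0) (f2 := fun=> 1)) => // q Aq; [exact: wd_y|exact: cont_cst|exact: cont_cst].
Qed.

Lemma C1D A f g : adm A -> C1 A f -> C1 A g ->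
  [/\ C1 A (fun q => f q + g q),
      forall q, A q -> pd 0 (fun q => f q + g q) q = pd 0 f q + pd 0 g q
    & forall q, A q -> pd 1 (fun q => f q + g q) q = pd 1 f q + pd 1 g q].
Proof.
move=> admA cf cg; apply: C1I => // q Aq.
- by apply: wdD; exact: C1_wd.
- by apply: contD; exact: C1_cont0.
- by apply: contD; exact: C1_cont1.
Qed.

Lemma C1M A f g : adm A -> C1 A f -> C1 A g ->
  [/\ C1 A (fun q => f q * g q),
      forall q, A q -> pd 0 (fun q => f q * g q) q = pd 0 f q * g q + f q * pd 0 g q
    & forall q, A q -> pd 1 (fun q => f q * g q) q = pd 1 f q * g q + f q * pd 1 g q].
Proof.
move=> admA cf cg; apply: C1I => // q Aq.
- by apply: wdM => //; exact: C1_wd.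
- by apply: contD; apply: contM; [exact: (C1_cont0 cf)|exact: (C1_cont cg)|exact: (C1_cont cf)|exact: (C1_cont0 cg)].
- by apply: contD; apply: contM; [exact: (C1_cont1 cf)|exact: (C1_cont cg)|exact: (C1_cont cf)|exact: (C1_cont1 cg)].
Qed.

Lemma C1Z A k f : adm A -> C1 A f ->
  [/\ C1 A (fun q => k * f q),
      forall q, A q -> pd 0 (fun q => k * f q) q = k * pd 0 f q
    & forall q, A q -> pd 1 (fun q => k * f q) q = k * pd 1 f q].
Proof.
move=> admA cf; have [ck ck0 ck1] := C1_cst k admA; have [c c0 c1] := C1M admA ck cf.
by split => // q Aq; rewrite ?c0 ?c1// ?ck0 ?ck1// mul0r add0r.
Qed.

Lemma C1N A f : adm A -> C1 A f ->
  [/\ C1 A (fun q => - f q),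
      forall q, A q -> pd 0 (fun q => - f q) q = - pd 0 f q
    & forall q, A q -> pd 1 (fun q => - f q) q = - pd 1 f q].
Proof.
move=> admA cf; have [c c0 c1] := C1Z (-1) admA cf.
have [|ce ce0 ce1] := @C1_extE _ _ (fun q => - f q) admA c.
  by move=> q _; rewrite mulN1r.
by split=> // q Aq; rewrite ?ce0 ?ce1 ?c0 ?c1// mulN1r.
Qed.

Lemma C1B A f g : adm A -> C1 A f -> C1 A g ->
  [/\ C1 A (fun q => f q - g q),
      forall q, A q -> pd 0 (fun q => f q - g q) q = pd 0 f q - pd 0 g q
    & forall q, A q -> pd 1 (fun q => f q - g q) q = pd 1 f q - pd 1 g q].
Proof.
move=> admA cf cg; have [cn n0 n1] := C1N admA cg; have [c c0 c1] := C1D admA cf cn.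
by split=> // q Aq; rewrite ?c0 ?c1// ?n0 ?n1.
Qed.

Lemma C1_comp A B T f : adm A -> adm B -> (forall q, A q -> B (T q)) ->
  C1 A (fun q => T q 0 0) -> C1 A (fun q => T q 0 1) -> C1 B f ->
  [/\ C1 A (f \o T),
      forall q, A q -> pd 0 (f \o T) q = pd 0 f (T q) * pd 0 (fun q => T q 0 0) q
         + pd 1 f (T q) * pd 0 (fun q => T q 0 1) q
    & forall q, A q -> pd 1 (f \o T) q = pd 0 f (T q) * pd 1 (fun q => T q 0 0) q
         + pd 1 f (T q) * pd 1 (fun q => T q 0 1) q].
Proof.
move=> admA admB AB cT1 cT2 cf.
have cT q : A q -> cont A T q by move=> Aq; apply: cont_vec; exact: C1_cont.
have AB' q : \forall q' \near q, A q' -> B (T q') by apply: near_all.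
have cc h q : (forall q, B q -> cont B h q) -> A q -> cont A (fun q => h (T q)) q.
  by move=> ch Aq; apply: (cont_comp (AB' q)); [exact: cT|apply: ch; exact: AB].
apply: C1I => // q Aq.
- by apply: (wd_comp (AB' q)) => //; apply: C1_wd => //; exact: AB.
- by apply: contD; apply: contM; [apply: cc|exact: (C1_cont0 cT1)|apply: cc|exact: (C1_cont0 cT2)] => //;
    move=> q' Bq'; [exact: (C1_cont0 cf)|exact: (C1_cont1 cf)].
- by apply: contD; apply: contM; [apply: cc|exact: (C1_cont1 cT1)|apply: cc|exact: (C1_cont1 cT2)] => //;
    move=> q' Bq'; [exact: (C1_cont0 cf)|exact: (C1_cont1 cf)].
Qed.

Lemma C1_comp1 A f (k k' : R -> R) : adm A -> C1 A f ->
  (forall q, A q -> is_derive (f q) 1 k (k' (f q))) ->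
  (forall q, A q -> {for f q, continuous k'}) ->
  [/\ C1 A (k \o f),
      forall q, A q -> pd 0 (k \o f) q = k' (f q) * pd 0 f q
    & forall q, A q -> pd 1 (k \o f) q = k' (f q) * pd 1 f q].
Proof.
move=> admA cf dk ck; apply: C1I => // q Aq.
- by apply: wd_comp1 => //; [exact: C1_wd|exact: dk].
- by apply: contM; [apply: (@cont_comp1 A f k'); [exact: C1_cont|exact: ck]|exact: C1_cont0].
- by apply: contM; [apply: (@cont_comp1 A f k'); [exact: C1_cont|exact: ck]|exact: C1_cont1].
Qed.

Lemma near_capP A B q (P : set V) : (\forall q' \near q, B q') ->
  (\forall q' \near q, (A `&` B) q' -> P q') -> \forall q' \near q, A q' -> P q'.
Proof. by move=> h1 h2; apply: filterS2 h1 h2 => x Bx h Ax; exact: h. Qed.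

Lemma cont_local (W : topologicalType) A B (f : V -> W) q : (\forall q' \near q, B q') ->
  cont (A `&` B) f q -> cont A f q.
Proof. by move=> h cf P /cf; exact: near_capP. Qed.

Lemma wd_local A B f q a b : (\forall q' \near q, B q') ->
  wd (A `&` B) f q a b -> wd A f q a b.
Proof.
move=> h [phi [psi [c c' p p' hh]]]; exists phi, psi; split => //;
  [exact: cont_local h c|exact: cont_local h c'|exact: near_capP h hh].
Qed.

Lemma C1_local A f : (forall q, A q -> exists B, (\forall q' \near q, B q') /\ C1 (A `&` B) f) ->
  C1 A f.
Proof.
move=> h q Aq; have [B [hB cf]] := h q Aq.
have [w c c'] := cf q (conj Aq (nbhs_singleton hB)).
by split; [exact: wd_local hB w|exact: cont_local hB c|exact: cont_local hB c'].
Qed.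

Lemma adm_open A : open A -> adm A.
Proof. by move=> oA q Aq; near=> x; move=> _; near: x; exact: open_nbhs_nbhs. Unshelve. all: by end_near. Qed.

Lemma admI A B : adm A -> adm B -> adm (A `&` B).
Proof.
move=> hA hB q [/hA h1 /hB h2]; apply: filterS2 h1 h2 => x h1 h2 h; split; [exact: h1|exact: h2].
Qed.

Lemma C2_ext A f g : adm A -> (forall q, A q -> f q = g q) -> C2 A f -> C2 A g.
Proof.
move=> admA fg [c c0 c1]; have [e e0 e1] := C1_extE admA c fg.
split; first exact: e.
  by apply: (C1_ext admA (fun q Aq => esym (e0 q Aq)) c0).
by apply: (C1_ext admA (fun q Aq => esym (e1 q Aq)) c1).
Qed.

Lemma C2_sub A B f : adm A -> adm B -> B `<=` A -> C2 A f -> C2 B f.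
Proof. by move=> a b ba [c c0 c1]; split; [exact: C1_subE c|exact: C1_subE c0|exact: C1_subE c1]. Qed.

Lemma C2_local A f : (forall q, A q -> exists B, (\forall q' \near q, B q') /\ C2 (A `&` B) f) ->
  C2 A f.
Proof.
by move=> h; split; apply: C1_local => q Aq; case: (h q Aq) => B [hB [c c0 c1]]; exists B.
Qed.

Lemma C2D A f g : adm A -> C2 A f -> C2 A g -> C2 A (fun q => f q + g q).
Proof.
move=> admA [c c0 c1] [e e0 e1]; have [h h0 h1] := C1D admA c e; split => //.
  by apply: (C1_ext admA (fun q Aq => esym (h0 q Aq))); have [] := C1D admA c0 e0.
by apply: (C1_ext admA (fun q Aq => esym (h1 q Aq))); have [] := C1D admA c1 e1.
Qed.

Lemma C2M A f g : adm A -> C2 A f -> C2 A g -> C2 A (fun q => f q * g q).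
Proof.
move=> admA [c c0 c1] [e e0 e1]; have [h h0 h1] := C1M admA c e; split => //.
  apply: (C1_ext admA (fun q Aq => esym (h0 q Aq))).
  have [X _ _] := C1M admA c0 e; have [Y _ _] := C1M admA c e0.
  by have [] := C1D admA X Y.
apply: (C1_ext admA (fun q Aq => esym (h1 q Aq))).
have [X _ _] := C1M admA c1 e; have [Y _ _] := C1M admA c e1.
by have [] := C1D admA X Y.
Qed.

Lemma C2_cst A k : adm A -> C2 A (fun=> k).
Proof.
move=> admA; have [h h0 h1] := C1_cst k admA; have [z _ _] := C1_cst 0 admA.
by split => //; [apply: (C1_ext admA (fun q Aq => esym (h0 q Aq)))|apply: (C1_ext admA (fun q Aq => esym (h1 q Aq)))].
Qed.

Lemma C2_x A : adm A -> C2 A (fun q => q 0 0).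
Proof.
move=> admA; have [h h0 h1] := C1_x admA; have [z _ _] := C1_cst 0 admA; have [k _ _] := C1_cst 1 admA.
by split => //; [apply: (C1_ext admA (fun q Aq => esym (h0 q Aq)))|apply: (C1_ext admA (fun q Aq => esym (h1 q Aq)))].
Qed.

Lemma C2_y A : adm A -> C2 A (fun q => q 0 1).
Proof.
move=> admA; have [h h0 h1] := C1_y admA; have [z _ _] := C1_cst 0 admA; have [k _ _] := C1_cst 1 admA.
by split => //; [apply: (C1_ext admA (fun q Aq => esym (h0 q Aq)))|apply: (C1_ext admA (fun q Aq => esym (h1 q Aq)))].
Qed.

Lemma C2_comp A B T f : adm A -> adm B -> (forall q, A q -> B (T q)) ->
  C2 A (fun q => T q 0 0) -> C2 A (fun q => T q 0 1) -> C2 B f -> C2 A (f \o T).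
Proof.
move=> admA admB AB [a a0 a1] [b b0 b1] [c c0 c1].
have [h h0 h1] := C1_comp admA admB AB a b c.
have [k0 _ _] := C1_comp admA admB AB a b c0.
have [k1 _ _] := C1_comp admA admB AB a b c1.
split => //.
  apply: (C1_ext admA (fun q Aq => esym (h0 q Aq))).
  have [X _ _] := C1M admA k0 a0; have [Y _ _] := C1M admA k1 b0.
  by have [] := C1D admA X Y.
apply: (C1_ext admA (fun q Aq => esym (h1 q Aq))).
have [X _ _] := C1M admA k0 a1; have [Y _ _] := C1M admA k1 b1.
by have [] := C1D admA X Y.
Qed.

Lemma C2_comp1 A f (k k' k'' : R -> R) : adm A -> C2 A f ->
  (forall q, A q -> is_derive (f q) 1 k (k' (f q))) ->
  (forall q, A q -> is_derive (f q) 1 k' (k'' (f q))) ->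
  (forall q, A q -> {for f q, continuous k''}) -> C2 A (k \o f).
Proof.
move=> admA [c c0 c1] dk dk' ck''.
have ck' q : A q -> {for f q, continuous k'}.
  by move=> /dk'[h _]; apply: differentiable_continuous; exact/derivable1_diffP.
have [h h0 h1] := C1_comp1 admA c dk ck'.
have [e _ _] := C1_comp1 admA c dk' ck''.
split => //.
  by apply: (C1_ext admA (fun q Aq => esym (h0 q Aq))); have [] := C1M admA e c0.
by apply: (C1_ext admA (fun q Aq => esym (h1 q Aq))); have [] := C1M admA e c1.
Qed.

End Differentiability.

(** * Green's formula on rectangles *)

Section Green.
Variable R : realType.
Local Notation V := 'rV[R]_2.
Implicit Types (A B : set V) (q : V) (f g : V -> R) (T : V -> V) (a b c d : R).

Definition box a b c d : set V := [set q | a <= q 0 0 <= b /\ c <= q 0 1 <= d].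

Lemma box_pt a b c d u v : box a b c d (pt u v) <-> a <= u <= b /\ c <= v <= d.
Proof. by rewrite /box/= pt0 pt1. Qed.

Lemma caratheodory_derive (k kap : R -> R) (y : R) :
  (\forall z \near y, k z = k y + kap z * (z - y)) -> {for y, continuous kap} ->
  is_derive y 1 k (kap y).
Proof.
move=> hk ck.
have H : (h^-1 *: ((k \o shift y) (h *: 1) - k y)) @[h --> (0 : R)^'] --> kap y.
  have sh : h + y @[h --> (0:R)^'] --> y.
    rewrite -[X in _ --> X]add0r; apply: cvgD; last exact: cvg_cst.
    by apply: cvg_within_filter; exact: cvg_id.
  have : kap (h + y) @[h --> (0 : R)^'] --> kap y by exact: cvg_comp sh ck.
  apply: cvg_trans; apply: near_eq_cvg.
  have {}hk : \forall h \near (0:R)^', k (h + y) = k y + kap (h + y) * (h + y - y) by exact: sh hk.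
  near=> h; have h0 : h != 0 by near: h; exact: nbhs_dnbhs_neq.
  by rewrite /= (scaleRE h 1) mulr1 (near hk h)// scaleRE; field.
split; last exact: cvg_lim H.
by apply/cvg_ex; exists (kap y).
Unshelve. all: by end_near. Qed.

Lemma near_pt0 q (P : set V) : (\forall q' \near q, P q') -> \forall u \near q 0 0, P (pt u (q 0 1)).
Proof.
move=> /near_ptP[e e0 eP]; apply/nbhs_normP; exists e => //= u qu.
by apply: eP; rewrite ?pt0 ?pt1 ?subrr ?normr0// distrC.
Qed.

Lemma near_pt1 q (P : set V) : (\forall q' \near q, P q') -> \forall v \near q 0 1, P (pt (q 0 0) v).
Proof.
move=> /near_ptP[e e0 eP]; apply/nbhs_normP; exists e => //= u qu.
by apply: eP; rewrite ?pt0 ?pt1 ?subrr ?normr0// distrC.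
Qed.

Lemma wd_derive0 A f q a b : (\forall u \near q 0 0, A (pt u (q 0 1))) -> wd A f q a b ->
  is_derive (q 0 0) 1 (fun u => f (pt u (q 0 1))) a.
Proof.
move=> hA [phi [psi [c c' <- _ h]]].
have -> : phi q = phi (pt (q 0 0) (q 0 1)) by rewrite ptE.
apply: (@caratheodory_derive _ (fun u => phi (pt u (q 0 1)))).
  apply: filterS2 hA (near_pt0 h) => u Au /(_ Au) ->.
  by rewrite pt0 pt1 subrr mulr0 addr0 ptE.
rewrite /prop_for /continuous_at ptE => P /c h'.
have {}h' : \forall q' \near q, A q' -> P (phi q') by exact: h'.
by apply: filterS2 hA (near_pt0 h') => u Au /(_ Au).
Qed.

Lemma wd_derive1 A f q a b : (\forall v \near q 0 1, A (pt (q 0 0) v)) -> wd A f q a b ->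
  is_derive (q 0 1) 1 (fun v => f (pt (q 0 0) v)) b.
Proof.
move=> hA [phi [psi [c c' _ <- h]]].
have -> : psi q = psi (pt (q 0 0) (q 0 1)) by rewrite ptE.
apply: (@caratheodory_derive _ (fun v => psi (pt (q 0 0) v))).
  apply: filterS2 hA (near_pt1 h) => u Au /(_ Au) ->.
  by rewrite pt0 pt1 subrr mulr0 addr0 ptE.
rewrite /prop_for /continuous_at ptE => P /c' h'.
have {}h' : \forall q' \near q, A q' -> P (psi q') by exact: h'.
by apply: filterS2 hA (near_pt1 h') => u Au /(_ Au).
Qed.

Lemma slice0_cont A f a b v : (forall u, a <= u <= b -> A (pt u v)) ->
  (forall q, A q -> cont A f q) -> cont_on a b (fun u => f (pt u v)).
Proof.
move=> hA cf; apply/cont_onP => u uab P /(cf _ (hA _ uab)) h.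
have {}h : \forall q' \near pt u v, A q' -> P (f q') by exact: h.
have {}h := near_pt0 h; rewrite pt0 pt1 in h.
suff : \forall u' \near u, u' \in `[a, b] -> P (f (pt u' v)) by [].
by apply: filterS h => u' + u'ab; apply; apply: hA; move: u'ab; rewrite in_itv.
Qed.

Lemma slice1_cont A f a b u : (forall v, a <= v <= b -> A (pt u v)) ->
  (forall q, A q -> cont A f q) -> cont_on a b (fun v => f (pt u v)).
Proof.
move=> hA cf; apply/cont_onP => v uab P /(cf _ (hA _ uab)) h.
have {}h : \forall q' \near pt u v, A q' -> P (f q') by exact: h.
have {}h := near_pt1 h; rewrite pt0 pt1 in h.
suff : \forall u' \near v, u' \in `[a, b] -> P (f (pt u u')) by [].
by apply: filterS h => u' + u'ab; apply; apply: hA; move: u'ab; rewrite in_itv.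
Qed.

Lemma slice0_derive A f u v : adm A -> A (pt u v) -> C1 A f ->
  is_derive u 1 (fun u => f (pt u v)) (pd 0 f (pt u v)).
Proof.
move=> admA Au cf; have := @wd_derive0 A f (pt u v) _ _ _ (C1_wd cf Au).
rewrite pt0 pt1; apply.
have := adm_line0 admA Au => /nbhs_normP[e /= e0 he]; apply/nbhs_normP; exists e => //= u' uu'.
have /he : ball_ Num.Def.normr 0 e (u' - u) by rewrite /ball_/= sub0r normrN distrC.
by rewrite addv0E pt0 pt1 addrC subrK.
Qed.

(** At a point of the boundary line the vertical derivative is only one-sided. Hence [v] is interior
    to a vertical segment lying in [A], which is all that the fundamental theorem of calculus asks
    for. *)
Lemma slice1_derive A f u v a b : C1 A f -> (forall w, a < w < b -> A (pt u w)) -> a < v < b ->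
  is_derive v 1 (fun v => f (pt u v)) (pd 1 f (pt u v)).
Proof.
move=> cf hA vab; have := @wd_derive1 A f (pt u v) _ _ _ (C1_wd cf (hA _ vab)).
rewrite pt0 pt1; apply.
have : v \in `]a, b[ by rewrite in_itv.
move=> /near_in_itvoo; apply: filterS => w; rewrite in_itv/=; exact: hA.
Qed.

Lemma box_compact a b c d : compact (box a b c d).
Proof.
have := @rV_compact R 2 (fun i => if i == 0 then `[a, b]%classic else `[c, d]%classic).
rewrite (_ : [set _ | _] = box a b c d).
  by apply => i; case: ifP => _; exact: segment_compact.
apply/seteqP; split => q /=.
  by move=> h; split; [have := h 0|have := h 1]; rewrite /= in_itv.
by move=> [h0 h1]; apply: ord2P; rewrite /= in_itv.
Qed.

(** Heine's theorem, with continuity within the closed box only, since the box may rest on the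
    boundary line. *)
Lemma box_unif a b c d f : (forall q, box a b c d q -> cont (box a b c d) f q) ->
  forall e : R, 0 < e -> exists2 dl : R, 0 < dl & forall q q', box a b c d q -> box a b c d q' ->
    `|q' 0 0 - q 0 0| < dl -> `|q' 0 1 - q 0 1| < dl -> `|f q' - f q| < e.
Proof.
move=> cf e e0; have /compact_near_coveringP H := @box_compact a b c d.
have e2 : 0 < e / 2 by rewrite divr_gt0.
pose P (dl : R) q := box a b c d q -> forall q', box a b c d q' ->
    `|q' 0 0 - q 0 0| < dl -> `|q' 0 1 - q 0 1| < dl -> `|f q' - f q| < e.
have := H R (0 : R)^'+ P _; case.
- move=> x Bx; have h := (@cvgrPdist_lt _ _ _ _ _ _ _).1 (cf x Bx) _ e2.
  have {h}/near_ptP[r r0 hr] : \forall q' \near x, box a b c d q' -> `|f x - f q'| < e / 2 by exact: h.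
  have r2 : 0 < r / 2 by rewrite divr_gt0.
  exists ([set q' : V | `|q' 0 0 - x 0 0| < r / 2 /\ `|q' 0 1 - x 0 1| < r / 2], [set dl : R | dl < r / 2]).
    split => /=.
      by apply/near_ptP; exists (r / 2).
    exact: nbhs_right_lt.
  move=> [q dl] /= [[h0 h1] hdl] Bq q' Bq' h0' h1'.
  have lem (s t w : R) : `|s - t| < r / 2 -> `|w - s| < dl -> `|w - t| < r.
    move=> k k'; rewrite -(subrKA s) (splitr r); apply: le_lt_trans (ler_normD _ _) _.
    by apply: ltrD => //; exact: lt_trans k' hdl.
  have l1 : `|f x - f q| < e / 2.
    by apply: hr => //; [apply: lt_trans h0 _|apply: lt_trans h1 _]; rewrite ltr_pdivrMr// ltr_pMr// ltr1n.
  have l2 : `|f x - f q'| < e / 2.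
    by apply: hr => //; [exact: lem h0 h0'|exact: lem h1 h1'].
  rewrite -(subrKA (f x)) (splitr e); apply: le_lt_trans (ler_normD _ _) _.
  by apply: ltrD => //; rewrite distrC.
- move=> dl /= d0 hdl; exists (dl / 2); first by rewrite divr_gt0.
  move=> q q' Bq Bq' h0 h1.
  apply: (hdl (dl / 2) _ _ q) => //=; last by rewrite divr_gt0.
  rewrite sub0r normrN gtr0_norm ?divr_gt0// ltr_pdivrMr// ltr_pMr// ltr1n//.
Qed.

Lemma is_derive_continuous (k : R -> R) (x l : R) : is_derive x 1 k l -> {for x, continuous k}.
Proof. by move=> [h _]; apply: differentiable_continuous; exact/derivable1_diffP. Qed.

Lemma cont_on_derive (k k' : R -> R) a b :
  (forall w, a <= w <= b -> is_derive w 1 k (k' w)) -> cont_on a b k.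
Proof.
move=> dk; apply/cont_onP => w wab; apply: cvg_within_filter.
exact: is_derive_continuous (dk w wab).
Qed.

(** The mean value theorem compares [k] with its linearization of slope [l]. The points [s] and [z]
    come in any order, because difference quotients are taken on both sides. *)
Lemma mvt_bound (k k' : R -> R) (l s z e : R) :
  (forall w, Num.min s z <= w <= Num.max s z -> is_derive w 1 k (k' w)) ->
  (forall w, Num.min s z <= w <= Num.max s z -> `|k' w - l| <= e) ->
  `|k z - k s - l * (z - s)| <= e * `|z - s|.
Proof.
wlog sz : s z / s <= z => [H|].
  have /orP[sz|zs] := le_total s z; first exact: H.
  rewrite minC maxC => h1 h2; have := H z s zs h1 h2.
  by rewrite -normrN [`|s - z|]distrC; congr (`|_| <= _); ring.
rewrite (min_idPl sz) (max_idPr sz) => dk bk.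
have [w||] := @MVT_segment R k k' s z sz.
- by rewrite in_itv/= => /andP[h1 h2]; apply: dk; rewrite (ltW h1) (ltW h2).
- exact: cont_on_derive dk.
move=> w; rewrite in_itv/= => wsz ->.
by rewrite -mulrBl normrM ler_wpM2r//; exact: bk.
Qed.

Lemma eps_scale (e m : R) : 0 < e -> 0 <= m -> exists2 e' : R, 0 < e' & e' * m < e.
Proof.
(* The denominator is [m + 1] because the length [m] may be 0. *)
move=> e0 m0; exists (e / (m + 1)); first by rewrite divr_gt0// ltr_wpDl.
by rewrite -mulrA gtr_pMr// mulrC ltr_pdivrMr ?ltr_wpDl// mul1r ltrDl.
Qed.

Lemma cont_box_slice1 a b c d f u : (forall q, box a b c d q -> cont (box a b c d) f q) ->
  a <= u <= b -> cont_on c d (fun v => f (pt u v)).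
Proof. by move=> cf uab; apply: slice1_cont cf => v vcd; apply/box_pt. Qed.

Lemma pint_cont a b c d f : c <= d -> (forall q, box a b c d q -> cont (box a b c d) f q) ->
  cont_on a b (fun u => rint c d (fun v => f (pt u v))).
Proof.
move=> cd cf; apply/cont_onP => u uab; apply/(@cvgrPdist_lt _ _ _ _ _) => e e0.
have dc0 : 0 <= d - c by rewrite subr_ge0.
have [e' e'0 e'e] := eps_scale e0 dc0.
have [dl dl0 hdl] := box_unif cf e'0.
suff : \forall u' \near u, u' \in `[a, b] -> `|rint c d (fun v => f (pt u v)) - rint c d (fun v => f (pt u' v))| < e by [].
apply/nbhs_normP; exists dl => //= u' uu' u'ab; rewrite in_itv/= in u'ab.
rewrite -rintB; [|exact: cont_box_slice1 cf _|exact: cont_box_slice1 cf _].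
apply: le_lt_trans e'e; apply: rint_le_norm => //.
  by apply: cont_onB; exact: cont_box_slice1 cf _.
by move=> v vcd; apply/ltW/hdl; rewrite ?pt0 ?pt1 ?subrr ?normr0//; exact/box_pt.
Qed.

(** The remainder [f(z,v) - f(u,v) - (z - u) pd 0 f(u,v)] is at most [e' |z - u|] uniformly in [v],
    by the mean value theorem in [z] and the uniform continuity of [pd 0 f] on the box; then it is
    integrated over [v]. *)
Lemma leibniz A f a b c d u : adm A -> box a b c d `<=` A -> C1 A f -> c <= d -> a < u < b ->
  is_derive u 1 (fun u => rint c d (fun v => f (pt u v))) (rint c d (fun v => pd 0 f (pt u v))).
Proof.
move=> admA BA cf cd uab; have uab' : a <= u <= b by case/andP: uab => /ltW -> /ltW ->.
set J := fun u => rint c d (fun v => f (pt u v)); set J1 := rint c d _.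
pose kap z := if z == u then J1 else (J z - J u) / (z - u).
have -> : J1 = kap u by rewrite /kap eqxx.
have cfB q : box a b c d q -> cont (box a b c d) f q.
  by move=> Bq; apply: (cont_sub BA); apply: C1_cont => //; exact: BA.
have cf0B q : box a b c d q -> cont (box a b c d) (pd 0 f) q.
  by move=> Bq; apply: (cont_sub BA); apply: C1_cont0 => //; exact: BA.
apply: caratheodory_derive.
  apply: filterE => z; rewrite /kap; case: eqP => [->|/eqP zu]; first by rewrite subrr mulr0 addr0.
  by rewrite divfK ?subr_eq0// addrC subrK.
rewrite /prop_for /continuous_at {2}/kap eqxx; apply/cvgrPdist_lt => e e0.
have dc0 : 0 <= d - c by rewrite subr_ge0.
have [e' e'0 e'e] := eps_scale e0 dc0.
have [dl dl0 hdl] := box_unif cf0B e'0.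
have hu : \forall z \near u, a <= z <= b.
  have : u \in `]a, b[ by rewrite in_itv.
  by move=> /near_in_itvoo; apply: filterS => w; rewrite in_itv/= => /andP[/ltW -> /ltW ->].
have hd : \forall z \near u, `|z - u| < dl.
  by apply/nbhs_normP; exists dl => //= z; rewrite distrC.
apply: filterS2 hu hd => z zab zdl; rewrite /kap; case: eqP => [_|/eqP zu]; first by rewrite subrr normr0.
have zu0 : 0 < `|z - u| by rewrite normr_gt0 subr_eq0.
have -> : J1 - (J z - J u) / (z - u) = - ((J z - J u - J1 * (z - u)) / (z - u)).
  by field; rewrite subr_eq0.
rewrite normrN normrM normfV ltr_pdivrMr//.
apply: (@le_lt_trans _ _ ((e' * `|z - u|) * (d - c))); last first.
  by rewrite mulrAC ltr_pM2r.
have c1 := cont_box_slice1 cfB zab; have c2 := cont_box_slice1 cfB uab'; have c3 := cont_box_slice1 cf0B uab'.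
have -> : J z - J u - J1 * (z - u) =
   rint c d (fun v => f (pt z v) - f (pt u v) - (z - u) * pd 0 f (pt u v)).
  rewrite !rintB ?rintZ//; [by rewrite mulrC|exact: cont_onB|].
  by apply: cont_onM => //; exact: cont_on_cst.
apply: rint_le_norm => //.
  by apply: cont_onB; [exact: cont_onB|apply: cont_onM => //; exact: cont_on_cst].
move=> v vcd; rewrite [_ * pd _ _ _]mulrC.
have mm w : Num.min u z <= w <= Num.max u z -> a <= w <= b /\ `|w - u| <= `|z - u|.
  case/andP: zab => z1 z2; case/andP: uab' => u1 u2.
  have /orP[uz|uz] := le_total u z; rewrite ?(min_idPl uz) ?(max_idPr uz) ?(min_idPr uz) ?(max_idPl uz) => /andP[w1 w2].
    by rewrite (le_trans u1 w1) (le_trans w2 z2) !ger0_norm ?subr_ge0// lerD2r.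
  by rewrite (le_trans z1 w1) (le_trans w2 u2) !ler0_norm ?subr_le0// lerN2 lerD2r.
apply: (@mvt_bound (fun w => f (pt w v)) (fun w => pd 0 f (pt w v))).
  by move=> w /mm[wab _]; apply: (slice0_derive (A := A)) => //; apply: BA; exact/box_pt.
move=> w /mm[wab wz]; apply/ltW/hdl; rewrite ?pt0 ?pt1 ?subrr ?normr0//; try exact/box_pt.
exact: le_lt_trans zdl.
Qed.

Definition rint2 a b c d f := rint a b (fun u => rint c d (fun v => f (pt u v))).

Lemma cont_sub_box A f a b c d : box a b c d `<=` A -> (forall q, A q -> cont A f q) ->
  forall q, box a b c d q -> cont (box a b c d) f q.
Proof. by move=> BA cf q Bq; apply: (cont_sub BA); apply: cf; exact: BA. Qed.

Lemma green A P Q a b c d : adm A -> box a b c d `<=` A -> a <= b -> c <= d -> C1 A P -> C1 A Q ->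
  rint2 a b c d (fun q => pd 0 Q q - pd 1 P q) =
  rint c d (fun v => Q (pt b v)) - rint c d (fun v => Q (pt a v))
  - (rint a b (fun u => P (pt u d)) - rint a b (fun u => P (pt u c))).
Proof.
move=> admA BA ab cd cP cQ.
have cPB := cont_sub_box BA (fun q => C1_cont cP (q := q)).
have cQB := cont_sub_box BA (fun q => C1_cont cQ (q := q)).
have cP1B := cont_sub_box BA (fun q => C1_cont1 cP (q := q)).
have cQ0B := cont_sub_box BA (fun q => C1_cont0 cQ (q := q)).
have cI : cont_on a b (fun u => P (pt u d)).
  by apply: slice0_cont cPB => u uab; apply/box_pt; rewrite lexx cd.
have cI' : cont_on a b (fun u => P (pt u c)).
  by apply: slice0_cont cPB => u uab; apply/box_pt; rewrite lexx cd.
have -> : rint2 a b c d (fun q => pd 0 Q q - pd 1 P q) =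
   rint a b (fun u => rint c d (fun v => pd 0 Q (pt u v)) - (P (pt u d) - P (pt u c))).
  apply: rint_ext => u uab; rewrite rintB; [|exact: cont_box_slice1 cQ0B _|exact: cont_box_slice1 cP1B _].
  congr (_ - _); apply: (@rint_FTC2 _ _ _ _ (fun v => P (pt u v))) => //.
  - exact: cont_box_slice1 cP1B _.
  - exact: cont_box_slice1 cPB _.
  - move=> v vcd; apply: slice1_derive cP _ vcd => w /andP[/ltW w1 /ltW w2].
    by apply: BA; apply/box_pt; rewrite w1 w2.
rewrite rintB; [|exact: pint_cont|exact: cont_onB].
rewrite rintB//; congr (_ - _).
apply: (@rint_FTC2 _ _ _ _ (fun u => rint c d (fun v => Q (pt u v)))) => //; try exact: pint_cont.
by move=> u uab; exact: leibniz BA cQ cd uab.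
Qed.

(** Differentiating [f(., v + t) - f(., v)], the vertical integral of [pd 1 f], under the integral
    sign shows that the difference [D] of the mixed derivatives has integral 0 over every short
    segment starting upwards from [q]; by continuity [D q = 0]. Only points not below [q] occur, so
    boundary points are covered. *)
Lemma schwarz A f q : adm A -> A q -> C2 A f -> pd 0 (pd 1 f) q = pd 1 (pd 0 f) q.
Proof.
move=> admA Aq [cf cf0 cf1].
have /near_ptP[r r0 hr] := admA q Aq.
set u := q 0 0 in hr *; set v := q 0 1 in hr *.
pose s := r / 2; have s0 : 0 < s by rewrite divr_gt0.
have sr : s < r by rewrite /s ltr_pdivrMr// ltr_pMr// ltr1n.
have BA : box (u - s) (u + s) v (v + s) `<=` A.
  move=> q' [/andP[h1 h2] /andP[h3 h4]]; apply: hr => //; apply: le_lt_trans sr.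
    by rewrite ler_norml; apply/andP; split; lra.
  by rewrite ler_norml; apply/andP; split; lra.
pose D q := pd 0 (pd 1 f) q - pd 1 (pd 0 f) q.
have cD : forall q, A q -> cont A D q.
  by move=> q' Aq'; apply: contB; [exact: C1_cont0|exact: C1_cont1].
have uab : u - s < u < u + s by apply/andP; split; lra.
have uab' : u - s <= u <= u + s by apply/andP; split; lra.
have cDB := cont_sub_box BA cD.
have cf01B := cont_sub_box BA (fun q => C1_cont0 cf1 (q := q)).
have cf10B := cont_sub_box BA (fun q => C1_cont1 cf0 (q := q)).
have cf0B := cont_sub_box BA (fun q => C1_cont cf0 (q := q)).
have cf1B := cont_sub_box BA (fun q => C1_cont cf1 (q := q)).
have cfB := cont_sub_box BA (fun q => C1_cont cf (q := q)).
have int0 t : 0 < t <= s -> rint v (v + t) (fun y => D (pt u y)) = 0.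
  move=> /andP[t0 ts].
  have vt : v <= v + t by lra.
  have BB : box (u - s) (u + s) v (v + t) `<=` box (u - s) (u + s) v (v + s).
    by move=> q' [h1 /andP[h2 h3]]; split => //; apply/andP; split; lra.
  have BA' : box (u - s) (u + s) v (v + t) `<=` A by apply: subset_trans BA.
  have sub g : (forall q, box (u - s) (u + s) v (v + s) q -> cont (box (u - s) (u + s) v (v + s)) g q) ->
     forall w, u - s <= w <= u + s -> cont_on v (v + t) (fun y => g (pt w y)).
    by move=> cg w wab; apply: cont_on_sub (cont_box_slice1 cg wab) => //; lra.
  have L := leibniz admA BA' cf1 vt uab.
  have ftc (g : V -> R) w : C1 A g -> u - s <= w <= u + s ->
     rint v (v + t) (fun y => pd 1 g (pt w y)) = g (pt w (v + t)) - g (pt w v).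
    move=> cg wab; apply: (@rint_FTC2 _ _ _ _ (fun y => g (pt w y))) => //.
    - exact: sub (cont_sub_box BA (fun q => C1_cont1 cg (q := q))) _ wab.
    - exact: sub (cont_sub_box BA (fun q => C1_cont cg (q := q))) _ wab.
    - move=> y yv; apply: slice1_derive cg _ yv => z /andP[/ltW z1 /ltW z2].
      by apply: BA'; apply/box_pt; rewrite z1 z2.
  have L' : is_derive u 1 (fun w => f (pt w (v + t)) - f (pt w v)) (pd 0 f (pt u (v + t)) - pd 0 f (pt u v)).
    apply: is_deriveB; apply: (slice0_derive admA) => //; apply: BA'; apply/box_pt; split => //.
      by rewrite vt lexx.
    by rewrite lexx vt.
  have E : rint v (v + t) (fun y => pd 0 (pd 1 f) (pt u y)) = pd 0 f (pt u (v + t)) - pd 0 f (pt u v).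
    have [_ <-] := L; have [_ <-] := L'; apply: near_eq_derive.
    have : u \in `]u - s, u + s[ by rewrite in_itv.
    move=> /near_in_itvoo; apply: filterS => w; rewrite in_itv/= => /andP[/ltW w1 /ltW w2].
    by rewrite ftc// w1 w2.
  rewrite rintB; [|exact: sub cf01B _ uab'|exact: sub cf10B _ uab'].
  by rewrite E ftc// subrr.
(* If [D q] were not 0, then [D] would differ from [D q] by at most [|D q| / 2] on a segment of
   length [t]; as the integral of [D] is 0, this gives [|D q| t <= |D q| t / 2]. *)
apply/eqP; rewrite -subr_eq0 -/(D q); apply/negPn/negP => Dq.
have e0 : 0 < `|D q| / 2 by rewrite divr_gt0// normr_gt0.
have [dl dl0 hdl] := box_unif cDB e0.
pose t := Num.min s (dl / 2).
have t0 : 0 < t by rewrite lt_min s0 divr_gt0.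
have ts : t <= s by rewrite ge_min lexx.
have tdl' : t <= dl / 2 by rewrite ge_min lexx orbT.
have tdl : t < dl by lra.
have vt : v <= v + t by lra.
have cDs : cont_on v (v + t) (fun y => D (pt u y)).
  by apply: cont_on_sub (cont_box_slice1 cDB uab') => //; lra.
have K : `|rint v (v + t) (fun y => D (pt u y) - D q)| <= `|D q| / 2 * (v + t - v).
  apply: rint_le_norm => //.
    by apply: cont_onB => //; exact: cont_on_cst.
  move=> y /andP[y1 y2]; apply/ltW/hdl; rewrite ?pt0 ?pt1 -/u -/v ?subrr ?normr0//.
  - by split; rewrite -/u -/v//; apply/andP; split; lra.
  - by apply/box_pt; split => //; apply/andP; split; lra.
  - by rewrite ger0_norm; lra.
rewrite rintB ?int0 ?t0 ?ts// in K; last exact: cont_on_cst.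
rewrite rint_cst// sub0r normrN normrM [v + t]addrC addrK (gtr0_norm t0) ler_pM2r// in K.
by move: K; rewrite ler_pdivlMr// -[leRHS]mulr1 ler_pM2l ?normr_gt0// lern1.
Qed.

End Green.

(** * Change of variables *)

Section RectangleChangeOfVariables.
Variable R : realType.
Local Notation V := 'rV[R]_2.
Implicit Types (A B : set V) (q : V) (f g : V -> R) (T : V -> V) (a b c d : R).

(** [upper 0] is the half-plane of the charts; other levels [t] serve for affine maps of the whole
    plane, with [t] chosen far below the supports. *)
Definition upper (t : R) : set V := [set q | t <= q 0 1].

Lemma adm_upper t : adm (upper t).
Proof. by move=> q; rewrite /upper/= => tq; apply: near_all => q'; exact: le_trans. Qed.

Lemma between_dist (s z w : R) : Num.min s z <= w <= Num.max s z -> `|w - s| <= `|z - s|.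
Proof.
have /orP[uz|uz] := le_total s z; rewrite ?(min_idPl uz) ?(max_idPr uz) ?(min_idPr uz) ?(max_idPl uz) => /andP[w1 w2].
  by rewrite !ger0_norm ?subr_ge0// lerD2r.
by rewrite !ler0_norm ?subr_le0// lerN2 lerD2r.
Qed.

Lemma itv1_self (s : R) : s - 1 <= s <= s + 1.
Proof. by apply/andP; split; lra. Qed.

Lemma itv1_dist (s w m : R) : m <= 1 -> `|w - s| < m -> s - 1 <= w <= s + 1.
Proof. by move=> m1; rewrite ltr_distl => /andP[h1 h2]; apply/andP; split; lra. Qed.

Lemma prim_bound (k : R -> R) a b s z l e : cont_on a b k -> a <= s <= b -> a <= z <= b ->
  (forall w, Num.min s z <= w <= Num.max s z -> `|k w - l| <= e) ->
  `|rint a z k - rint a s k - l * (z - s)| <= e * `|z - s|.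
Proof.
move=> ck; wlog sz : s z / s <= z => [H hs hz|].
  have /orP[sz|zs] := le_total s z; first exact: H.
  rewrite minC maxC => h; have := H z s zs hz hs h.
  by rewrite -normrN [`|s - z|]distrC; congr (`|_| <= _); ring.
rewrite (min_idPl sz) (max_idPr sz) => /andP[as_ sb] /andP[az zb] bk.
have cz : cont_on a z k by exact: cont_on_sub ck.
have cs : cont_on s z k by exact: cont_on_sub ck.
have -> : rint a z k - rint a s k - l * (z - s) = rint s z k - l * (z - s).
  by rewrite (rint_cat as_ sz cz); ring.
rewrite -rint_cst// -rintB//; last exact: cont_on_cst.
rewrite [`|z - s|]ger0_norm ?subr_ge0//; apply: rint_le_norm => //.
by apply: cont_onB => //; exact: cont_on_cst.
Qed.

(** The endpoint and the abscissa are moved one after the other: the first by continuity of a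
    primitive on the fixed vertical line, the second by uniform continuity on a box. *)
Lemma fubini_prim_cont t f : (forall q, upper t q -> cont (upper t) f q) ->
  forall q, upper t q -> cont (upper t) (fun q => rint t (q 0 1) (fun y => f (pt (q 0 0) y))) q.
Proof.
move=> cf q tq; apply/(@cvgrPdist_lt _ _ _ _ _) => e e0.
set u := q 0 0; set y := q 0 1; have ty : t <= y by [].
have BU : box (u - 1) (u + 1) t (y + 1) `<=` upper t by move=> q' [_ /andP[]].
have cB := cont_sub_box BU cf.
have e2 : 0 < e / 2 by rewrite divr_gt0.
have l0 : 0 <= y + 1 - t by lra.
have [e' e'0 e'e] := eps_scale e2 l0.
have [dl dl0 hdl] := box_unif cB e'0.
have cu : cont_on t (y + 1) (fun z => f (pt u z)).
  by apply: cont_box_slice1 cB _; apply/andP; split; lra.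
have /cont_onP/(_ y) := rint_prim_cont cu.
have -> : t <= y <= y + 1 by apply/andP; split; lra.
move=> /(_ isT) /(@cvgrPdist_lt _ _ _ _ _)/(_ _ e2) h.
have {h}/nbhs_normP[r /= r0 hr] : \forall z \near y, z \in `[t, y + 1] ->
  `|rint t y (fun z => f (pt u z)) - rint t z (fun z => f (pt u z))| < e / 2 by exact: h.
suff : nbhs q (fun q' : V => upper t q' ->
  `|rint t y (fun y => f (pt u y)) - rint t (q' 0 1) (fun y => f (pt (q' 0 0) y))| < e) by [].
pose m := Num.min 1 (Num.min r dl).
have m0 : 0 < m by rewrite !lt_min ltr01 r0.
have m1 : m <= 1 by rewrite ge_min lexx.
have mr : m <= r by rewrite !ge_min lexx orbT.
have md : m <= dl by rewrite !ge_min lexx !orbT.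
apply/near_ptP; exists m => // q'.
rewrite -/u -/y; set u' := q' 0 0; set y' := q' 0 1 => hu hy ty'.
have {}ty' : t <= y' by [].
have /andP[_ y'1] := itv1_dist m1 hy.
rewrite -(subrKA (rint t y' (fun z => f (pt u z)))) (splitr e).
apply: le_lt_trans (ler_normD _ _) _; apply: ltrD.
  apply: hr; last by rewrite in_itv/= ty' y'1.
  by rewrite /= distrC; exact: lt_le_trans mr.
have uu1 := itv1_self u.
have uu2 := itv1_dist m1 hu.
have c1 : cont_on t y' (fun z => f (pt u z)).
  by apply: cont_on_sub (cont_box_slice1 cB uu1).
have c2 : cont_on t y' (fun z => f (pt u' z)).
  by apply: cont_on_sub (cont_box_slice1 cB uu2).
rewrite -rintB//; apply: le_lt_trans e'e.
apply: (@le_trans _ _ (e' * (y' - t))).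
  apply: rint_le_norm => //; first exact: cont_onB.
  move=> z /andP[z1 z2]; rewrite distrC.
  have tz : t <= z <= y + 1 by rewrite z1 (le_trans z2 y'1).
  apply/ltW/hdl; rewrite ?pt0 ?pt1 ?subrr ?normr0//; try exact/box_pt.
  exact: lt_le_trans md.
by rewrite ler_pM2l// lerD2r.
Qed.

(** The increment of [K] is split along a corner: horizontally at the height of the moving point,
    then vertically on the line through [q]. The horizontal part is a derivation under the integral
    sign, the vertical one the fundamental theorem of calculus. *)
Lemma prim_C1 t g : C1 (upper t) g ->
  let K q := rint t (q 0 1) (fun y => g (pt (q 0 0) y)) in
  [/\ C1 (upper t) K,
    forall q, upper t q -> pd 0 K q = rint t (q 0 1) (fun y => pd 0 g (pt (q 0 0) y))
  & forall q, upper t q -> pd 1 K q = g q].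
Proof.
move=> cg K; apply: C1I => [|q tq|q tq|q tq]; first exact: adm_upper; first last.
 exact: C1_cont.
- by apply: fubini_prim_cont => // q' tq'; exact: C1_cont0.
set u := q 0 0; set y := q 0 1; have ty : t <= y by [].
have BU : box (u - 1) (u + 1) t (y + 1) `<=` upper t by move=> q' [_ /andP[]].
have cB := cont_sub_box BU (fun q => C1_cont cg (q := q)).
have c0B := cont_sub_box BU (fun q => C1_cont0 cg (q := q)).
have uu1 := itv1_self u.
have yy1 : t <= y <= y + 1 by apply/andP; split; lra.
have cu := cont_box_slice1 cB uu1.
have c0u := cont_box_slice1 c0B uu1.
pose K1 z := rint t z (fun y => pd 0 g (pt u y)).
pose G z := rint t z (fun y => g (pt u y)).
(* The difference quotients on the two sides of the corner, each continued by its limit; [G] is [K]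
   on the vertical line through [q]. *)
pose phi (q' : V) := if q' 0 0 == u then K1 (q' 0 1) else (K q' - G (q' 0 1)) / (q' 0 0 - u).
pose psi (q' : V) := if q' 0 1 == y then g q else (G (q' 0 1) - G y) / (q' 0 1 - y).
exists phi, psi; split.
- apply/(@cvgrPdist_lt _ _ _ _ _) => e e0.
  have e2 : 0 < e / 2 by rewrite divr_gt0.
  have l0 : 0 <= y + 1 - t by lra.
  have [e' e'0 e'e] := eps_scale e2 l0.
  have [dl dl0 hdl] := box_unif c0B e'0.
  have /cont_onP/(_ y yy1) := rint_prim_cont c0u.
  move=> /(@cvgrPdist_lt _ _ _ _ _)/(_ _ e2) h.
  have {h}/nbhs_normP[r /= r0 hr] : \forall z \near y, z \in `[t, y + 1] ->
    `|K1 y - K1 z| < e / 2 by exact: h.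
  suff : nbhs q (fun q' : V => upper t q' -> `|phi q - phi q'| < e) by [].
  pose m := Num.min 1 (Num.min r dl).
  have m0 : 0 < m by rewrite !lt_min ltr01 r0.
  have m1 : m <= 1 by rewrite ge_min lexx.
  have mr : m <= r by rewrite !ge_min lexx orbT.
  have md : m <= dl by rewrite !ge_min lexx !orbT.
  apply/near_ptP; exists m => // q'.
  rewrite -/u -/y; set u' := q' 0 0; set y' := q' 0 1 => hu hy ty'.
  have {}ty' : t <= y' by [].
  have /andP[_ y'1] := itv1_dist m1 hy.
  have P1 : `|K1 y - K1 y'| < e / 2.
    apply: hr; last by rewrite in_itv/= ty' y'1.
    by rewrite /= distrC; exact: lt_le_trans mr.
  have -> : phi q = K1 y by rewrite /phi eqxx.
  have hlt : `|K1 y - K1 y'| < e by apply: lt_trans P1 _; rewrite ltr_pdivrMr// ltr_pMr// ltr1n.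
  rewrite /phi -/u' -/y'; case: eqP => [_|/eqP uu']; first exact: hlt.
  rewrite -(subrKA (K1 y')) (splitr e).
  apply: le_lt_trans (ler_normD _ _) _; apply: ltrD => //.
  have u0 : 0 < `|u' - u| by rewrite normr_gt0 subr_eq0.
  have -> : K1 y' - (K q' - G y') / (u' - u) = - ((K q' - G y' - (u' - u) * K1 y') / (u' - u)).
    by field; rewrite subr_eq0.
  rewrite normrN normrM normfV ltr_pdivrMr//.
  apply: (@le_lt_trans _ _ ((e' * `|u' - u|) * (y' - t))); last first.
    rewrite mulrAC ltr_pM2r//; apply: le_lt_trans e'e.
    by rewrite ler_pM2l// lerD2r.
  have uu2 := itv1_dist m1 hu.
  have c1 : cont_on t y' (fun z => g (pt u z)) by apply: cont_on_sub cu.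
  have c2 : cont_on t y' (fun z => g (pt u' z)).
    by apply: cont_on_sub (cont_box_slice1 cB uu2).
  have c3 : cont_on t y' (fun z => pd 0 g (pt u z)) by apply: cont_on_sub c0u.
  have -> : K q' - G y' - (u' - u) * K1 y' =
     rint t y' (fun v => g (pt u' v) - g (pt u v) - (u' - u) * pd 0 g (pt u v)).
    rewrite !rintB ?rintZ//; first exact: cont_onB.
    by apply: cont_onM => //; exact: cont_on_cst.
  apply: rint_le_norm => //.
    by apply: cont_onB; [exact: cont_onB|apply: cont_onM => //; exact: cont_on_cst].
  move=> v /andP[v1 v2]; rewrite [_ * pd _ _ _]mulrC.
  have tv : t <= v <= y + 1 by rewrite v1 (le_trans v2 y'1).
  apply: (@mvt_bound _ (fun w => g (pt w v)) (fun w => pd 0 g (pt w v))).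
    by move=> w _; apply: (slice0_derive (@adm_upper t)) => //; rewrite /upper/= pt1.
  move=> w hw; have w2 : `|w - u| < m by exact: le_lt_trans (between_dist hw) hu.
  have w1 := itv1_dist m1 w2.
  apply/ltW/hdl; rewrite ?pt0 ?pt1 ?subrr ?normr0//; try exact/box_pt.
  exact: lt_le_trans md.
- apply/(@cvgrPdist_le _ _ _ _ _) => e e0.
  have [dl dl0 hdl] := box_unif cB e0.
  suff : nbhs q (fun q' : V => upper t q' -> `|psi q - psi q'| <= e) by [].
  pose m := Num.min 1 dl.
  have m0 : 0 < m by rewrite !lt_min ltr01.
  have m1 : m <= 1 by rewrite ge_min lexx.
  have md : m <= dl by rewrite !ge_min lexx !orbT.
  apply/near_ptP; exists m => // q' _.
  rewrite -/y; set y' := q' 0 1 => hy ty'.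
  have {}ty' : t <= y' by [].
  have /andP[_ y'1] := itv1_dist m1 hy.
  have -> : psi q = g q by rewrite /psi eqxx.
  rewrite /psi -/y'; case: eqP => [_|/eqP yy']; first by rewrite subrr normr0 ltW.
  have y0 : 0 < `|y' - y| by rewrite normr_gt0 subr_eq0.
  have -> : g q - (G y' - G y) / (y' - y) = - ((G y' - G y - g q * (y' - y)) / (y' - y)).
    by field; rewrite subr_eq0.
  rewrite normrN normrM normfV ler_pdivrMr//.
  apply: (prim_bound cu yy1); first by rewrite ty'.
  move=> w hw; have w2 : `|w - y| < m by exact: le_lt_trans (between_dist hw) hy.
  have w1 : t <= w <= y + 1.
    have /andP[_ ->] := itv1_dist m1 w2; rewrite andbT.
    by case/andP: hw => hw _; apply: le_trans hw; rewrite le_min ty.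
  apply/ltW/hdl; rewrite ?pt0 ?pt1 -/u ?subrr ?normr0//.
    exact/box_pt.
  exact: lt_le_trans md.
- by rewrite /phi eqxx.
- by rewrite /psi eqxx.
- apply: near_all => q' tq'; have KG : K q = G y by [].
  rewrite KG.
  have -> : psi q' * (q' 0 1 - y) = G (q' 0 1) - G y.
    by rewrite /psi; case: eqP => [->|/eqP h]; rewrite ?subrr ?mulr0// divfK// subr_eq0.
  have -> : phi q' * (q' 0 0 - u) = K q' - G (q' 0 1).
    by rewrite /phi; case: eqP => [e|/eqP h]; rewrite ?e ?subrr ?mulr0// ?divfK// ?subr_eq0// /K e subrr.
  ring.
Qed.

(** With [Phi] a primitive of [k], the integrand is the derivative of [Phi \o gam]. So [gam] may go
    back and forth: only its end values count, and they lie on either side of the support of [k]. *)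
Lemma subst1 (k gam gam' : R -> R) a b s0 s1 : a <= b -> s0 <= s1 -> continuous k ->
  (forall s, k s != 0 -> s0 <= s <= s1) ->
  (forall u, a <= u <= b -> is_derive u 1 gam (gam' u)) -> cont_on a b gam' ->
  gam a < s0 -> s1 <= gam b ->
  rint a b (fun u => k (gam u) * gam' u) = rint s0 s1 k.
Proof.
move=> ab s01 ck k0 dg cg' ga gb.
have cg : cont_on a b gam by exact: cont_on_derive dg.
have [xM _ hM] := EVT_max ab cg; have [xm _ hm] := EVT_min ab cg.
(* [B0] and [B1] strictly enclose the support of [k] and the range of [gam], so that [Phi], based at
   [B0], is differentiable on the whole range. *)
pose B0 := Num.min s0 (gam xm) - 1; pose B1 := Num.max s1 (gam xM) + 1.
have b1 : B0 < s0 by rewrite /B0 ltrBlDr (le_lt_trans (y := s0)) ?ltrDl// ge_min lexx.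
have b2 : B0 < gam xm by rewrite /B0 ltrBlDr (le_lt_trans (y := gam xm)) ?ltrDl// ge_min lexx orbT.
have b3 : s1 < B1 by rewrite /B1 (lt_le_trans (y := s1 + 1)) ?ltrDl// lerD2r le_max lexx.
have b4 : gam xM < B1 by rewrite /B1 (lt_le_trans (y := gam xM + 1)) ?ltrDl// lerD2r le_max lexx orbT.
have gB u : a <= u <= b -> B0 < gam u < B1.
  move=> uab; rewrite (lt_le_trans b2)/=; last by apply: hm; rewrite in_itv.
  by apply: le_lt_trans b4; apply: hM; rewrite in_itv.
pose Phi s := rint B0 s k.
have dPhi s : B0 < s < B1 -> is_derive s 1 Phi (k s).
  by move=> hs; apply: rint_FTC1 hs; exact: continuous_cont_on.
have dc u : a <= u <= b -> is_derive u 1 (Phi \o gam) (k (gam u) * gam' u).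
  by move=> uab; exact: is_derive1_comp (dPhi _ (gB _ uab)) (dg u uab).
have cint : cont_on a b (fun u => k (gam u) * gam' u).
  apply: cont_onM => //; apply/cont_onP => u uab.
  by move/cont_onP : cg => /(_ u uab) cgu; apply: cvg_comp cgu _; exact: ck.
have -> : rint a b (fun u => k (gam u) * gam' u) = Phi (gam b) - Phi (gam a).
  apply: (@rint_FTC2 _ _ _ _ (Phi \o gam) ab cint (cont_on_derive dc)).
  by move=> u /andP[/ltW h1 /ltW h2]; apply: dc; rewrite h1.
have -> : Phi (gam b) = rint s0 s1 k.
  by apply: rint_sub => //; [exact: ltW|move=> x _; exact: k0].
rewrite /Phi.
rewrite [X in _ - X]rint0 ?subr0// => x /andP[x1 x2].
by apply/eqP; apply: contraT => /k0/andP[]; rewrite leNgt (le_lt_trans x2 ga).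
Qed.

Definition jacdet T q : R :=
  pd 0 (fun q => T q 0 0) q * pd 1 (fun q => T q 0 1) q
  - pd 1 (fun q => T q 0 0) q * pd 0 (fun q => T q 0 1) q.

(* Lax's argument: with [K(s, t)] the integral of [g(s, .)] up to [t], the
   integrand [g(T) det DT] is the exterior derivative of [- K(T) dT1]. *)
Lemma cv_rect A T g a b c d s0 s1 t0 t1 :
  adm A -> box a b c d `<=` A -> a <= b -> c <= d -> (forall q, A q -> upper t0 (T q)) ->
  C2 A (fun q => T q 0 0) -> C2 A (fun q => T q 0 1) -> C1 (upper t0) g ->
  s0 <= s1 -> t0 <= t1 -> (forall q, upper t0 q -> g q != 0 -> box s0 s1 t0 t1 q) ->
  (forall v, c <= v <= d -> T (pt a v) 0 0 < s0) ->
  (forall v, c <= v <= d -> s1 < T (pt b v) 0 0) ->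
  (forall u, a <= u <= b -> t1 <= T (pt u d) 0 1) ->
  (forall u, a <= u <= b -> T (pt u c) 0 1 = t0 \/
     forall q, upper t0 q -> g q != 0 -> T (pt u c) 0 1 < q 0 1) ->
  rint2 a b c d (fun q => g (T q) * jacdet T q) = rint2 s0 s1 t0 t1 g.
Proof.
move=> admA BA ab cd TU cT1 cT2 cg s01 t01 supp left right top bot.
have [C1T1 C1T10 C1T11] := cT1; have [C1T2 _ _] := cT2.
have admU := @adm_upper t0.
have [cK K0 K1] := prim_C1 cg; set K := (fun q => _) in cK K0 K1.
have [cF F0 F1] := C1_comp admA admU TU C1T1 C1T2 cK.
have [cP' P'0 P'1] := C1M admA cF C1T10; have [cP P0 P1] := C1N admA cP'.
have [cQ' Q'0 Q'1] := C1M admA cF C1T11; have [cQ Q0 Q1] := C1N admA cQ'.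
(* The second derivatives of [T] cancel by symmetry, and the terms in [pd 0 K] because
   [dT1 /\ dT1 = 0]. *)
have E q : A q -> pd 0 (fun q => - ((K \o T) q * pd 1 (fun q => T q 0 0) q)) q
    - pd 1 (fun q => - ((K \o T) q * pd 0 (fun q => T q 0 0) q)) q = g (T q) * jacdet T q.
  move=> Aq; rewrite Q0// P1// Q'0// P'1// F0// F1// (schwarz admA Aq cT1) /jacdet.
  by rewrite !K1; [|exact: TU]; ring.
have -> : rint2 a b c d (fun q => g (T q) * jacdet T q) = rint2 a b c d (fun q =>
    pd 0 (fun q => - ((K \o T) q * pd 1 (fun q => T q 0 0) q)) q
    - pd 1 (fun q => - ((K \o T) q * pd 0 (fun q => T q 0 0) q)) q).
  apply: rint_ext => u uab; apply: rint_ext => v vcd; rewrite E//.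
  by apply: BA; apply/box_pt.
rewrite (green admA BA)//.
have A_ u v : a <= u <= b -> c <= v <= d -> A (pt u v) by move=> h1 h2; apply: BA; exact/box_pt.
have aab : a <= a <= b by rewrite lexx.
have bab : a <= b <= b by rewrite lexx ab.
have ccd : c <= c <= d by rewrite lexx.
have dcd : c <= d <= d by rewrite lexx cd.
have g0 q : upper t0 q -> ~ box s0 s1 t0 t1 q -> g q = 0.
  by move=> Uq nb; apply/eqP; apply: contraT => /(supp _ Uq).
have Kout q : q 0 0 < s0 \/ s1 < q 0 0 -> K q = 0.
  move=> h; rewrite /K; apply: rint0 => y /andP[y1 y2]; apply: g0; first by rewrite /upper/= pt1.
  by move/box_pt => -[/andP[h1 h2] _]; case: h => h; [move: h1|move: h2]; rewrite leNgt h.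
(* On the vertical edges [K \o T] vanishes because [T] is beside the support. On the bottom edge the
   integral defining [K] is over a point, or stays below the support. *)
rewrite [rint c d _]rint0; last first.
  by move=> v vcd; rewrite /= Kout ?mul0r ?oppr0//; right; exact: right.
rewrite [rint c d _]rint0; last first.
  by move=> v vcd; rewrite /= Kout ?mul0r ?oppr0//; left; exact: left.
rewrite [X in _ - (_ - X)]rint0; last first.
  move=> u uab; rewrite /= (_ : K _ = 0) ?mul0r ?oppr0//.
  have Ut := TU _ (A_ u c uab ccd).
  rewrite /K; case: (bot u uab) => [->|h]; first exact: rint_point.
  apply: rint0 => y /andP[y1 y2]; apply/eqP; apply: contraT => /h.
  by rewrite /upper/= pt1 => /(_ y1); rewrite ltNge y2.
rewrite subr0 sub0r subr0.
pose k s := rint t0 t1 (fun y => g (pt s y)).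
pose gam u := T (pt u d) 0 0.
have cF' : cont_on a b (fun u => (K \o T) (pt u d) * pd 0 (fun q => T q 0 0) (pt u d)).
  apply: (@slice0_cont _ A (fun q => (K \o T) q * pd 0 (fun q => T q 0 0) q)).
    by move=> u uab; exact: A_.
  by move=> q Aq; exact: (C1_cont cP').
rewrite -rintN; last by apply: cont_onN.
have -> : rint2 s0 s1 t0 t1 g = rint s0 s1 k by [].
transitivity (rint a b (fun u => k (gam u) * pd 0 (fun q => T q 0 0) (pt u d))); last first.
  apply: (@subst1 k gam (fun u => pd 0 (fun q => T q 0 0) (pt u d)) a b) => //; first last.
  + by apply/ltW/right.
  + exact: left.
  + by apply: slice0_cont (fun q => C1_cont0 C1T1 (q := q)) => u uab; exact: A_.
  + by move=> u uab; apply: (slice0_derive admA _ C1T1); exact: A_.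
  + move=> s; apply: contraNT => hs; apply/eqP; apply: rint0 => y /andP[y1 y2].
    apply: g0; first by rewrite /upper/= pt1.
    by move/box_pt => -[h1 _]; rewrite h1 in hs.
  + have cgU := fun q => C1_cont cg (q := q).
    move=> s; have BU : box (s - 1) (s + 1) t0 t1 `<=` upper t0 by move=> q' [_ /andP[]].
    have := pint_cont t01 (cont_sub_box BU cgU).
    have ss : s - 1 < s + 1 by lra.
    by move/(within_continuous_continuous ss); apply; rewrite in_itv/=; apply/andP; split; lra.
apply: rint_ext => u uab; rewrite opprK; congr (_ * _).
rewrite /= /K /k; apply: rint_sub => //; first exact: top.
move=> y /andP[y1 _] gy; have := supp (pt (T (pt u d) 0 0) y).
rewrite /upper/= pt1 => /(_ y1 gy).
by move/box_pt => -[].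
Qed.

(** Taken over the whole plane, so that its value does not refer to the box in which a compactly
    supported integrand is computed. *)
Definition dint f : R := Rintegral (@lebesgue_measure R) setT
  (fun u => Rintegral (@lebesgue_measure R) setT (fun v => f (pt u v))).

Lemma dint_box a b c d f : (forall q, f q != 0 -> box a b c d q) -> dint f = rint2 a b c d f.
Proof.
move=> f0; rewrite /dint.
have E u : Rintegral (@lebesgue_measure R) setT (fun v => f (pt u v)) = rint c d (fun v => f (pt u v)).
  by apply: RintT_box => v /f0/box_pt[].
under eq_fun do rewrite E.
apply: RintT_box => u; apply: contraNT => h; apply/eqP; apply: rint0 => v _.
by apply/eqP; apply: contraT => /f0/box_pt[h' _]; rewrite h' in h.
Qed.

Lemma dint_ext f g : (forall q, f q = g q) -> dint f = dint g.
Proof. by move=> fg; congr dint; apply/funext. Qed.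

End RectangleChangeOfVariables.

(** * Affine maps, and maps near a point of the half-plane *)

Section LocalChangeOfVariables.
Variable R : realType.
Local Notation V := 'rV[R]_2.
Implicit Types (A B : set V) (q : V) (f g h : V -> R) (T : V -> V) (a b c d : R).

Lemma adm_setT : adm (@setT V).
Proof. by move=> q _; apply: near_all. Qed.

Lemma near_cont A f q e : cont A f q -> 0 < e -> \forall q' \near q, A q' -> `|f q - f q'| < e.
Proof. by move=> cf e0; exact: (@cvgrPdist_lt _ _ _ _ _ _ _).1 cf _ e0. Qed.

Lemma adm_lt A f t : adm A -> (forall q, A q -> cont A f q) -> adm (A `&` [set q | t < f q]).
Proof.
move=> admA cf q [Aq /= tq].
have h := near_cont (cf q Aq) (_ : 0 < f q - t).
have {}h := h (ltac:(by rewrite subr_gt0)).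
apply: filterS2 h (admA q Aq) => x h hA hx; have Ax := hA hx; split => //=.
by have := h Ax; rewrite ltr_distlC => /andP[h1 h2]; lra.
Qed.

Definition bounded_support g := exists2 k : R, 0 <= k &
  forall q, g q != 0 -> `|q 0 0| <= k /\ `|q 0 1| <= k.

Definition aff (l11 l12 l21 l22 e1 e2 : R) q : V :=
  pt (l11 * q 0 0 + l12 * q 0 1 + e1) (l21 * q 0 0 + l22 * q 0 1 + e2).

Lemma C1_lin (A : set V) (l1 l2 e : R) : adm A ->
  let f := fun q : V => l1 * q 0 0 + l2 * q 0 1 + e in
  [/\ C2 A f, forall q, A q -> pd 0 f q = l1 & forall q, A q -> pd 1 f q = l2].
Proof.
move=> admA f; have [cx x0 x1] := C1_x admA; have [cy y0 y1] := C1_y admA.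
have [cz z0 z1] := C1_cst e admA.
have [c1 c10 c11] := C1Z l1 admA cx; have [c2 c20 c21] := C1Z l2 admA cy.
have [c3 c30 c31] := C1D admA c1 c2; have [c4 c40 c41] := C1D admA c3 cz.
have E0 q : A q -> pd 0 f q = l1.
  by move=> Aq; rewrite c40// c30// c10// c20// x0// y0// z0//; ring.
have E1 q : A q -> pd 1 f q = l2.
  by move=> Aq; rewrite c41// c31// c11// c21// x1// y1// z1//; ring.
split; [split|exact: E0|exact: E1]; first exact: c4.
  by apply: (C1_ext admA (fun q Aq => esym (E0 q Aq))); have [] := C1_cst l1 admA.
by apply: (C1_ext admA (fun q Aq => esym (E1 q Aq))); have [] := C1_cst l2 admA.
Qed.

Lemma aff0 l11 l12 l21 l22 e1 e2 :
  (fun q => aff l11 l12 l21 l22 e1 e2 q 0 0) = (fun q => l11 * q 0 0 + l12 * q 0 1 + e1).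
Proof. by apply/funext => q; rewrite pt0. Qed.

Lemma aff1 l11 l12 l21 l22 e1 e2 :
  (fun q => aff l11 l12 l21 l22 e1 e2 q 0 1) = (fun q => l21 * q 0 0 + l22 * q 0 1 + e2).
Proof. by apply/funext => q; rewrite pt1. Qed.

Lemma aff_jac A l11 l12 l21 l22 e1 e2 q : adm A -> A q ->
  jacdet (aff l11 l12 l21 l22 e1 e2) q = l11 * l22 - l12 * l21.
Proof.
move=> admA Aq; rewrite /jacdet aff0 aff1.
have [_ h1 h2] := C1_lin l11 l12 e1 admA; have [_ h3 h4] := C1_lin l21 l22 e2 admA.
by rewrite h1// h2// h3// h4.
Qed.

(** Cramer's rule bounds the inverse matrix by its entries over [|D|]; the summand 1 makes the bound
    positive. *)
Lemma lin_bound (l11 l12 l21 l22 : R) : l11 * l22 - l12 * l21 != 0 ->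
  exists2 k : R, 0 < k & forall x y m : R,
    `|l11 * x + l12 * y| <= m -> `|l21 * x + l22 * y| <= m -> `|x| <= k * m /\ `|y| <= k * m.
Proof.
set D := _ - _ => D0.
have D1 : 0 < `|D| by rewrite normr_gt0.
exists ((`|l11| + `|l12| + `|l21| + `|l22| + 1) / `|D|).
  by rewrite divr_gt0// ltr_wpDl// !addr_ge0.
move=> x y m h1 h2; have m0 : 0 <= m by apply: le_trans h1.
have H (s z w z' w' : R) : D * s = z * w - z' * w' -> `|w| <= m -> `|w'| <= m ->
   `|z| + `|z'| <= `|l11| + `|l12| + `|l21| + `|l22| + 1 ->
   `|s| <= (`|l11| + `|l12| + `|l21| + `|l22| + 1) / `|D| * m.
  move=> E hw hw' hz.
  rewrite mulrAC ler_pdivlMr// mulrC -normrM E.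
  apply: le_trans (ler_normB _ _) _; rewrite !normrM.
  apply: (@le_trans _ _ ((`|z| + `|z'|) * m)); last by rewrite ler_wpM2r.
  by rewrite mulrDl lerD// ler_wpM2l.
have p1 := normr_ge0 l11; have p2 := normr_ge0 l12; have p3 := normr_ge0 l21; have p4 := normr_ge0 l22.
split.
  by apply: (H x l22 (l11 * x + l12 * y) l12 (l21 * x + l22 * y)) => //; [rewrite /D; ring|lra].
by apply: (H y l11 (l21 * x + l22 * y) l21 (l11 * x + l12 * y)) => //; [rewrite /D; ring|lra].
Qed.

Lemma aff_bounded_support l11 l12 l21 l22 e1 e2 g : l11 * l22 - l12 * l21 != 0 ->
  bounded_support g -> bounded_support (fun q => g (aff l11 l12 l21 l22 e1 e2 q) * (l11 * l22 - l12 * l21)).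
Proof.
move=> D0 [k k0 gk]; have [k' k'0 hk'] := lin_bound D0.
have p1 := normr_ge0 e1; have p2 := normr_ge0 e2.
exists (k' * (k + `|e1| + `|e2|)); first by rewrite mulr_ge0 ?addr_ge0// ltW.
move=> q; rewrite mulf_eq0 negb_or => /andP[/gk[]]; rewrite pt0 pt1 => h1 h2 _.
apply: hk'.
  have -> : l11 * q 0 0 + l12 * q 0 1 = (l11 * q 0 0 + l12 * q 0 1 + e1) - e1 by rewrite addrK.
  by apply: le_trans (ler_normB _ _) _; lra.
have -> : l21 * q 0 0 + l22 * q 0 1 = (l21 * q 0 0 + l22 * q 0 1 + e2) - e2 by rewrite addrK.
by apply: le_trans (ler_normB _ _) _; lra.
Qed.

Lemma aff_C1 l11 l12 l21 l22 e1 e2 g : C1 setT g ->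
  C1 setT (fun q => g (aff l11 l12 l21 l22 e1 e2 q) * (l11 * l22 - l12 * l21)).
Proof.
move=> cg; have a := adm_setT.
have [[h1 _ _] _ _] := C1_lin l11 l12 e1 a; have [[h2 _ _] _ _] := C1_lin l21 l22 e2 a.
rewrite -(aff0 l11 l12 l21 l22 e1 e2) in h1; rewrite -(aff1 l11 l12 l21 l22 e1 e2) in h2.
have [h _ _] := C1_comp a a (fun q _ => I) h1 h2 cg.
have [c _ _] := C1_cst (l11 * l22 - l12 * l21) a.
by have [] := C1M a h c.
Qed.

(** The change of variables for all affine maps with a given linear part; quantifying over the
    translations makes the property stable under products. *)
Definition cvlin (l11 l12 l21 l22 : R) := forall e1 e2 g, C1 setT g -> bounded_support g ->
  dint (fun q => g (aff l11 l12 l21 l22 e1 e2 q) * (l11 * l22 - l12 * l21)) = dint g.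

Lemma cvlin_mul (l11 l12 l21 l22 m11 m12 m21 m22 : R) :
  m11 * m22 - m12 * m21 != 0 ->
  cvlin l11 l12 l21 l22 -> cvlin m11 m12 m21 m22 ->
  cvlin (m11 * l11 + m12 * l21) (m11 * l12 + m12 * l22)
        (m21 * l11 + m22 * l21) (m21 * l12 + m22 * l22).
Proof.
move=> D0 hL hM e1 e2 g cg sg.
rewrite -(hM e1 e2 g cg sg).
rewrite -(hL 0 0 _ (aff_C1 m11 m12 m21 m22 e1 e2 cg) (aff_bounded_support e1 e2 D0 sg)).
apply: dint_ext => q; rewrite -mulrA; congr (_ * _); last by ring.
by congr g; apply: eq_pt; rewrite /aff !pt0 ?pt1; ring.
Qed.

(** On a large box with half-sides [m] and [k * m], the diagonal entries dominate in the ratio [k],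
    so each edge is mapped beyond the support of [g] on its own side, as the rectangle formula
    requires. *)
Lemma cvlin_good (l11 l12 l21 l22 k : R) : 0 < l11 -> 0 < l22 -> 0 < k ->
  `|l12| * k < l11 -> `|l21| < l22 * k -> cvlin l11 l12 l21 l22.
Proof.
move=> l11p l22p kp h1 h2 e1 e2 g cg [K K0 gK].
have D0 : 0 < l11 * l22 - l12 * l21.
  rewrite subr_gt0; apply: le_lt_trans (ler_norm _) _; rewrite normrM.
  rewrite -(ltr_pM2r kp) [ltLHS]mulrAC.
  apply: (@le_lt_trans _ _ (l11 * `|l21|)); first by rewrite ler_wpM2r// ltW.
  by rewrite -mulrA ltr_pM2l.
have [K' K'0 hK'] := aff_bounded_support e1 e2 (lt0r_neq0 D0) (ex_intro2 _ _ K K0 gK).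
have p1 := normr_ge0 e1; have p2 := normr_ge0 e2.
have x1 : 0 < l11 - `|l12| * k by rewrite subr_gt0.
have x2 : 0 < l22 * k - `|l21| by rewrite subr_gt0.
pose K1 := K + `|e1| + `|e2| + 1.
have K10 : 0 < K1 by rewrite /K1; lra.
(* The terms in [K'] make the box contain the support of the pulled-back integrand; those in [K1]
   make the displacement of the edges exceed the support of [g] and the translation. *)
pose m := K' + K' / k + K1 / (l11 - `|l12| * k) + K1 / (l22 * k - `|l21|).
have m1 : K' <= m by rewrite /m -!addrA lerDl !addr_ge0// divr_ge0// ltW.
have m2 : K' <= k * m.
  rewrite mulrC -ler_pdivrMr// /m -!addrA addrCA lerDl !addr_ge0// divr_ge0// ltW//.
have m3 : K1 <= m * (l11 - `|l12| * k).
  by rewrite -ler_pdivrMr// /m -addrA addrCA lerDl !addr_ge0// divr_ge0// ltW.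
have m4 : K1 <= m * (l22 * k - `|l21|).
  by rewrite -ler_pdivrMr// /m lerDr !addr_ge0// divr_ge0// ltW.
have m0 : 0 <= m by apply: le_trans m1.
set T := aff _ _ _ _ _ _.
have bnd (l : R) (x y : R) : `|x| <= y -> - (`|l| * y) <= l * x <= `|l| * y.
  by move=> h; rewrite -ler_norml normrM ler_wpM2l.
have eb1 : - `|e1| <= e1 <= `|e1| by rewrite -ler_norml.
have eb2 : - `|e2| <= e2 <= `|e2| by rewrite -ler_norml.
(* A level below the image of the box and below the support of [g]. *)
pose t0 := - (m * (l22 * k + `|l21|)) - K1.
have nn : 0 <= m * (l22 * k + `|l21|) by rewrite mulr_ge0// addr_ge0// mulr_ge0// ltW.
pose A := setT `&` [set q : V | t0 < l21 * q 0 0 + l22 * q 0 1 + e2].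
have admA : adm A.
  apply: adm_lt; first exact: adm_setT.
  by have [[h _ _] _ _] := C1_lin l21 l22 e2 adm_setT; move=> q _; exact: C1_cont.
have bB (q : V) : box (- m) m (- (k * m)) (k * m) q -> `|q 0 0| <= m /\ `|q 0 1| <= k * m.
  by move=> [x y]; rewrite !ler_norml.
have BA : box (- m) m (- (k * m)) (k * m) `<=` A.
  move=> q /bB[x y]; split => //=; have /andP[y1 y2] := bnd l21 _ _ x; have /andP[y3 y4] := bnd l22 _ _ y.
  by rewrite (gtr0_norm l22p) in y3 y4; rewrite /t0 /K1; case/andP: eb2 => e3 e4; lra.
have cU : C1 (upper t0) g by apply: C1_subE cg => //; [exact: adm_setT|exact: adm_upper].
have km0 : 0 <= k * m by rewrite mulr_ge0// ltW.
have itvN (x y : R) : 0 <= y -> - y <= x <= y -> `|x| <= y by rewrite ler_norml.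
have [c1 _ _] := C1_lin l11 l12 e1 admA; have [c2 _ _] := C1_lin l21 l22 e2 admA.
rewrite -(aff0 l11 l12 l21 l22 e1 e2) in c1; rewrite -(aff1 l11 l12 l21 l22 e1 e2) in c2.
have t0K : t0 <= K by rewrite /t0 /K1; lra.
have t0K' : t0 <= - K by rewrite /t0 /K1; lra.
have sg q : g q != 0 -> box (- K) K t0 K q.
  move=> /gK[]; rewrite !ler_norml => x1' /andP[y1 y2]; split => //.
  by rewrite y2 (le_trans t0K' y1).
have mm : - m <= m by rewrite ge0_cp.
have kk : - (k * m) <= k * m by rewrite ge0_cp.
have KK : - K <= K by rewrite ge0_cp.
have TU q : A q -> upper t0 (T q) by move=> [_ /= h]; rewrite /upper/= pt1 ltW.
have := @cv_rect R A T g (- m) m (- (k * m)) (k * m) (- K) K t0 K admA BA mm kk TU c1 c2 cU KK t0K.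
rewrite -(dint_box sg) => <-.
- rewrite (@dint_box _ (- m) m (- (k * m)) (k * m)).
    apply: rint_ext => u um; apply: rint_ext => v vm; rewrite (aff_jac _ _ _ _ _ _ admA)//.
    by apply: BA; apply/box_pt.
  by move=> q /hK'[h3 h4]; split; rewrite -ler_norml; [exact: le_trans m1|exact: le_trans m2].
- by move=> q _; exact: sg.
- move=> v /(itvN _ _ km0) vm; have /andP[y3 y4] := bnd l12 _ _ vm; rewrite !(pt0, pt1).
  by rewrite /K1 in m3; case/andP: eb1 => e3 e4; lra.
- move=> v /(itvN _ _ km0) vm; have /andP[y3 y4] := bnd l12 _ _ vm; rewrite !(pt0, pt1).
  by rewrite /K1 in m3; case/andP: eb1 => e3 e4; lra.
- move=> v /(itvN _ _ m0) vm; have /andP[y3 y4] := bnd l21 _ _ vm; rewrite !(pt0, pt1).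
  by rewrite /K1 in m4; case/andP: eb2 => e3 e4; lra.
- move=> v /(itvN _ _ m0) vm; right => q _ /gK[_]; rewrite ler_norml => /andP[q1 q2].
  have /andP[y3 y4] := bnd l21 _ _ vm; rewrite !(pt0, pt1).
  by rewrite /K1 in m4; case/andP: eb2 => e3 e4; lra.
Qed.

(** The entry [l12] multiplies the height of the box, so a flat box is taken: the ratio [k] is
    small. *)
Lemma cvlin_upper (l11 l12 l22 : R) : 0 < l11 -> 0 < l22 -> cvlin l11 l12 0 l22.
Proof.
move=> h1 h2; have h : 0 < `|l12| + 1 by rewrite ltr_wpDl.
apply: (@cvlin_good _ _ _ _ (l11 / (`|l12| + 1))) => //.
- by rewrite divr_gt0.
- by rewrite mulrA ltr_pdivrMr// mulrC ltr_pM2l// ltrDl.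
- by rewrite normr0 mulr_gt0// divr_gt0.
Qed.

(** Here the box is tall: the ratio [k] exceeds [|c|]. *)
Lemma cvlin_lower (c : R) : cvlin 1 0 c 1.
Proof.
by apply: (@cvlin_good _ _ _ _ (`|c| + 1)) => //; rewrite ?ltr_wpDl// ?normr0 ?mul0r// mul1r ltrDl.
Qed.

Lemma cvlin_eq (l11 l12 l21 l22 m11 m12 m21 m22 : R) :
  l11 = m11 -> l12 = m12 -> l21 = m21 -> l22 = m22 -> cvlin l11 l12 l21 l22 -> cvlin m11 m12 m21 m22.
Proof. by move=> -> -> -> ->. Qed.

(** Gaussian elimination with the positive pivot [l11]: a lower transvection times an upper
    triangular matrix with positive diagonal. *)
Lemma cvlin_pos (l11 l12 l21 l22 : R) : 0 < l11 -> 0 < l11 * l22 - l12 * l21 -> cvlin l11 l12 l21 l22.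
Proof.
move=> h D.
have hU : 0 < (l11 * l22 - l12 * l21) / l11 by rewrite divr_gt0.
have X := @cvlin_mul l11 l12 0 _ 1 0 (l21 / l11) 1 _ (cvlin_upper l12 h hU) (cvlin_lower (l21 / l11)).
have l0 := lt0r_neq0 h.
by apply: cvlin_eq (X _); rewrite ?mul1r ?mul0r ?subr0 ?oner_neq0//; field.
Qed.

Lemma cvlin_neq0 (l11 l12 l21 l22 : R) : l21 != 0 -> 0 < l11 * l22 - l12 * l21 -> cvlin l11 l12 l21 l22.
Proof.
move=> h D; pose s := (1 - l11) / l21.
have E : l11 + s * l21 = 1 by rewrite /s; field.
have P : cvlin (l11 + s * l21) (l12 + s * l22) l21 l22.
  by apply: cvlin_pos; [rewrite E|rewrite (_ : _ - _ = l11 * l22 - l12 * l21)//; ring].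
have X := @cvlin_mul _ _ _ _ 1 (- s) 0 1 _ P (cvlin_upper (- s) ltr01 ltr01).
by apply: cvlin_eq (X _); rewrite ?mulr0 ?subr0 ?mul1r ?oner_neq0//; ring.
Qed.

(* Left multiplication by transvections makes [l21 != 0], then [l11 = 1]. *)
Lemma cvlin_det (l11 l12 l21 l22 : R) : 0 < l11 * l22 - l12 * l21 -> cvlin l11 l12 l21 l22.
Proof.
move=> D; have [h|h] := eqVneq l21 0; last exact: cvlin_neq0.
have l0 : l11 != 0 by apply/eqP => l0; move: D; rewrite l0 h; lra.
have P : cvlin l11 l12 (l11 + l21) (l12 + l22).
  by apply: cvlin_neq0; [rewrite h addr0|rewrite (_ : _ - _ = l11 * l22 - l12 * l21)//; ring].
have X := @cvlin_mul _ _ _ _ 1 0 (- 1) 1 _ P (cvlin_lower (- 1)).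
by apply: cvlin_eq (X _); rewrite ?mul0r ?subr0 ?mul1r ?oner_neq0//; ring.
Qed.

Lemma wd_bound A f q a b eta : wd A f q a b -> A q -> 0 < eta ->
  exists2 r : R, 0 < r & forall q', A q' -> `|q' 0 0 - q 0 0| < r -> `|q' 0 1 - q 0 1| < r ->
    `|f q' - f q - (a * (q' 0 0 - q 0 0) + b * (q' 0 1 - q 0 1))|
    <= eta * (`|q' 0 0 - q 0 0| + `|q' 0 1 - q 0 1|).
Proof.
move=> [phi [psi [c c' <- <- hf]]] Aq e0.
have h1 := near_cont c e0; have h2 := near_cont c' e0.
have [r r0 hr] := (near_ptP _ _).1 (filterI hf (filterI h1 h2)).
exists r => // q' Aq' d1 d2; have [H0 [H1 H2]] := hr q' d1 d2.
have {}H0 := H0 Aq'; have {}H1 := H1 Aq'; have {}H2 := H2 Aq'.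
have -> : f q' - f q - (phi q * (q' 0 0 - q 0 0) + psi q * (q' 0 1 - q 0 1))
  = - ((phi q - phi q') * (q' 0 0 - q 0 0) + (psi q - psi q') * (q' 0 1 - q 0 1)).
  by rewrite H0; ring.
rewrite normrN [leRHS]mulrDr; apply: le_trans (ler_normD _ _) _; rewrite !normrM.
by apply: lerD; rewrite ler_wpM2r// ltW.
Qed.

(** On an edge [|x| = dl] of a box with half-sides [dl] and [k * dl], the linear part has the sign
    of [x] with margin [mu * dl], and the error of linearization consumes at most half of it.
    Exchanging the coordinates, with [k^-1] for [k], gives the other pair of edges. *)
Lemma edge_estimate (l1 l2 k mu eta dl x y w : R) : 0 < dl -> 0 < k -> 0 <= eta ->
  eta * (1 + k) <= mu / 2 -> mu = l1 - `|l2| * k -> `|x| = dl -> `|y| <= k * dl ->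
  `|w - (l1 * x + l2 * y)| <= eta * (`|x| + `|y|) ->
  (x = dl -> mu / 2 * dl <= w) /\ (x = - dl -> w <= - (mu / 2 * dl)).
Proof.
move=> d0 k0 eta0 he Emu xd yk hw.
have h1 : eta * (`|x| + `|y|) <= mu / 2 * dl.
  apply: le_trans (_ : eta * (1 + k) * dl <= _); last by rewrite ler_pM2r.
  by rewrite -mulrA ler_wpM2l// xd mulrDl mul1r lerD2l.
have h2 : `|l2 * y| <= `|l2| * (k * dl) by rewrite normrM ler_wpM2l.
move: hw h2; rewrite !ler_norml => /andP[w1 w2] /andP[y1 y2].
have E : mu * dl = l1 * dl - `|l2| * (k * dl) by rewrite Emu; ring.
have E2 : mu / 2 * dl = mu * dl / 2 by rewrite mulrAC.
rewrite E2 in h1 *.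
by split=> xE; rewrite xE ?mulrN in w1 w2 h1; lra.
Qed.

(** The change of variables for supports in a small square around [T q]. The pulled-back integrand
    is any [h] that has the expected values on the box and vanishes off it, because [T] is
    meaningful on [A] only. The support of [g] may touch the boundary line. *)
Definition cv_at A T q := exists a b c d e, [/\ 0 < e, box a b c d `<=` A,
  nbhs q (fun q' : V => 0 <= q' 0 1 -> box a b c d q') &
    forall g h, C1 (upper 0) g ->
      (forall q', g q' != 0 -> [/\ 0 <= q' 0 1, `|q' 0 0 - T q 0 0| <= e & `|q' 0 1 - T q 0 1| <= e]) ->
      (forall q', box a b c d q' -> h q' = g (T q') * jacdet T q') ->
      (forall q', h q' != 0 -> box a b c d q') -> dint h = dint g].

(** On a small box of ratio [k] around [q], weighted diagonal dominance of the derivative at [q]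
    beats the error of linearization, so the edges are mapped beyond the square of half-side [e]
    around [T q]. If [q] is on the boundary line, the bottom edge lies on it and is mapped into
    it. *)
Lemma cv_local_good A T q (l11 l12 l21 l22 k : R) :
  adm A -> A `<=` upper 0 -> A q -> (forall q, A q -> upper 0 (T q)) ->
  nbhs q (fun q' : V => 0 <= q' 0 1 -> A q') ->
  C2 A (fun q => T q 0 0) -> C2 A (fun q => T q 0 1) ->
  pd 0 (fun q => T q 0 0) q = l11 -> pd 1 (fun q => T q 0 0) q = l12 ->
  pd 0 (fun q => T q 0 1) q = l21 -> pd 1 (fun q => T q 0 1) q = l22 ->
  0 < l11 -> 0 < l22 -> 0 < k -> `|l12| * k < l11 -> `|l21| < l22 * k ->
  (0 < q 0 1 \/ (q 0 1 = 0 /\ forall q', A q' -> q' 0 1 = 0 -> T q' 0 1 = 0)) ->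
  cv_at A T q.
Proof.
move=> admA AU Aq TU nA cT1 cT2 E11 E12 E21 E22 l11p l22p kp g1 g2 cases.
have [cT1' _ _] := cT1; have [cT2' _ _] := cT2.
have w1 := C1_wd cT1' Aq; have w2 := C1_wd cT2' Aq.
rewrite E11 E12 in w1; rewrite E21 E22 in w2.
set u := q 0 0 in w1 w2 *; set v := q 0 1 in w1 w2 cases *.
set s := T q 0 0 in w1 w2 *; set t := T q 0 1 in w1 w2 cases *.
have v0 : 0 <= v by exact: AU Aq.
have t0 : 0 <= t by exact: TU Aq.
pose mu1 := l11 - `|l12| * k; have mu1p : 0 < mu1 by rewrite subr_gt0.
pose mu2 := l22 * k - `|l21|; have mu2p : 0 < mu2 by rewrite subr_gt0.
have k1 : 0 < 1 + k by rewrite ltr_wpDl.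
have k2 : 0 < 2 * (1 + k) by rewrite mulr_gt0.
pose mu := Num.min mu1 mu2; have mup : 0 < mu by rewrite lt_min mu1p.
(* On the box [|x| + |y| <= (1 + k) * dl], so with this [eta] the remainder of [T] is at most half
   of the margin [mu * dl]. *)
pose eta := mu / (2 * (1 + k)); have etap : 0 < eta by rewrite divr_gt0.
have etaE : eta * (1 + k) = mu / 2 by rewrite /eta; field; rewrite lt0r_neq0.
have [r1 r1p hr1] := wd_bound w1 Aq etap; have [r2 r2p hr2] := wd_bound w2 Aq etap.
have [r3 r3p hr3] := (near_ptP _ _).1 nA.
rewrite -/u -/v -/s -/t in hr1 hr2 hr3.
(* At an interior point this keeps the box in the half-plane; at a boundary point 1 is a dummy
   bound. *)
pose v' := if 0 < v then v else 1; have v'p : 0 < v' by rewrite /v'; case: ifP.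
pose r := Num.min (Num.min r1 r2) (Num.min r3 v'); have rp : 0 < r by rewrite !lt_min r1p r2p r3p.
pose dl := r / (1 + k) / 2.
have dlp : 0 < dl by rewrite !divr_gt0.
have dlr : dl * (1 + k) < r.
  have -> : dl * (1 + k) = r / 2 by rewrite /dl; field; rewrite lt0r_neq0.
  by rewrite ltr_pdivrMr// ltr_pMr// ltr1n.
have dl1 : dl < r by apply: le_lt_trans dlr; rewrite mulrDr mulr1 lerDl mulr_ge0// ltW.
have kdl : k * dl < r by apply: le_lt_trans dlr; rewrite mulrDr mulr1 [k * _]mulrC lerDr ltW.
have kd0 : 0 < k * dl by rewrite mulr_gt0.
have [rr1 rr2 rr3 rr4] : [/\ r <= r1, r <= r2, r <= r3 & r <= v'].
  by split; rewrite /r !ge_min lexx ?orbT.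
(* At a boundary point the box is cut along the boundary line. *)
pose c := if 0 < v then v - k * dl else 0.
have [c0 cv] : 0 <= c /\ v - k * dl <= c <= v.
  rewrite /c; case: ifPn => hv.
    have E : v' = v by rewrite /v' hv.
    rewrite lexx gerBl (ltW kd0) subr_ge0; split => //.
    by apply: (le_trans (ltW kdl)); rewrite -E.
  have vz : v = 0 by apply/eqP; rewrite eq_le v0 andbT leNgt.
  by rewrite vz lexx sub0r oppr_le0 (ltW kd0).
case/andP: cv => cv1 cv2.
have bB q' : box (u - dl) (u + dl) c (v + k * dl) q' -> `|q' 0 0 - u| <= dl /\ `|q' 0 1 - v| <= k * dl.
  by move=> [h /andP[h3 h4]]; rewrite !ler_distl h4 (le_trans cv1 h3) h.
have bA : box (u - dl) (u + dl) c (v + k * dl) `<=` A.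
  move=> q' Bq'; have [h1 h2] := bB _ Bq'; case: Bq' => _ /andP[h3 _].
  apply: hr3; [apply: le_lt_trans h1 _; exact: lt_le_trans dl1 rr3|
    apply: le_lt_trans h2 _; exact: lt_le_trans kdl rr3|exact: le_trans h3].
(* Half of the guaranteed displacement [mu / 2 * dl] of the edges, so that they avoid the square
   strictly. *)
pose e := mu / 2 * dl / 2.
have ep : 0 < e by rewrite !(mulr_gt0, divr_gt0)// invr_gt0.
have e2 : e < mu / 2 * dl by rewrite /e ltr_pdivrMr// ltr_pMr ?ltr1n// mulr_gt0// divr_gt0.
have m1 : mu <= mu1 by rewrite ge_min lexx.
have m2 : mu <= mu2 by rewrite ge_min lexx orbT.
have me1 : e < mu1 / 2 * dl by apply: lt_le_trans e2 _; rewrite ler_pM2r// ler_pM2r.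
have me2 : e < mu2 / 2 * dl by apply: lt_le_trans e2 _; rewrite ler_pM2r// ler_pM2r.
have eta1 : eta * (1 + k) <= mu1 / 2 by rewrite etaE ler_pM2r.
have eta2 : eta * (1 + k^-1) <= mu2 / k / 2.
  have -> : eta * (1 + k^-1) = eta * (1 + k) / k by field; rewrite lt0r_neq0.
  by rewrite etaE mulrAC ler_pM2r ?invr_gt0// ler_pM2r ?invr_gt0.
have mu2E : mu2 / k = l22 - `|l21| * k^-1 by rewrite /mu2; field; rewrite lt0r_neq0.
have ee1 := @edge_estimate l11 l12 k mu1 eta dl _ _ _ dlp kp (ltW etap) eta1 erefl.
have kV : 0 < k^-1 by rewrite invr_gt0.
(* For the horizontal edges the half-side is [k * dl] and the ratio of the other half-side to it is
   [k^-1]. *)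
have ee2 := @edge_estimate l22 l21 k^-1 (mu2 / k) eta (k * dl) _ _ _ kd0 kV (ltW etap) eta2 mu2E.
have mu2k : mu2 / k / 2 * (k * dl) = mu2 / 2 * dl by field; rewrite lt0r_neq0.
rewrite mu2k (mulKf (lt0r_neq0 kp)) in ee2.
clear k1 k2 mup etap etaE r1p r2p r3p rp dlr e2 m1 m2 eta1 eta2 mu2E mu2k g1 g2 l11p l22p v'p rr4 kV.
have {dl1 rr1 rr2 rr3 kdl} [dr1 dr2 kr1 kr2] : [/\ dl < r1, dl < r2, k * dl < r1 & k * dl < r2].
  by split; [exact: lt_le_trans dl1 _|exact: lt_le_trans dl1 _|exact: lt_le_trans kdl _|exact: lt_le_trans kdl _].
clearbody eta e dl r v'.
have uu : u - dl <= u + dl by rewrite lerD2l ge0_cp// ltW.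
have cd : c <= v + k * dl by apply: le_trans cv2 _; rewrite lerDl ltW.
have horiz z y : `|z - u| = dl -> c <= y <= v + k * dl ->
   (z - u = dl -> s + mu1 / 2 * dl <= T (pt z y) 0 0) /\
   (z - u = - dl -> T (pt z y) 0 0 <= s - mu1 / 2 * dl).
  move=> xd yc; have Bz : box (u - dl) (u + dl) c (v + k * dl) (pt z y).
    by apply/box_pt; rewrite -ler_distl xd lexx.
  have [_ yk] := bB _ Bz; rewrite pt1 in yk.
  have := hr1 _ (bA _ Bz); rewrite !pt0 !pt1 xd => /(_ dr1 (le_lt_trans yk kr1)) H.
  rewrite -xd in H; have [H1 H2] := ee1 _ _ _ xd yk H.
  by split=> [/H1|/H2]; [rewrite lerBrDl|rewrite lerBlDl].
have vert z y : `|y - v| = k * dl -> `|z - u| <= dl -> c <= y <= v + k * dl ->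
   (y - v = k * dl -> t + mu2 / 2 * dl <= T (pt z y) 0 1) /\
   (y - v = - (k * dl) -> T (pt z y) 0 1 <= t - mu2 / 2 * dl).
  move=> yd xk yc; have Bz : box (u - dl) (u + dl) c (v + k * dl) (pt z y).
    by apply/box_pt; rewrite -ler_distl.
  have := hr2 _ (bA _ Bz); rewrite !pt0 !pt1 yd => /(_ (le_lt_trans xk dr2) kr2) H.
  rewrite -yd in H; rewrite [l21 * _ + _]addrC [`|z - u| + _]addrC in H.
  have [H1 H2] := ee2 _ _ _ yd xk H.
  by split=> [/H1|/H2]; [rewrite lerBrDl|rewrite lerBlDl].
exists (u - dl), (u + dl), c, (v + k * dl), e; split => //.
  apply/near_ptP; exists (Num.min dl (k * dl)); first by rewrite lt_min dlp.
  move=> q'; rewrite !lt_min -/u -/v => /andP[h1 _] /andP[_ h2] h3.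
  move: h1 h2; rewrite !ltr_distl => /andP[h1 h2] /andP[h4 h5].
  split; apply/andP; split; (try by apply/ltW).
  by rewrite /c; case: ifP => _ //; exact: ltW.
move=> g h cg sg hg sh.
have te : 0 <= t + e by rewrite addr_ge0// ltW.
have se : s - e <= s + e by rewrite lerD2l ge0_cp// ltW.
have sg' q' : g q' != 0 -> box (s - e) (s + e) 0 (t + e) q'.
  by move=> /sg[h1]; rewrite !ler_distl => h2 /andP[h4 h5]; split => //; rewrite h1.
rewrite (dint_box sh) (dint_box sg').
have -> : rint2 (u - dl) (u + dl) c (v + k * dl) h
        = rint2 (u - dl) (u + dl) c (v + k * dl) (fun q' => g (T q') * jacdet T q').
  by apply: rint_ext => x xu; apply: rint_ext => y yv; apply: hg; apply/box_pt.
have nd : `|u - dl - u| = dl by rewrite addrAC subrr sub0r normrN gtr0_norm.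
have pd' : `|u + dl - u| = dl by rewrite addrAC subrr add0r gtr0_norm.
apply: (cv_rect admA bA uu cd TU cT1 cT2 cg se te).
- by move=> q' _; exact: sg'.
- move=> y yc; have [_ H] := horiz _ _ nd yc; apply: le_lt_trans (H _) _; first by rewrite addrAC subrr sub0r.
  by rewrite ltrD2l ltrN2.
- move=> y yc; have [H _] := horiz _ _ pd' yc; apply: lt_le_trans (H _); last by rewrite addrAC subrr add0r.
  by rewrite ltrD2l.
- move=> x xu; have [|||H _] := vert x (v + k * dl) _ _ _.
  + by rewrite addrAC subrr add0r gtr0_norm.
  + by rewrite ler_distl.
  + by rewrite cd lexx.
  apply: (le_trans _ (H _)); last by rewrite addrAC subrr add0r.
  by rewrite lerD2l ltW.
- move=> x xu; case: cases => [vp|[vz hz]].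
    right=> q' _ /sg[_ _]; rewrite ler_distl => /andP[q1 q2].
    have cE : c = v - k * dl by rewrite /c vp.
    have [|||_ H] := vert x c _ _ _.
    + by rewrite cE addrAC subrr sub0r normrN gtr0_norm.
    + by rewrite ler_distl.
    + by rewrite cd lexx.
    apply: le_lt_trans (H _) _; first by rewrite cE addrAC subrr sub0r.
    by apply: lt_le_trans q1; rewrite ltrD2l ltrN2.
  left; apply: hz; last by rewrite pt1 /c vz ltxx.
  by apply: bA; apply/box_pt; rewrite lexx cd.
Qed.

(** As [T] preserves the boundary line, its derivative at [q] is upper triangular; as it preserves
    the half-plane and has positive Jacobian, the diagonal is positive. A flat box then gives the
    dominance. *)
Lemma cv_at_boundary A T q : adm A -> A `<=` upper 0 -> A q -> (forall q, A q -> upper 0 (T q)) ->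
  nbhs q (fun q' : V => 0 <= q' 0 1 -> A q') ->
  C2 A (fun q => T q 0 0) -> C2 A (fun q => T q 0 1) -> 0 < jacdet T q ->
  q 0 1 = 0 -> (forall q', A q' -> q' 0 1 = 0 -> T q' 0 1 = 0) -> cv_at A T q.
Proof.
move=> admA AU Aq TU nA cT1 cT2 J0 q0 hB.
have [cT2' _ _] := cT2.
have l21 : pd 0 (fun q => T q 0 1) q = 0.
  have := @slice0_derive R A _ (q 0 0) (q 0 1) admA _ cT2'; rewrite ptE => /(_ Aq)[_ <-].
  rewrite -(derive_cst (0 : R) (q 0 0) 1); apply: near_eq_derive.
  have h := admA q Aq.
  apply: filterS (near_pt0 h) => u; rewrite pt1 lexx => /(_ isT) Au.
  by rewrite hB// pt1.
(* Otherwise [T] would leave the half-plane just above [q]. *)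
have l22 : 0 <= pd 1 (fun q => T q 0 1) q.
  rewrite leNgt; apply/negP => l0.
  have e0 : 0 < - pd 1 (fun q => T q 0 1) q / 2 by rewrite divr_gt0// oppr_gt0.
  have [r r0 hr] := wd_bound (C1_wd cT2' Aq) Aq e0.
  have [s s0 hs] := (near_ptP _ _).1 nA.
  pose m := Num.min r s / 2.
  have m0 : 0 < m by rewrite divr_gt0// lt_min r0.
  have m1 : m < Num.min r s by rewrite ltr_pdivrMr// ltr_pMr ?ltr1n// lt_min r0.
  have [mr ms] : m < r /\ m < s by move: m1; rewrite lt_min => /andP[].
  have Am : A (pt (q 0 0) (q 0 1 + m)).
    by apply: hs; rewrite ?pt0 ?pt1 ?subrr ?normr0// ?q0 ?add0r ?subr0 ?gtr0_norm ?(ltW m0).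
  have := hr _ Am; rewrite pt0 pt1 subrr normr0 mulr0 add0r [_ + m]addrC addrK gtr0_norm// => /(_ r0 mr).
  rewrite (hB q)// subr0 add0r ler_norml => /andP[_ h].
  have : 0 <= T (pt (q 0 0) (m + q 0 1)) 0 1 by apply: TU; rewrite addrC.
  have : pd 1 (fun q => T q 0 1) q * m < 0 by rewrite pmulr_llt0.
  by move: h; lra.
move: J0; rewrite /jacdet l21 mulr0 subr0 => J0.
have {}l22 : 0 < pd 1 (fun q => T q 0 1) q.
  by rewrite lt_neqAle l22 andbT; apply/eqP => E; rewrite -E mulr0 ltxx in J0.
have l11 : 0 < pd 0 (fun q => T q 0 0) q by rewrite pmulr_lgt0 in J0.
pose k := pd 0 (fun q => T q 0 0) q / (`|pd 1 (fun q => T q 0 0) q| + 1).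
have k0 : 0 < k by rewrite divr_gt0// ltr_wpDl.
have H := @cv_local_good A T q _ _ _ _ k admA AU Aq TU nA cT1 cT2 erefl erefl l21 erefl l11 l22 k0.
apply: H.
- by rewrite /k mulrA ltr_pdivrMr ?ltr_wpDl// mulrC ltr_pM2l// ltrDl.
- by rewrite normr0 mulr_gt0.
- by right.
Qed.

(** [T] is the affine map with the same value and derivative at [q], composed with a map [S] that
    fixes [q] and has identity derivative there. The box argument applies to [S] with ratio 1, and
    the affine factor is a matter of linear algebra. *)
Lemma cv_at_interior A T q : adm A -> A `<=` upper 0 -> A q ->
  nbhs q (fun q' : V => 0 <= q' 0 1 -> A q') ->
  C2 A (fun q => T q 0 0) -> C2 A (fun q => T q 0 1) -> 0 < jacdet T q ->
  0 < q 0 1 -> 0 < T q 0 1 -> cv_at A T q.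
Proof.
move=> admA AU Aq nA cT1 cT2 J0 q0 Tq0.
have [cT1' _ _] := cT1; have [cT2' _ _] := cT2.
set l11 := pd 0 (fun q => T q 0 0) q; set l12 := pd 1 (fun q => T q 0 0) q.
set l21 := pd 0 (fun q => T q 0 1) q; set l22 := pd 1 (fun q => T q 0 1) q.
pose D := l11 * l22 - l12 * l21.
have D0 : 0 < D by exact: J0.
have Dn : D != 0 by exact: lt0r_neq0.
pose e1 := q 0 0 - (l22 / D * T q 0 0 - l12 / D * T q 0 1).
pose e2 := q 0 1 - (- l21 / D * T q 0 0 + l11 / D * T q 0 1).
pose S0 q' := l22 / D * T q' 0 0 + - (l12 / D) * T q' 0 1 + e1.
pose S1 q' := - l21 / D * T q' 0 0 + l11 / D * T q' 0 1 + e2.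
pose S q' : V := pt (S0 q') (S1 q').
have TU q' : A q' -> setT (T q') by [].
have lin (m1 m2 e : R) : let f := fun q' => m1 * T q' 0 0 + m2 * T q' 0 1 + e in
  [/\ C2 A f, forall q', A q' -> pd 0 f q' = m1 * pd 0 (fun q => T q 0 0) q' + m2 * pd 0 (fun q => T q 0 1) q'
   & forall q', A q' -> pd 1 f q' = m1 * pd 1 (fun q => T q 0 0) q' + m2 * pd 1 (fun q => T q 0 1) q'].
  move=> f; have admT := adm_setT.
  have [c k0 k1] := C1_lin m1 m2 e admT; have [c' _ _] := c.
  have [_ h0 h1] := C1_comp admA admT TU cT1' cT2' c'.
  split; first exact: (C2_comp admA admT TU cT1 cT2 c).
    by move=> q' Aq'; have := h0 q' Aq'; rewrite k0// k1.
  by move=> q' Aq'; have := h1 q' Aq'; rewrite k0// k1.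
have [cS0 dS00 dS01] := lin (l22 / D) (- (l12 / D)) e1.
have [cS1 dS10 dS11] := lin (- l21 / D) (l11 / D) e2.
have Sq : S q = q by apply: eq_pt; rewrite ?pt0 ?pt1 /S0 /S1 /e1 /e2; ring.
(* [S] may leave the half-plane; only the part of [A] that it keeps above the boundary line is
   retained. *)
pose A' := A `&` [set q' | 0 < S1 q'].
have admA' : adm A'.
  by apply: adm_lt => // q' Aq'; apply: C1_cont => //; case: cS1.
have A'A : A' `<=` A by move=> q' [].
have S1q : S1 q = q 0 1 by rewrite -[in RHS]Sq pt1.
have A'q : A' q by split => //=; rewrite S1q.
have cS0' : C2 A' (fun q' => S q' 0 0).
  by apply: C2_ext (C2_sub admA admA' A'A cS0) => // q' _; rewrite pt0.
have cS1' : C2 A' (fun q' => S q' 0 1).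
  by apply: C2_ext (C2_sub admA admA' A'A cS1) => // q' _; rewrite pt1.
have SE0 i : pd i (fun q' => S q' 0 0) = pd i S0 by congr (pd i _); apply/funext => q'; rewrite pt0.
have SE1 i : pd i (fun q' => S q' 0 1) = pd i S1 by congr (pd i _); apply/funext => q'; rewrite pt1.
have nA' : nbhs q (fun q' : V => 0 <= q' 0 1 -> A' q').
  have cS : cont A S1 q by apply: C1_cont => //; case: cS1.
  have hq : 0 < q 0 1 by [].
  have := near_cont cS hq => h.
  apply: filterS2 h nA => q' h1 h2 h3; have Aq' := h2 h3; split => //=.
  by have := h1 Aq'; rewrite S1q ltr_distlC => /andP[h4 h5]; lra.
have SU q' : A' q' -> upper 0 (S q') by move=> [_ /= h]; rewrite /upper/= pt1 ltW.
have A'U : A' `<=` upper 0 by move=> q' [/AU].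
have [] := @cv_local_good A' S q 1 0 0 1 1 admA' A'U A'q SU nA' cS0' cS1'.
- by rewrite SE0 dS00// -/l11 -/l21 /D; field; exact: Dn.
- by rewrite SE0 dS01// -/l12 -/l22 /D; field; exact: Dn.
- by rewrite SE1 dS10// -/l11 -/l21 /D; field; exact: Dn.
- by rewrite SE1 dS11// -/l12 -/l22 /D; field; exact: Dn.
- exact: ltr01.
- exact: ltr01.
- exact: ltr01.
- by rewrite normr0 mul0r.
- by rewrite normr0 mul1r.
- by left.
move=> a [b [c [d [e [e0 Bo nB H]]]]].
have [k k0 hk] := lin_bound Dn.
(* The first bound puts the support of [g] composed with the affine map in the [e]-square around [q]
   and in the half-plane; the second keeps the support of [g] away from the boundary line. *)
pose e' := Num.min (Num.min e (q 0 1) / k) (T q 0 1 / 2).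
have e'0 : 0 < e' by rewrite lt_min !divr_gt0// lt_min e0.
exists a, b, c, d, e'; split => //; first exact: subset_trans A'A.
move=> g h cg sg hg sh.
have g0 q' : T q 0 1 / 2 < `|q' 0 1 - T q 0 1| -> g q' = 0.
  move=> h'; apply/eqP; apply: contraTT h' => /sg[_ _ h'].
  by rewrite -leNgt; apply: le_trans h' _; rewrite ge_min lexx orbT.
(* The affine change of variables takes place in the whole plane, hence [g] must be C^1 there; it
   vanishes below the height [T q 0 1 / 2]. *)
have cgT : C1 setT g.
  apply: C1_local => q' _; have [q'0|q'0] := ltP 0 (q' 0 1).
    exists (upper 0); split; last by rewrite setTI.
    apply/near_ptP; exists (q' 0 1) => // w _; rewrite ltr_distl => /andP[h' _].
    by rewrite /upper/=; move: h'; rewrite subrr => /ltW.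
  exists [set w | w 0 1 < T q 0 1 / 2]; split.
    apply/near_ptP; exists (T q 0 1 / 2); first by rewrite divr_gt0.
    by move=> w _; rewrite ltr_distl => /andP[_ h'] /=; lra.
  rewrite setTI; have admL : adm [set w : V | w 0 1 < T q 0 1 / 2].
    move=> w /= hw; apply/near_ptP; exists (T q 0 1 / 2 - w 0 1); first by rewrite subr_gt0.
    by move=> w' _; rewrite ltr_distl subrKC => /andP[].
  have [cz _ _] := C1_cst (0 : R) admL; apply: C1_ext cz => // w /= hw; symmetry; apply: g0.
  by rewrite ltr0_norm; lra.
have bg : bounded_support g.
  exists (`|T q 0 0| + `|T q 0 1| + e'); first by rewrite !addr_ge0// ltW.
  move=> q' /sg[_ h1 h2]; split.
    rewrite -(subrK (T q 0 0) (q' 0 0)); apply: le_trans (ler_normD _ _) _.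
    by have := normr_ge0 (T q 0 1); lra.
  rewrite -(subrK (T q 0 1) (q' 0 1)); apply: le_trans (ler_normD _ _) _.
  by have := normr_ge0 (T q 0 0); lra.
pose f1 := T q 0 0 - l11 * q 0 0 - l12 * q 0 1.
pose f2 := T q 0 1 - l21 * q 0 0 - l22 * q 0 1.
rewrite -(cvlin_det D0 f1 f2 cgT bg).
apply: H => //.
- by apply: C1_subE (aff_C1 l11 l12 l21 l22 f1 f2 cgT) => //; [exact: adm_setT|exact: adm_upper].
- move=> q'; rewrite mulf_eq0 negb_or => /andP[/sg[h1 h2 h3] _].
  rewrite pt0 in h2; rewrite pt1 in h1 h3.
  have E1 : l11 * (q' 0 0 - q 0 0) + l12 * (q' 0 1 - q 0 1) = l11 * q' 0 0 + l12 * q' 0 1 + f1 - T q 0 0.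
    by rewrite /f1; ring.
  have E2 : l21 * (q' 0 0 - q 0 0) + l22 * (q' 0 1 - q 0 1) = l21 * q' 0 0 + l22 * q' 0 1 + f2 - T q 0 1.
    by rewrite /f2; ring.
  have : k * e' <= Num.min e (q 0 1) by rewrite mulrC -ler_pdivlMr// ge_min lexx.
  rewrite le_min => /andP[ke kq].
  have [||H1 H2] := hk (q' 0 0 - q 0 0) (q' 0 1 - q 0 1) e'; rewrite ?E1 ?E2//.
  rewrite Sq; split; [|exact: le_trans H1 ke|exact: le_trans H2 ke].
  by have := le_trans H2 kq; rewrite ler_distl subrr => /andP[].
- move=> q' Bq'; rewrite hg//.
  have Aq' : A q' by exact: A'A (Bo _ Bq').
  rewrite -mulrA; congr (_ * _).
    by congr g; apply: eq_pt; rewrite /aff !(pt0, pt1) /S0 /S1 /f1 /f2 /e1 /e2 /D; field; exact: Dn.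
  rewrite /jacdet !SE0 !SE1 dS00// dS01// dS10// dS11//.
  by rewrite /D; field; exact: Dn.
Qed.

End LocalChangeOfVariables.

(** * From smooth maps to the C^2 calculus within a set *)

Section Smooth.
Variable R : realType.
Local Notation V := 'rV[R]_2.
Implicit Types (A S U : set V) (q : V) (f : V -> R).

(** The Frechet remainder [r] is shared between the coordinates as [r x / (x^2 + y^2)] times [x]
    plus [r y / (x^2 + y^2)] times [y], where [(x, y)] is the increment. Both factors tend to 0
    because [r] is small with respect to the sup norm of the increment, whose square is at most
    [x^2 + y^2]. *)
Lemma diff_wd f q : differentiable f q ->
  wd setT f q ('D_(delta_mx 0 0) f q) ('D_(delta_mx 0 1) f q).
Proof.
move=> df; rewrite !deriveE//.
set a := 'd f q (delta_mx 0 0); set b := 'd f q (delta_mx 0 1).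
pose r q' := f q' - f q - (a * (q' 0 0 - q 0 0) + b * (q' 0 1 - q 0 1)).
pose n2 q' := (q' 0 0 - q 0 0) ^+ 2 + (q' 0 1 - q 0 1) ^+ 2.
have lin (h : V) : 'd f q h = a * h 0 0 + b * h 0 1.
  have {1}-> : h = h 0 0 *: delta_mx 0 0 + h 0 1 *: delta_mx 0 1.
    by apply/rowP; apply: ord2P; rewrite !mxE !eqxx/= ?mulr1 ?mulr0 ?addr0 ?add0r.
  by rewrite linearD !linearZ /= [_ *: a]mulrC [_ *: b]mulrC.
have hr (e : R) : 0 < e -> \forall q' \near q, `|r q'| <= e * `|q' - q|.
  move=> e0; have /eqaddoP/(_ _ e0) := diff_locally df.
  move=> /nbhs_normP[d /= d0 hd]; apply/nbhs_normP; exists d => //= q' /= qq'.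
  have h0 : ball_ Num.norm 0 d (q' - q) by rewrite /ball_/= sub0r normrN distrC.
  have : `|(f \o shift q) (q' - q) - (cst (f q) + 'd f q) (q' - q)| <= e * `|q' - q| := hd _ h0.
  have -> : (f \o shift q) (q' - q) = f q' by rewrite /= subrK.
  have -> : (cst (f q) + 'd f q) (q' - q) = f q + 'd f q (q' - q) by [].
  by rewrite lin !mxE opprD addrA.
have nn (q' : V) : q' <> q -> 0 < n2 q'.
  move=> qq'; rewrite lt_neqAle addr_ge0 ?sqr_ge0// andbT eq_sym; apply/eqP.
  move=> /eqP; rewrite paddr_eq0 ?sqr_ge0// !sqrf_eq0 !subr_eq0 => /andP[/eqP h0 /eqP h1].
  by apply: qq'; exact: eq_pt.
have cc (l : R) (i : 'I_2) : cont setT (fun q' => l + r q' * (q' 0 i - q 0 i) / n2 q') q.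
  apply/(@cvgrPdist_le _ _ _ _ _) => e e0.
  suff : \forall q' \near q, setT q' -> `|l + r q * (q 0 i - q 0 i) / n2 q - (l + r q' * (q' 0 i - q 0 i) / n2 q')| <= e by [].
  apply: filterS (hr e e0) => q' hq' _.
  rewrite subrr mulr0 mul0r addr0 opprD addrA subrr sub0r normrN.
  have [->|/eqP/nn n0] := eqVneq q' q; first by rewrite subrr mulr0 mul0r normr0 ltW.
  rewrite normrM normfV (gtr0_norm n0) ler_pdivrMr// normrM.
  apply: le_trans (ler_wpM2r (normr_ge0 _) hq') _.
  rewrite -mulrA ler_pM2l//.
  have hi : `|q' 0 i - q 0 i| <= `|q' - q| by apply: le_trans (coord_le_norm _ i); rewrite !mxE.
  apply: (@le_trans _ _ (`|q' - q| ^+ 2)); first by rewrite expr2 ler_wpM2l.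
  have n0' := ltW n0.
  rewrite -[leRHS]sqr_sqrtr// lerXn2r ?nnegrE ?sqrtr_ge0//.
  rewrite [leLHS]/Num.Def.normr/= mx_normrE; apply: bigmax_le; first exact: sqrtr_ge0.
  move=> -[i0 j] _ /=; rewrite (ord1 i0) !mxE -sqrtr_sqr ler_sqrt//.
  by move: j; apply: ord2P; rewrite /n2 ?lerDl ?lerDr sqr_ge0.
exists (fun q' => a + r q' * (q' 0 0 - q 0 0) / n2 q'), (fun q' => b + r q' * (q' 0 1 - q 0 1) / n2 q').
split; [exact: cc|exact: cc|by rewrite subrr mulr0 mul0r addr0|by rewrite subrr mulr0 mul0r addr0|].
apply: near_all => q' _.
have [->|/eqP/nn n0] := eqVneq q' q; first by rewrite !subrr !mulr0 !addr0.
have -> : f q' = f q + (a * (q' 0 0 - q 0 0) + b * (q' 0 1 - q 0 1)) + r q' by rewrite /r; ring.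
have {1}-> : r q' = r q' * n2 q' / n2 q' by rewrite mulfK// lt0r_neq0.
by rewrite {1}/n2; ring.
Qed.

Section vector.
Variables (n : nat) (g : V -> 'rV[R]_n.+1).

Lemma diff_coord q j : differentiable g q -> differentiable (fun q => g q 0 j) q.
Proof.
by move=> dg; apply: (@differentiable_comp _ _ _ _ g (fun N : 'rV[R]_n.+1 => N 0 j)) => //; exact: differentiable_coord.
Qed.

Lemma derive_coord q v j : differentiable g q -> 'D_v (fun q => g q 0 j) q = 'D_v g q 0 j.
Proof.
by move=> dg; rewrite derive_mx ?mxE//; exact: diff_derivable.
Qed.

Lemma diffs_C1 U j : open U -> (forall q, U q -> differentiable g q) ->
  (forall v q, U q -> differentiable ('D_v g) q) ->
  [/\ C1 U (fun q => g q 0 j),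
    forall q, U q -> pd 0 (fun q => g q 0 j) q = 'D_(delta_mx 0 0) g q 0 j
  & forall q, U q -> pd 1 (fun q => g q 0 j) q = 'D_(delta_mx 0 1) g q 0 j].
Proof.
move=> oU dg ddg; apply: C1I => [|q Uq|q Uq|q Uq]; first exact: adm_open.
- rewrite -!derive_coord; [|exact: dg|exact: dg].
  by apply: wd_sub (diff_wd (diff_coord j (dg _ Uq))).
- apply: cont_coord; apply: cvg_within_filter.
  exact: differentiable_continuous (ddg _ _ Uq).
- apply: cont_coord; apply: cvg_within_filter.
  exact: differentiable_continuous (ddg _ _ Uq).
Qed.

End vector.

Lemma smooth_on_C2 n (g : V -> 'rV[R]_n.+1) U j : open U -> smooth_on U g -> C2 U (fun q => g q 0 j).
Proof.
move=> oU sg.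
have h0 q : U q -> differentiable g q by exact: (sg [::] q).
have h1 v q : U q -> differentiable ('D_v g) q by exact: (sg [:: v] q).
have h2 v w q : U q -> differentiable ('D_w ('D_v g)) q by exact: (sg [:: w; v] q).
have [c c0 c1] := diffs_C1 j oU h0 h1.
have aU := adm_open oU.
split; first exact: c.
  apply: (C1_ext aU (fun q Uq => esym (c0 q Uq))).
  by have [] := diffs_C1 j oU (h1 (delta_mx 0 0)) (h2 (delta_mx 0 0)).
apply: (C1_ext aU (fun q Uq => esym (c1 q Uq))).
by have [] := diffs_C1 j oU (h1 (delta_mx 0 1)) (h2 (delta_mx 0 1)).
Qed.

(** The local extensions are C^2 on open sets, and Caratheodory's condition passes to the part of
    [S] inside them; since it determines the derivatives within [S], the choice of the extensions
    does not matter. *)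
Lemma smooth_upto_C2 n (f : V -> 'rV[R]_n.+1) S j : adm S -> smooth_upto S f -> C2 S (fun q => f q 0 j).
Proof.
move=> aS sf; apply: C2_local => q Sq; have [U [g [oU Uq sg fg]]] := sf q Sq.
exists U; split; first exact: open_nbhs_nbhs.
have aSU : adm (S `&` U) by apply: admI => //; exact: adm_open.
apply: (C2_ext aSU (f := fun q => g q 0 j)).
  by move=> q' [Sq' Uq']; rewrite fg.
apply: C2_sub (smooth_on_C2 j oU sg) => //; exact: adm_open.
Qed.

Lemma partial_coord n (F : V -> 'rV[R]_n.+1) S q i j : adm S -> S q ->
  (forall j, C1 S (fun q => F q 0 j)) -> partial i F q 0 j = pd i (fun q => F q 0 j) q.
Proof.
move=> aS Sq cF; rewrite /partial /rderive.
suff : (h^-1 *: (F (q + h *: delta_mx 0 i) - F q)) @[h --> (0 : R)^'+] --> \row_j pd i (fun q => F q 0 j) q.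
  by move=> /cvg_lim -> //; rewrite mxE.
have H k : (h^-1 *: (F (q + h *: delta_mx 0 i) 0 k - F q 0 k)) @[h --> (0 : R)^'+] --> pd i (fun q => F q 0 k) q.
  have [h0 h1] := wd_cvg aS Sq (C1_wd (cF k) Sq).
  by move: i; apply: ord2P.
apply/cvgrPdist_lt => e e0; near=> h.
rewrite [ltLHS]/Num.Def.normr/= mx_normrE.
apply/bigmax_ltP; split => // -[i0 k] _ /=; rewrite (ord1 i0) !mxE.
move: k; near: h; apply: filter_forall => k.
exact: (@cvgrPdist_lt _ _ _ _ _ _ _).1 (H k) _ e0.
Unshelve. all: by end_near. Qed.

Lemma sum_ord2 (F : 'I_2 -> R) : \sum_k F k = F 0 + F 1.
Proof. by rewrite big_ord_recl big_ord1; congr (F _ + F _); exact: val_inj. Qed.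

Lemma det2 (B : 'M[R]_2) : \det B = B 0 0 * B 1 1 - B 0 1 * B 1 0.
Proof.
rewrite (expand_det_row _ 0) sum_ord2 /cofactor !det_mx11 !mxE/= expr0 mul1r expr1 mulN1r mulrN.
by congr (_ * B _ _ - _ * B _ _); exact: val_inj.
Qed.

Lemma det_jac (T : V -> V) S q : adm S -> S q ->
  C1 S (fun q => T q 0 0) -> C1 S (fun q => T q 0 1) -> \det (jac T q) = jacdet T q.
Proof.
move=> aS Sq c0 c1.
have cT j : C1 S (fun q => T q 0 j) by move: j; apply: ord2P.
have P i j : partial i T q 0 j = pd i (fun q => T q 0 j) q := partial_coord i j aS Sq cT.
by rewrite det2 !mxE !P /jacdet [X in _ - X]mulrC.
Qed.

End Smooth.

(** * Stokes' theorem on a compact surface *)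

Section Manifold.
Variables (R : realType) (M : topologicalType) (A : oriented_atlas R M).
Local Notation V := 'rV[R]_2.
Implicit Types (c : chart R M) (p : M) (q : V).

Lemma cimg_upper c : cimg c `<=` upper 0.
Proof. by have [W oW E] := cimg_open c; rewrite /cimg E; move=> q []. Qed.

Lemma cimg_full c q : cimg c q -> nbhs q (fun q' : V => 0 <= q' 0 1 -> cimg c q').
Proof.
have [W oW E] := cimg_open c; rewrite /cimg E => -[Wq _].
have : nbhs q W by exact: open_nbhs_nbhs.
by apply: filterS => q' Wq' h; split.
Qed.

Lemma full_adm (B : set V) : B `<=` upper 0 -> (forall q, B q -> nbhs q (fun q' : V => 0 <= q' 0 1 -> B q')) -> adm B.
Proof.
move=> BU h q Bq; apply: filterS (h q Bq) => q' h' qq'; apply: h'; apply: le_trans qq'; exact: BU Bq.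
Qed.

Lemma cimg_adm c : adm (cimg c).
Proof. by apply: full_adm; [exact: cimg_upper|exact: cimg_full]. Qed.

Lemma cimgP c p : cdom c p -> cimg c (cmap c p).
Proof. by move=> cp; exists p. Qed.

Lemma inv_dom c q : cimg c q -> cdom c (chart_inv c q).
Proof. by move=> [p cp <-]; rewrite cmapK. Qed.

Lemma invK c q : cimg c q -> cmap c (chart_inv c q) = q.
Proof. by move=> [p cp <-]; rewrite cmapK. Qed.

Lemma dom_near c p : cdom c p -> nbhs p (cdom c).
Proof. by move=> cp; apply: open_nbhs_nbhs; split => //; exact: cdom_open. Qed.

Lemma map_near c p (P : set V) : cdom c p -> nbhs (cmap c p) P -> nbhs p (fun p' => cdom c p' /\ P (cmap c p')).
Proof.
move=> cp Pp; have /subspace_continuousP/(_ p cp)/(_ _ Pp) h := @cmap_continuous R M c.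
have {}h : nbhs p (fun p' => cdom c p' -> P (cmap c p')) by exact: h.
by apply: filterS2 h (dom_near cp) => p' h1 h2; split => //; exact: h1.
Qed.

Lemma inv_near c q (P : set M) : cimg c q -> nbhs (chart_inv c q) P ->
  nbhs q (fun q' : V => 0 <= q' 0 1 -> P (chart_inv c q')).
Proof.
move=> cq Pq; have /subspace_continuousP/(_ q cq)/(_ _ Pq) h := @chart_inv_continuous R M c.
have {}h : nbhs q (fun q' => cimg c q' -> P (chart_inv c q')) by exact: h.
by apply: filterS2 h (cimg_full cq) => q' h1 h2 h3; apply: h1; exact: h2.
Qed.

Definition ovl c c' : set V := cmap c @` (cdom c `&` cdom c').
Definition trans c c' : V -> V := cmap c' \o chart_inv c.

Lemma ovlP c c' q : ovl c c' q <-> cimg c q /\ cdom c' (chart_inv c q).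
Proof.
split=> [[p [cp c'p] <-]|[cq c'q]]; first by split; [exact: cimgP|rewrite cmapK].
by exists (chart_inv c q); [split => //; exact: inv_dom|exact: invK].
Qed.

Lemma ovl_full c c' q : ovl c c' q -> nbhs q (fun q' : V => 0 <= q' 0 1 -> ovl c c' q').
Proof.
move=> /ovlP[cq c'q].
apply: filterS2 (cimg_full cq) (inv_near cq (dom_near c'q)) => q' h1 h2 h3.
by apply/ovlP; split; [exact: h1|exact: h2].
Qed.

Lemma ovl_upper c c' : ovl c c' `<=` upper 0.
Proof. by move=> q /ovlP[/cimg_upper]. Qed.

Lemma ovl_adm c c' : adm (ovl c c').
Proof. by apply: full_adm; [exact: ovl_upper|exact: ovl_full]. Qed.

Lemma trans_ovl c c' q : ovl c c' q -> cimg c' (trans c c' q).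
Proof. by move=> /ovlP[cq c'q]; exact: cimgP. Qed.

Lemma trans_inv c c' q : ovl c c' q -> chart_inv c' (trans c c' q) = chart_inv c q.
Proof. by move=> /ovlP[cq c'q]; rewrite /trans/= cmapK. Qed.

Lemma trans_cmap c c' p : cdom c p -> trans c c' (cmap c p) = cmap c' p.
Proof. by move=> cp; rewrite /trans/= cmapK. Qed.

Lemma ovl_cmap c c' p : cdom c p -> cdom c' p -> ovl c c' (cmap c p).
Proof. by move=> cp c'p; exists p. Qed.

Lemma trans_C2 c c' j : charts A c -> charts A c' -> C2 (ovl c c') (fun q => trans c c' q 0 j).
Proof.
by move=> Ac Ac'; apply: smooth_upto_C2; [exact: ovl_adm|exact: (transition_smooth Ac Ac')].
Qed.

Lemma trans_jac c c' q : charts A c -> charts A c' -> ovl c c' q -> 0 < jacdet (trans c c') q.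
Proof.
move=> Ac Ac' Oq; have [cp cq] : cimg c q /\ cdom c' (chart_inv c q) by exact/ovlP.
have := transition_positive Ac Ac' (inv_dom cp) cq; rewrite invK//.
rewrite (det_jac (@ovl_adm c c') Oq)//.
  by have [] := trans_C2 0 Ac Ac'.
by have [] := trans_C2 1 Ac Ac'.
Qed.

(** Fermat's rule: the first-order estimate at displacements of both signs bounds the two
    coefficients by every positive [e]. *)
Lemma wd_min (B : set V) (f : V -> R) q a b : nbhs q B -> (forall q', B q' -> f q <= f q') ->
  wd B f q a b -> a = 0 /\ b = 0.
Proof.
move=> nB fm w; have Bq : B q by exact: nbhs_singleton.
have H (e : R) : 0 < e -> `|a| <= e /\ `|b| <= e.
  move=> e0; have [r r0 hr] := wd_bound w Bq e0.
  have [s s0 hs] := (near_ptP _ _).1 nB.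
  pose m := Num.min r s / 2.
  have m0 : 0 < m by rewrite divr_gt0// lt_min r0.
  have m1 : m < Num.min r s by rewrite ltr_pdivrMr// ltr_pMr ?ltr1n// lt_min r0.
  have [mr ms] : m < r /\ m < s by move: m1; rewrite lt_min => /andP[].
  have K x y : `|x| <= m -> `|y| <= m -> - (e * (`|x| + `|y|)) <= a * x + b * y.
    move=> xm ym; have Bxy : B (pt (q 0 0 + x) (q 0 1 + y)).
      by apply: hs; rewrite ?pt0 ?pt1 addrAC subrr add0r; exact: le_lt_trans ms.
    have := hr _ Bxy; rewrite !pt0 !pt1 [q 0 0 + x]addrC [q 0 1 + y]addrC !addrK.
    move=> /(_ (le_lt_trans xm mr) (le_lt_trans ym mr)).
    have := fm _ Bxy; rewrite [q 0 0 + x]addrC [q 0 1 + y]addrC ler_norml => h1 /andP[h2 h3].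
    by move: h1 h2 h3; lra.
  have nm : `|m| = m by rewrite gtr0_norm.
  have nm' : `|- m| = m by rewrite normrN.
  have Z := K _ _ _ _.
  split; rewrite ler_norml -(ler_pM2r m0) -[X in _ && X](ler_pM2r m0).
    have := K m 0; have := K (- m) 0; rewrite nm nm' normr0 !mulr0 !addr0 lexx (ltW m0).
    by move=> /(_ isT isT) h1 /(_ isT isT) h2; apply/andP; split; move: h1 h2; rewrite mulrN; lra.
  have := K 0 m; have := K 0 (- m); rewrite nm nm' normr0 !mulr0 !add0r lexx (ltW m0).
  by move=> /(_ isT isT) h1 /(_ isT isT) h2; apply/andP; split; move: h1 h2; rewrite mulrN; lra.
by split; apply/eqP; rewrite -normr_le0; apply/ler_addgt0Pl => e /H[]; rewrite addr0.
Qed.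

(** If [p] were interior in [c'], the second coordinate of the transition map to [c] would have an
    interior minimum 0 there; its gradient would vanish, against the positive Jacobian. *)
Lemma boundary_chart c c' p : charts A c -> charts A c' -> cdom c p -> cdom c' p ->
  cmap c p 0 1 = 0 -> cmap c' p 0 1 = 0.
Proof.
move=> Ac Ac' cp c'p p0; apply/eqP; apply: contraT => p'0.
have Oq : ovl c' c (cmap c' p) by exact: ovl_cmap.
have pos : 0 < cmap c' p 0 1 by rewrite lt_neqAle eq_sym p'0; exact: (ovl_upper Oq).
have [cT _ _] := trans_C2 1 Ac' Ac.
have near_pos : nbhs (cmap c' p) (ovl c' c).
  have h : nbhs (cmap c' p) (fun q' : V => 0 <= q' 0 1).
    apply/near_ptP; exists (cmap c' p 0 1) => // w _; rewrite ltr_distl subrr => /andP[h _].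
    exact: ltW.
  by apply: filterS2 (ovl_full Oq) h => q' h1; exact: h1.
have [|a0 b0] := wd_min near_pos _ (C1_wd cT Oq).
  move=> q' Oq'; rewrite trans_cmap// p0.
  by apply: (@cimg_upper c); exact: trans_ovl.
by have := trans_jac Ac' Ac Oq; rewrite /jacdet a0 b0 !mulr0 subr0 ltxx.
Qed.

Definition loc c (f : M -> R) : V -> R := f \o chart_inv c.
Definition MC2 (f : M -> R) := forall c, charts A c -> C2 (cimg c) (loc c f).

Lemma MC2_cst k : MC2 (fun=> k).
Proof. by move=> c Ac; apply: C2_cst; exact: cimg_adm. Qed.

Lemma MC2D f g : MC2 f -> MC2 g -> MC2 (fun p => f p + g p).
Proof. by move=> hf hg c Ac; apply: C2D; [exact: cimg_adm|exact: hf|exact: hg]. Qed.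

Lemma MC2M f g : MC2 f -> MC2 g -> MC2 (fun p => f p * g p).
Proof. by move=> hf hg c Ac; apply: C2M; [exact: cimg_adm|exact: hf|exact: hg]. Qed.

Lemma MC2_sum n (f : 'I_n -> M -> R) : (forall i, MC2 (f i)) -> MC2 (fun p => \sum_i f i p).
Proof.
elim: n f => [|n IH] f hf.
  by rewrite (_ : (fun p => _) = fun=> 0); [exact: MC2_cst|apply/funext => p; rewrite big_ord0].
rewrite (_ : (fun p => _) = fun p => f ord0 p + \sum_(i < n) f (lift ord0 i) p).
  by apply: MC2D => //; exact: IH.
by apply/funext => p; rewrite big_ord_recl.
Qed.

Lemma MC2V f : (forall p, 0 < f p) -> MC2 f -> MC2 (fun p => (f p)^-1).
Proof.
move=> f0 hf c Ac.
pose k (x : R) := x^-1; pose k' (x : R) := - (x * x)^-1; pose k'' (x : R) := (x + x) / (x * x * (x * x)).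
have ne (y : R) : y != 0 -> \forall z \near y, z != 0.
  by move=> y0; apply: open_nbhs_nbhs; split => //; exact: open_neq.
have n0 q : loc c f q != 0 by rewrite gt_eqF// f0.
have cid (y : R) : id z @[z --> y] --> y by exact: cvg_id.
apply: (@C2_comp1 R (cimg c) (loc c f) k k' k''); [exact: cimg_adm|exact: hf|move=> q _|move=> q _|move=> q _].
- apply: (@caratheodory_derive _ k (fun z => - (z * loc c f q)^-1)).
    apply: filterS (ne _ (n0 q)) => z z0; rewrite /k; field.
    by rewrite (n0 q) z0.
  by apply: cvgN; apply: cvgV; [rewrite mulf_neq0|apply: cvgM; [exact: cid|exact: cvg_cst]].
- apply: (@caratheodory_derive _ k' (fun z => (z + loc c f q) / (z * z * (loc c f q * loc c f q)))).
    apply: filterS (ne _ (n0 q)) => z z0; rewrite /k'; field.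
    by rewrite (n0 q) z0.
  apply: cvgM; first by apply: cvgD; [exact: cid|exact: cvg_cst].
  apply: cvgV; first by rewrite !mulf_neq0.
  by apply: cvgM; [apply: cvgM; exact: cid|exact: cvg_cst].
- apply: cvgM; first by apply: cvgD; exact: cid.
  apply: cvgV; first by rewrite !mulf_neq0.
  by apply: cvgM; apply: cvgM; exact: cid.
Qed.

Lemma MC2_continuous f : MC2 f -> continuous f.
Proof.
move=> hf p; have [c Ac cp] := charts_cover A p.
have [h _ _] := hf c Ac; have := C1_cont h (cimgP cp).
move=> h1; have {h1} : loc c f @ within (cimg c) (nbhs (cmap c p)) --> f p by move: h1; rewrite /cont /loc/= cmapK.
move=> h1 P /h1 h2; have {}h2 : nbhs (cmap c p) (fun q' => cimg c q' -> P (loc c f q')) by exact: h2.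
have := map_near cp h2; apply: filterS => p' [cp'] /(_ (cimgP cp')).
by rewrite /loc/= cmapK.
Qed.

End Manifold.

(** * Bump functions and partitions of unity *)

Section Bumps.
Variables (R : realType) (M : topologicalType) (A : oriented_atlas R M).
Local Notation V := 'rV[R]_2.
Implicit Types (c : chart R M) (p : M) (q : V).

Lemma max0_continuous : continuous (fun t : R => Num.max 0 t).
Proof.
by move=> t; apply: (@continuous_max _ _ (cst 0) id); [exact: cvg_cst|exact: cvg_id].
Qed.

(** At 0 the power of exponent [n.+1] is itself the difference quotient. The cube of the positive
    part is therefore C^2, and bump functions can be built from it. *)
Lemma max0X_derive n (t : R) :
  is_derive t 1 (fun t : R => Num.max 0 t ^+ n.+2) (n.+2%:R * Num.max 0 t ^+ n.+1).
Proof.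
have /or3P[t0|t0|/eqP t0] : [|| t < 0, 0 < t | t == 0] by case: ltgtP.
- rewrite (max_idPl (ltW t0)) [0 ^+ n.+1]expr0n/= mulr0.
  apply: (@near_eq_is_derive _ _ _ (cst (0 : R))).
  near=> z; have z0 : z <= 0 by apply: ltW; near: z; exact: (lt_nbhsl t0).
  by rewrite (max_idPl z0) expr0n.
- rewrite (max_idPr (ltW t0)).
  apply: (@near_eq_is_derive _ _ _ (fun z : R => z ^+ n.+2)).
    near=> z; have z0 : 0 <= z by apply: ltW; near: z; exact: (lt_nbhsr t0).
    by rewrite (max_idPr z0).
  split; first exact: exprn_derivable.
  by rewrite exp_derive scaleRE mulr1.
- rewrite t0; have -> : n.+2%:R * Num.max 0 0 ^+ n.+1 = (fun t : R => Num.max 0 t ^+ n.+1) 0 :> R.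
    by rewrite maxxx expr0n/= mulr0.
  apply: (@caratheodory_derive R (fun t => Num.max 0 t ^+ n.+2) (fun t => Num.max 0 t ^+ n.+1) 0).
    near=> z; rewrite maxxx [0 ^+ n.+2]expr0n/= add0r subr0 exprSr.
    have /orP[z0|z0] := le_total z 0; first by rewrite (max_idPl z0) expr0n !mul0r.
    by rewrite (max_idPr z0).
  by apply: (@continuous_comp _ _ _ (fun t : R => Num.max 0 t) (fun x : R => x ^+ n.+1));
    [exact: max0_continuous|exact: exprn_continuous].
Unshelve. all: by end_near. Qed.

Lemma C2_cube (S : set V) (f : V -> R) : adm S -> C2 S f -> C2 S (fun q => Num.max 0 (f q) ^+ 3).
Proof.
move=> aS cf.
apply: (@C2_comp1 R S f (fun t => Num.max 0 t ^+ 3) (fun t => 3%:R * Num.max 0 t ^+ 2)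
   (fun t => 3%:R * (2%:R * Num.max 0 t ^+ 1)) aS cf) => q _.
- exact: (@max0X_derive 1).
- by have h := @max0X_derive 0 (f q); apply: is_deriveZ.
- apply: cvgM; first exact: cvg_cst.
  by apply: cvgM; [exact: cvg_cst|exact: max0_continuous].
Qed.

(** A piecewise polynomial C^2 bump, positive exactly inside the square of half-side [r] around
    [(u, v)] when [r] is positive. *)
Definition bump2 (u v r : R) q : R :=
  Num.max 0 (r ^+ 2 - (q 0 0 - u) ^+ 2) ^+ 3 * Num.max 0 (r ^+ 2 - (q 0 1 - v) ^+ 2) ^+ 3.

Lemma bump2_C2 (S : set V) u v r : adm S -> C2 S (bump2 u v r).
Proof.
move=> aS.
have H (f : V -> R) (w : R) : C2 S f -> C2 S (fun q => Num.max 0 (r ^+ 2 - (f q - w) ^+ 2) ^+ 3).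
  move=> cf; apply: C2_cube => //.
  have c1 : C2 S (fun q => f q + - w) by apply: C2D => //; exact: C2_cst.
  have c2 := C2M aS c1 c1.
  have c3 : C2 S (fun q => r ^+ 2 + -1 * ((f q + - w) * (f q + - w))).
    by apply: C2D => //; [exact: C2_cst|apply: C2M => //; exact: C2_cst].
  by apply: C2_ext c3 => // q _; rewrite expr2; ring.
by apply: C2M => //; apply: H; [exact: C2_x|exact: C2_y].
Qed.

Lemma bump2_ge0 u v r q : 0 <= bump2 u v r q.
Proof. by rewrite mulr_ge0// exprn_ge0// le_max lexx. Qed.

Lemma bump2_gt0 u v r : 0 < r -> 0 < bump2 u v r (pt u v).
Proof.
move=> r0; rewrite /bump2 pt0 pt1 !subrr expr0n/= subr0 (max_idPr _); last by rewrite exprn_ge0// ltW.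
by rewrite mulr_gt0// !exprn_gt0.
Qed.

Lemma bump2_supp u v r q : 0 < r -> bump2 u v r q != 0 -> `|q 0 0 - u| <= r /\ `|q 0 1 - v| <= r.
Proof.
move=> r0; rewrite mulf_eq0 negb_or !expf_eq0/= => /andP[h1 h2].
have H (x : R) : Num.max 0 (r ^+ 2 - x ^+ 2) != 0 -> `|x| <= r.
  rewrite -ler_sqr ?nnegrE ?(ltW r0)// real_normK ?num_real// -subr_ge0.
  by apply: contraNT; rewrite -ltNge => h; rewrite (max_idPl (ltW h)).
by split; exact: H.
Qed.

Definition cbox c q (r : R) : set M :=
  [set p | cdom c p /\ (`|cmap c p 0 0 - q 0 0| <= r /\ `|cmap c p 0 1 - q 0 1| <= r)].

(** The closed square, cut by the half-plane, lies in the chart image; [cbox c q r] is then the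
    image of a compact rectangle. *)
Definition good c q (r : R) := 0 < r /\
  forall q', 0 <= q' 0 1 -> `|q' 0 0 - q 0 0| <= r -> `|q' 0 1 - q 0 1| <= r -> cimg c q'.

Lemma good_ex c q (P : set V) : cimg c q -> nbhs q (fun q' : V => 0 <= q' 0 1 -> P q') ->
  exists2 r, good c q r &
    forall q', 0 <= q' 0 1 -> `|q' 0 0 - q 0 0| <= r -> `|q' 0 1 - q 0 1| <= r -> P q'.
Proof.
move=> cq nP; have [r r0 hr] := (near_ptP _ _).1 (filterI (cimg_full cq) nP).
have r2 : 0 < r / 2 by rewrite divr_gt0.
have rr : r / 2 < r by rewrite ltr_pdivrMr// ltr_pMr// ltr1n.
exists (r / 2).
  by split => // q' h h1 h2; have [k _] := hr q' (le_lt_trans h1 rr) (le_lt_trans h2 rr); exact: k.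
by move=> q' h h1 h2; have [_ k] := hr q' (le_lt_trans h1 rr) (le_lt_trans h2 rr); exact: k.
Qed.

Lemma cbox_nbhs c p r : cdom c p -> 0 < r -> nbhs p (cbox c (cmap c p) r).
Proof.
move=> cp r0; have h : nbhs (cmap c p) (fun q' : V =>
    `|q' 0 0 - cmap c p 0 0| <= r /\ `|q' 0 1 - cmap c p 0 1| <= r).
  by apply/near_ptP; exists r => // q' h1 h2; split; exact: ltW.
exact: map_near cp h.
Qed.

Hypothesis hausM : hausdorff_space M.

(** A compact subset of a Hausdorff space is closed. This is what allows functions supported in
    [cbox] to be extended by 0 beyond the chart domain. *)
Lemma cbox_closed c q r : good c q r -> closed (cbox c q r).
Proof.
move=> [r0 g]; apply: compact_closed => //.
pose B := box (q 0 0 - r) (q 0 0 + r) (Num.max 0 (q 0 1 - r)) (q 0 1 + r).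
have BI : B `<=` cimg c.
  move=> q' [h1 /andP[h2 h3]]; move: h2; rewrite ge_max => /andP[h2 h4].
  by apply: g => //; rewrite ler_distl ?h1// h4.
have -> : cbox c q r = chart_inv c @` B.
  apply/seteqP; split => [p [cp [h1 h2]]|_ [q' Bq' <-]].
    exists (cmap c p); last by rewrite cmapK.
    rewrite !ler_distl in h1 h2; split => //; case/andP: h2 => h2 h3.
    by rewrite h3 andbT ge_max h2 andbT; exact: (cimg_upper (cimgP cp)).
  have cq' := BI _ Bq'; split; first exact: inv_dom.
  rewrite invK//; case: Bq' => h1 /andP[]; rewrite ge_max => /andP[_ h2] h3.
  by rewrite !ler_distl h2.
apply: continuous_compact; last exact: box_compact.
exact: continuous_subspaceW BI (@chart_inv_continuous R M c).
Qed.

Definition bump c q r p : R := if `[<cdom c p>] then bump2 (q 0 0) (q 0 1) r (cmap c p) else 0.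

Lemma bump_supp c q r p : 0 < r -> bump c q r p != 0 -> cbox c q r p.
Proof.
by move=> r0; rewrite /bump; case: asboolP => [cp /(bump2_supp r0)[]|]; [split|rewrite eqxx].
Qed.

Lemma bump_ge0 c q r p : 0 <= bump c q r p.
Proof. by rewrite /bump; case: ifP => // _; exact: bump2_ge0. Qed.

Lemma bump_gt0 c p r : cdom c p -> 0 < r -> 0 < bump c (cmap c p) r p.
Proof.
by move=> cp r0; rewrite /bump; case: asboolP => // _; rewrite -[X in bump2 _ _ _ X]ptE; exact: bump2_gt0.
Qed.

(** In another chart the bump is a composition with the transition map on the overlap, and it is 0
    near every other point because its support is contained in a closed set inside the domain of
    [c]. *)
Lemma bump_C2 c q r : charts A c -> good c q r -> MC2 A (bump c q r).
Proof.
move=> Ac g c' Ac'; have r0 : 0 < r by case: g.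
apply: C2_local => q' cq'.
have [cp|ncp] := pselect (cdom c (chart_inv c' q')).
  have Oq' : ovl c' c q' by apply/ovlP.
  exists (fun q'' : V => 0 <= q'' 0 1 -> ovl c' c q''); split; first exact: ovl_full.
  have sub : cimg c' `&` (fun q'' : V => 0 <= q'' 0 1 -> ovl c' c q'') `<=` ovl c' c.
    by move=> w [/cimg_upper h]; exact.
  have aI : adm (cimg c' `&` (fun q'' : V => 0 <= q'' 0 1 -> ovl c' c q'')).
    rewrite (_ : _ `&` _ = ovl c' c); first exact: ovl_adm.
    apply/seteqP; split; first exact: sub.
    by move=> w Ow; split; [have /ovlP[] := Ow|move=> _].
  apply: (C2_ext aI (f := bump2 (q 0 0) (q 0 1) r \o trans c' c)).
    by move=> w /sub/ovlP[cw cw']; rewrite /loc /bump/=; case: asboolP.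
  apply: (@C2_sub R (ovl c' c)) => //; first exact: ovl_adm.
  apply: (@C2_comp R _ (cimg c)); [exact: ovl_adm|exact: cimg_adm|exact: trans_ovl| | |].
  - exact: (trans_C2 0 Ac' Ac).
  - exact: (trans_C2 1 Ac' Ac).
  - by apply: bump2_C2; exact: cimg_adm.
have ncb : ~ cbox c q r (chart_inv c' q') by case.
have oC : nbhs (chart_inv c' q') (~` cbox c q r).
  by apply: open_nbhs_nbhs; split => //; exact/closed_openC/cbox_closed.
have nB := inv_near cq' oC.
exists (fun q'' : V => 0 <= q'' 0 1 -> (~` cbox c q r) (chart_inv c' q'')); split => //.
have E w : (cimg c' `&` (fun q'' : V => 0 <= q'' 0 1 -> (~` cbox c q r) (chart_inv c' q''))) w ->
    0 = loc c' (bump c q r) w.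
  move=> [/cimg_upper h] /(_ h) h'; apply/eqP; rewrite eq_sym; apply: contraT => /(bump_supp r0).
  by move=> /h'.
move=> {ncp}.
have aI : adm (cimg c' `&` (fun q'' : V => 0 <= q'' 0 1 -> (~` cbox c q r) (chart_inv c' q''))).
  apply: full_adm => [w [/cimg_upper]//|w [cw hw]].
  have h := hw (cimg_upper cw).
  have oC' : nbhs (chart_inv c' w) (~` cbox c q r).
    by apply: open_nbhs_nbhs; split => //; exact/closed_openC/cbox_closed.
  apply: filterS2 (cimg_full cw) (inv_near cw oC') => w' h1 h2 h3; split; first exact: h1.
  by move=> _; exact: h2.
apply: (C2_ext aI E); exact: C2_cst.
Qed.

Hypothesis compM : compact [set: M].

(** Finitely many bumps subordinate to [W], such that one of them is positive at each point, are
    divided by their sum. *)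
Lemma partition_of_unity (W : M -> set M) : (forall p, nbhs p (W p)) ->
  exists n (z : 'I_n -> M) (rho : 'I_n -> M -> R),
    [/\ forall i, MC2 A (rho i), forall i p, rho i p != 0 -> W (z i) p
      & forall p, \sum_i rho i p = 1].
Proof.
move=> nW.
have H p : exists f : M -> R, [/\ MC2 A f, forall p', 0 <= f p', forall p', f p' != 0 -> W p p' & 0 < f p].
  have [c Ac cp] := charts_cover A p.
  have nI : nbhs (cmap c p) (fun q' : V => 0 <= q' 0 1 -> W p (chart_inv c q')).
    by apply: inv_near; [exact: cimgP|rewrite cmapK].
  have [r gr hr] := good_ex (cimgP cp) nI.
  have r0 : 0 < r by case: gr.
  exists (bump c (cmap c p) r); split.
  - exact: bump_C2.
  - exact: bump_ge0.
  - move=> p' /(bump_supp r0)[cp' [h1 h2]].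
    by rewrite -(cmapK cp'); apply: hr => //; exact: (cimg_upper (cimgP cp')).
  - exact: bump_gt0.
have [f hf] := choice H.
(* The filter of the collections that contain all lists extending some finite list. Compactness
   along this filter gives one list [s0] that serves every point. *)
pose fin : set_system (seq M) := [set S : set (seq M) | exists s0 : seq M, forall s : seq M, {subset s0 <= s} -> S s].
have finF : Filter fin.
  split.
  - by exists [::].
  - move=> S1 S2 [s1 h1] [s2 h2]; exists (s1 ++ s2) => s ss; split; [apply: h1|apply: h2];
      by move=> p ps; apply: ss; rewrite mem_cat ps ?orbT.
  - by move=> S1 S2 S12 [s1 h1]; exists s1 => s /h1; exact: S12.
have [|s0 /(_ s0) hs] := (@compact_near_coveringP _ _).1 compM _ fin
    (fun (s : seq M) p => exists2 p', p' \in s & 0 < f p' p) finF.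
  move=> p _; have [cf _ _ fp] := hf p.
  have op : nbhs p [set p' | 0 < f p p'].
    apply: open_nbhs_nbhs; split => //=.
    have cc := MC2_continuous cf.
    rewrite (_ : [set _ | _] = f p @^-1` [set x | 0 < x]); last by [].
    by apply: open_comp; [move=> x' _; exact: cc|exact: open_gt].
  exists ([set p' | 0 < f p p'], [set s : seq M | p \in s]); first split => //=.
    by exists [:: p] => s; apply; rewrite inE.
  by move=> [p' s] /= [h ps]; exists p.
have cov p : exists2 p', p' \in s0 & 0 < f p' p by apply: hs.
pose s := s0; pose n := size s; pose z (i : 'I_n) : M := tnth (in_tuple s) i.
pose F p := \sum_(i < n) f (z i) p.
have F0 p : 0 < F p.
  have [p' Dp' fp'] := cov p.
  have ip' : (index p' s < n)%N by rewrite index_mem.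
  rewrite /F (bigD1 (Ordinal ip'))//= ltr_wpDr//.
    by apply: sumr_ge0 => i _; have [_ + _ _] := hf (z i); exact.
  by rewrite /z (tnth_nth p')/= nth_index.
exists n, z, (fun i p => f (z i) p * (F p)^-1); split.
- move=> i; apply: MC2M; first by have [] := hf (z i).
  by apply: MC2V => //; apply: MC2_sum => j; have [] := hf (z j).
- move=> i p; rewrite mulf_eq0 negb_or => /andP[h _].
  by have [_ _ hh _] := hf (z i); exact: hh.
- by move=> p; rewrite -mulr_suml mulfV// (lt0r_neq0 (F0 p)).
Qed.

End Bumps.

(** * Additivity of iterated integrals *)

Section Tame.
Variable R : realType.
Local Notation V := 'rV[R]_2.
Implicit Types (q : V) (f g : V -> R).

(** Enough for additivity of [dint]. The function vanishes below the boundary line and may jump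
    across it, so continuity is asked within the half-plane. *)
Definition tame f := (exists k : R, forall q, f q != 0 -> box (- k) k 0 k q) /\
  (forall q, upper 0 q -> cont (upper 0) f q).

Lemma tame_box f : tame f -> exists2 k : R, 0 <= k & forall k', k <= k' ->
  (forall q, f q != 0 -> box (- k') k' 0 k' q) /\
  (forall q, box (- k') k' 0 k' q -> cont (box (- k') k' 0 k') f q).
Proof.
move=> [[k hk] cf]; exists (Num.max 0 k); first by rewrite le_max lexx.
move=> k'; rewrite ge_max => /andP[k0 kk]; split.
  move=> q /hk[/andP[h1 h2] /andP[h3 h4]]; split; last by rewrite h3 (le_trans h4).
  by rewrite (le_trans h2)// andbT (le_trans _ h1)// lerN2.
by apply: cont_sub_box cf => q [_ /andP[]].
Qed.

Lemma tameD f g : tame f -> tame g -> tame (fun q => f q + g q) /\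
  dint (fun q => f q + g q) = dint f + dint g.
Proof.
move=> tf tg; have [k1 k10 h1] := tame_box tf; have [k2 k20 h2] := tame_box tg.
pose k := k1 + k2; have k0 : 0 <= k by rewrite addr_ge0.
have [|sf cf] := h1 k; first by rewrite lerDl.
have [|sg cg] := h2 k; first by rewrite lerDr.
have supp q : f q + g q != 0 -> box (- k) k 0 k q.
  have [f0|f0] := eqVneq (f q) 0; first by rewrite f0 add0r => /sg.
  by move=> _; exact: sf.
split.
  split; first by exists k.
  by move=> q Uq; apply: contD; [case: tf => _; exact|case: tg => _; exact].
rewrite (dint_box supp) (dint_box sf) (dint_box sg).
rewrite -(@rintD _ _ _ (fun u => rint 0 k (fun v => f (pt u v))) (fun u => rint 0 k (fun v => g (pt u v)))).
- apply: rint_ext => u uk; rewrite rintD//; [exact: cont_box_slice1 cf uk|exact: cont_box_slice1 cg uk].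
- exact: pint_cont.
- exact: pint_cont.
Qed.

Lemma tame0 : tame (fun=> 0) /\ dint (fun _ : V => 0 : R) = 0.
Proof.
have t0 : tame (fun=> 0).
  by split; [exists 0 => q; rewrite eqxx|move=> q _; exact: cont_cst].
split => //; rewrite (@dint_box R 0 0 0 0 (fun=> 0)); last by move=> q; rewrite eqxx.
exact: rint_point.
Qed.

Lemma dint_sum n (f : 'I_n -> V -> R) : (forall i, tame (f i)) ->
  tame (fun q => \sum_i f i q) /\ dint (fun q => \sum_i f i q) = \sum_i dint (f i).
Proof.
elim: n f => [|n IH] f tf.
  have -> : (fun q => \sum_(i < 0) f i q) = fun=> 0 by apply/funext => q; rewrite big_ord0.
  by rewrite big_ord0; exact: tame0.
have -> : (fun q => \sum_(i < n.+1) f i q) = fun q => f ord0 q + \sum_(i < n) f (lift ord0 i) q.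
  by apply/funext => q; rewrite big_ord_recl.
have [t1 e1] := IH (fun i => f (lift ord0 i)) (fun i => tf _).
have [t2 e2] := tameD (tf ord0) t1.
by split => //; rewrite e2 e1 big_ord_recl.
Qed.

Lemma pd_zero (A : set V) f q i : adm A -> A q -> (\forall q' \near q, A q' -> f q' = 0) -> pd i f q = 0.
Proof.
move=> aA Aq h.
have w : wd A f q 0 0.
  by apply: wd_near_ext (wd_cst A 0 q) => //; apply: filterS h => q' h /h.
have [h0 h1] := wd_partial aA Aq w.
by move: i; apply: ord2P.
Qed.

End Tame.

(** * Integrals of 2-forms in two charts *)

Section Forms.
Variables (R : realType) (M : topologicalType) (A : oriented_atlas R M).
Hypothesis hausM : hausdorff_space M.
Local Notation V := 'rV[R]_2.
Implicit Types (c : chart R M) (p : M) (q : V) (f th : M -> R).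

Definition ext c (F : V -> R) q : R := if `[<cimg c q>] then F q else 0.

Lemma ext_in c F q : cimg c q -> ext c F q = F q.
Proof. by rewrite /ext; case: asboolP. Qed.

Lemma ext_neq0 c F q : ext c F q != 0 -> cimg c q /\ F q != 0.
Proof. by rewrite /ext; case: asboolP => // _; rewrite eqxx. Qed.

Definition cell q (r : R) : set V := [set q' | `|q' 0 0 - q 0 0| <= r /\ `|q' 0 1 - q 0 1| <= r].

Lemma cell_out q r q' : ~ cell q r q' -> \forall w \near q', ~ cell q r w.
Proof.
have lem (s t : R) : r < `|s - t| -> exists2 e : R, 0 < e & forall w, `|w - s| < e -> r < `|w - t|.
  move=> h; exists (`|s - t| - r); first by rewrite subr_gt0.
  move=> w hw; have := ler_distD w s t; rewrite [`|s - w|]distrC.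
  by move: hw; lra.
move=> h; have [h0|h0] := leP `|q' 0 0 - q 0 0| r; last first.
  have [e e0 he] := lem _ _ h0; apply/near_ptP; exists e => // w /he h1 _ [h2 _].
  by move: h1; rewrite ltNge h2.
have [h1|h1] := leP `|q' 0 1 - q 0 1| r; first by case: h.
have [e e0 he] := lem _ _ h1; apply/near_ptP; exists e => // w _ /he h2 [_ h3].
by move: h2; rewrite ltNge h3.
Qed.

(** Near each point of the half-plane the extension by 0 either is [F] on the chart image or
    vanishes: [K] has open complement, contains the support of [F], and meets the half-plane inside
    the image. *)
Lemma ext_local (K : set V) c F q : (forall q', ~ K q' -> \forall w \near q', ~ K w) ->
  (forall q', 0 <= q' 0 1 -> K q' -> cimg c q') ->
  (forall q', cimg c q' -> F q' != 0 -> K q') -> upper 0 q ->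
  (cimg c q /\ \forall q' \near q, upper 0 q' -> cimg c q' /\ ext c F q' = F q') \/
  (\forall q' \near q, upper 0 q' -> ext c F q' = 0).
Proof.
move=> oK Kc FK Uq; have [cq|ncq] := pselect (cimg c q).
  left; split => //; apply: filterS (cimg_full cq) => q' h Uq'.
  by have cq' := h Uq'; rewrite ext_in.
right; have nK : ~ K q by move/(Kc _ Uq).
apply: filterS (oK _ nK) => q' nq' _.
by apply/eqP; apply: contraT => /ext_neq0[cq' /(FK _ cq')].
Qed.

Lemma ext_C1 (K : set V) c F : (forall q', ~ K q' -> \forall w \near q', ~ K w) ->
  (forall q', 0 <= q' 0 1 -> K q' -> cimg c q') ->
  (forall q', cimg c q' -> F q' != 0 -> K q') -> C1 (cimg c) F -> C1 (upper 0) (ext c F).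
Proof.
move=> oK Kc FK cF; apply: C1_local => q Uq.
have [[cq h]|h] := ext_local oK Kc FK Uq.
  exists (fun q' : V => 0 <= q' 0 1 -> cimg c q'); split; first exact: cimg_full.
  have E : upper 0 `&` (fun q' : V => 0 <= q' 0 1 -> cimg c q') = cimg c.
    by apply/seteqP; split => [w [h1]|w cw]; [exact|split => //; exact: (cimg_upper cw)].
  rewrite E; apply: C1_ext cF; first exact: cimg_adm.
  by move=> w cw; rewrite ext_in.
have [B [oB qB hB]] : exists B : set V, [/\ open B, B q & forall w, upper 0 w -> B w -> ext c F w = 0].
  exists (interior [set w | upper 0 w -> ext c F w = 0]); split; [exact: open_interior|exact: h|].
  by move=> w Uw Bw; exact: (interior_subset Bw).
exists B; split; first exact: open_nbhs_nbhs.
have aB : adm (upper 0 `&` B) by apply: admI; [exact: adm_upper|exact: adm_open].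
have [cz _ _] := C1_cst (0 : R) aB; apply: C1_ext cz => // w [Uw Bw].
by rewrite hB.
Qed.

Lemma ext_cont (K : set V) c F : (forall q', ~ K q' -> \forall w \near q', ~ K w) ->
  (forall q', 0 <= q' 0 1 -> K q' -> cimg c q') ->
  (forall q', cimg c q' -> F q' != 0 -> K q') -> (forall q, cimg c q -> cont (cimg c) F q) ->
  forall q, upper 0 q -> cont (upper 0) (ext c F) q.
Proof.
move=> oK Kc FK cF q Uq.
have [[cq h]|h] := ext_local oK Kc FK Uq.
  apply: (@cont_local _ _ _ (fun q' : V => 0 <= q' 0 1 -> cimg c q')); first exact: cimg_full.
  have E : upper 0 `&` (fun q' : V => 0 <= q' 0 1 -> cimg c q') = cimg c.
    by apply/seteqP; split => [w [h1]|w cw]; [exact|split => //; exact: (cimg_upper cw)].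
  by rewrite E; apply: cont_ext (cF _ cq) => // w cw; rewrite ext_in.
have X : cont (upper 0) (fun _ : V => 0 : R) q by exact: cont_cst.
have h' : \forall q' \near q, upper 0 q' -> 0 = ext c F q' by apply: filterS h => w h /h ->.
exact: (cont_near_ext Uq h' X).
Qed.

Variables P Q : chart R M -> V -> R.
Hypothesis P_C1 : forall c, charts A c -> C1 (cimg c) (P c).
Hypothesis Q_C1 : forall c, charts A c -> C1 (cimg c) (Q c).
Hypothesis closedPQ : forall c q, charts A c -> cimg c q -> pd 0 (Q c) q = pd 1 (P c) q.
Hypothesis P_trans : forall c c' q, charts A c -> charts A c' -> ovl c c' q ->
  P c q = P c' (trans c c' q) * pd 0 (fun q => trans c c' q 0 0) q
        + Q c' (trans c c' q) * pd 0 (fun q => trans c c' q 0 1) q.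
Hypothesis Q_trans : forall c c' q, charts A c -> charts A c' -> ovl c c' q ->
  Q c q = P c' (trans c c' q) * pd 1 (fun q => trans c c' q 0 0) q
        + Q c' (trans c c' q) * pd 1 (fun q => trans c c' q 0 1) q.

(* Coefficient of the 2-form [df /\ (P du + Q dv)] in the chart [c]. *)
Definition wform c f q : R := pd 0 (loc c f) q * Q c q - pd 1 (loc c f) q * P c q.

Lemma wform_C1 c f : charts A c -> MC2 A f -> C1 (cimg c) (wform c f).
Proof.
move=> Ac cf; have a := @cimg_adm R M c; have [_ c0 c1] := cf c Ac.
have [h0 _ _] := C1M a c0 (Q_C1 Ac); have [h1 _ _] := C1M a c1 (P_C1 Ac).
by have [] := C1B a h0 h1.
Qed.

(** The chain rule for [f] and the transformation rules of [P] and [Q]: a product of two pulled-back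
    1-forms acquires the Jacobian determinant. *)
Lemma wform_trans c c' f q : charts A c -> charts A c' -> MC2 A f -> ovl c c' q ->
  wform c f q = wform c' f (trans c c' q) * jacdet (trans c c') q.
Proof.
move=> Ac Ac' cf Oq; have a := @ovl_adm R M c c'; have a' := @cimg_adm R M c'.
have [cf' _ _] := cf c' Ac'.
have [t1 _ _] := trans_C2 0 Ac Ac'; have [t2 _ _] := trans_C2 1 Ac Ac'.
have [k k0 k1] := C1_comp a a' (@trans_ovl R M c c') t1 t2 cf'.
have E w : ovl c c' w -> (loc c' f \o trans c c') w = loc c f w.
  by move=> Ow; rewrite /loc /= trans_inv.
have [_ e0 e1] := C1_extE a k E.
rewrite /wform e0// e1// k0// k1// (P_trans Ac Ac' Oq) (Q_trans Ac Ac' Oq) /jacdet.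
ring.
Qed.

(** The differentials of a partition of unity add up to [d 1 = 0]. *)
Lemma wform_sum n (f : 'I_n -> M -> R) c q : charts A c -> (forall i, MC2 A (f i)) ->
  (forall p, \sum_i f i p = 1) -> cimg c q -> \sum_i wform c (f i) q = 0.
Proof.
move=> Ac cf f1 cq; have a := @cimg_adm R M c.
have H m (g : 'I_m -> M -> R) : (forall i, MC2 A (g i)) ->
    [/\ pd 0 (loc c (fun p => \sum_i g i p)) q = \sum_i pd 0 (loc c (g i)) q
      & pd 1 (loc c (fun p => \sum_i g i p)) q = \sum_i pd 1 (loc c (g i)) q].
  elim: m g => [|m IH] g cg.
    have -> : (fun p => \sum_(i < 0) g i p) = fun=> 0 by apply/funext => p; rewrite big_ord0.
    by have [_ z0 z1] := C1_cst (0 : R) a; rewrite !big_ord0 /loc/= -[(_ \o _)]/(fun=> 0) z0// z1.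
  have -> : (fun p => \sum_(i < m.+1) g i p) = fun p => g ord0 p + \sum_(i < m) g (lift ord0 i) p.
    by apply/funext => p; rewrite big_ord_recl.
  have [k0 k1] := IH (fun i => g (lift ord0 i)) (fun i => cg _).
  have [c0 _ _] := cg ord0 c Ac.
  have [c1 _ _] := MC2_sum (fun i => cg (lift ord0 i)) Ac.
  have [_ d0 d1] := C1D a c0 c1.
  have -> : loc c (fun p => g ord0 p + \sum_(i < m) g (lift ord0 i) p) =
     fun q => loc c (g ord0) q + loc c (fun p => \sum_(i < m) g (lift ord0 i) p) q by [].
  by rewrite d0// d1// k0 k1 !big_ord_recl.
have [h0 h1] := H n f cf.
rewrite /wform sumrB -!mulr_suml -h0 -h1.
have -> : (fun p => \sum_i f i p) = fun=> 1 by apply/funext.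
by have [_ z0 z1] := C1_cst (1 : R) a; rewrite /loc/= -[(_ \o _)]/(fun=> 1) z0// z1// !mul0r subrr.
Qed.

(** Near [p] the transition map satisfies the local change of variables, at a boundary point because
    it preserves the boundary line. The factor [th] supplies the small support, so [f] is
    arbitrary. *)
Lemma compare c c' p : charts A c -> charts A c' -> cdom c p -> cdom c' p ->
  exists W : set M, nbhs p W /\ forall th f, MC2 A th -> MC2 A f ->
    (forall p', th p' != 0 -> W p') ->
    dint (ext c (fun q => loc c th q * wform c f q))
    = dint (ext c' (fun q => loc c' th q * wform c' f q)).
Proof.
move=> Ac Ac' cp c'p.
have Oq : ovl c c' (cmap c p) by exact: ovl_cmap.
have aO := @ovl_adm R M c c'.
have TU q : ovl c c' q -> upper 0 (trans c c' q) by move=> /trans_ovl; exact: cimg_upper.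
have bd q : ovl c c' q -> q 0 1 = 0 <-> trans c c' q 0 1 = 0.
  move=> [p' [cp' c'p'] <-]; rewrite trans_cmap//.
  by split; [exact: (boundary_chart Ac Ac' cp' c'p')|exact: (boundary_chart Ac' Ac c'p' cp')].
have cv : cv_at (ovl c c') (trans c c') (cmap c p).
  have [q0|q0] := eqVneq (cmap c p 0 1) 0.
    apply: (cv_at_boundary aO (@ovl_upper R M c c') Oq TU (ovl_full Oq)) => //.
    - exact: (trans_C2 0 Ac Ac').
    - exact: (trans_C2 1 Ac Ac').
    - exact: (trans_jac Ac Ac' Oq).
    - by move=> q' /bd[].
  apply: (cv_at_interior aO (@ovl_upper R M c c') Oq (ovl_full Oq)) => //.
  - exact: (trans_C2 0 Ac Ac').
  - exact: (trans_C2 1 Ac Ac').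
  - exact: (trans_jac Ac Ac' Oq).
  - by rewrite lt_neqAle eq_sym q0; exact: (ovl_upper Oq).
  - rewrite lt_neqAle eq_sym; apply/andP; split; last exact: (TU _ Oq).
    by apply: contra_neq q0 => /(bd _ Oq).
have [a [b [d [d' [e [e0 Bo nB H]]]]]] := cv.
rewrite trans_cmap// in H.
(* The smaller square lies in the image of [c'] and in the [e]-square: the integrand extended by 0
   is then C^1 on the half-plane, with the support required by the change of variables. *)
have [r [r0 gr] hr] := @good_ex R M c' (cmap c' p) (cell (cmap c' p) e) (cimgP c'p)
  (ltac:(by apply/near_ptP; exists e => // w /ltW h1 /ltW h2 _; split)).
have re q' : 0 <= q' 0 1 -> cell (cmap c' p) r q' -> cell (cmap c' p) e q'.
  by move=> h [h1 h2]; exact: hr.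
exists [set p' | [/\ cdom c p', cdom c' p', box a b d d' (cmap c p') & cell (cmap c' p) r (cmap c' p')]].
split.
  have n1 := map_near cp nB.
  have n2 : nbhs p (cbox c' (cmap c' p) r) by exact: cbox_nbhs.
  apply: filterS2 n1 n2 => p' [cp' h] [c'p' h']; split => //.
  by apply: h; exact: (cimg_upper (cimgP cp')).
move=> th f cth cf sth.
have cF : C1 (cimg c') (fun q => loc c' th q * wform c' f q).
  by have [t _ _] := cth c' Ac'; have [] := C1M (@cimg_adm R M c') t (wform_C1 Ac' cf).
have FK q' : cimg c' q' -> loc c' th q' * wform c' f q' != 0 -> cell (cmap c' p) r q'.
  move=> cq'; rewrite mulf_eq0 negb_or => /andP[/sth[_ _ _ h] _].
  by move: h; rewrite invK.
apply: H.
- apply: (@ext_C1 (cell (cmap c' p) r)) => //; first exact: cell_out.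
  by move=> q' h [h1 h2]; exact: gr.
- move=> q' /ext_neq0[cq' /(FK _ cq') h].
  have U := cimg_upper cq'; have [h1 h2] := re _ U h; split => //.
- move=> q' /Bo Oq'; have /ovlP[cq' _] := Oq'.
  rewrite !ext_in//; last exact: trans_ovl.
  rewrite (wform_trans Ac Ac' cf Oq') mulrA; congr (_ * _ * _).
  by rewrite /loc/= trans_inv.
- move=> q' /ext_neq0[cq']; rewrite mulf_eq0 negb_or => /andP[/sth[_ _ h _] _].
  by move: h; rewrite invK.
Qed.

End Forms.

(** * Integrals over a period *)

Section PeriodicIntegral.
Variable R : realType.
Implicit Types (f : R -> R).

(** The integral over [[s, s + l]] has derivative [f (s + l) - f s = 0] in [s]. It is written with a
    primitive based at a point [B] below both 0 and [t]. *)
Lemma rint_periodic f (t l : R) : 0 < l -> continuous f -> (forall s, f (s + l) = f s) ->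
  rint 0 l f = rint t (t + l) f.
Proof.
move=> l0 cf fl.
pose B := Num.min 0 t - 1.
have B0 : B < 0 by rewrite /B ltrBlDr (le_lt_trans (y := 0)) ?add0r// ge_min lexx.
have Bt : B < t by rewrite /B ltrBlDr (le_lt_trans (y := t)) ?ltrDl// ge_min lexx orbT.
have cc a b : cont_on a b f by exact: continuous_cont_on.
pose Phi s := rint B s f.
have dPhi s : B < s -> is_derive s 1 Phi (f s).
  by move=> Bs; apply: (@rint_FTC1 _ B (s + 1)) => //; rewrite Bs ltrDl ltr01.
have dD s : B < s -> is_derive s 1 (fun s => Phi (s + l) - Phi s) (0 : R).
  move=> Bs; have h1 : is_derive (s + l) 1 Phi (f (s + l)) by apply: dPhi; rewrite ltr_wpDr// ltW.
  have h2 : is_derive s 1 (fun s => s + l) 1.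
    have := @is_deriveD _ _ _ id (cst l) s 1 1 0 (is_derive_id _ _) (is_derive_cst _ _ _).
    by rewrite addr0.
  have h3 := @is_derive1_comp R Phi (fun s => s + l) s _ _ h1 h2.
  rewrite mulr1 fl in h3.
  have := is_deriveB h3 (dPhi s Bs); rewrite subrr; exact.
(* The mean value inequality with bound 0 gives constancy. *)
have K : `|(Phi (t + l) - Phi t) - (Phi (0 + l) - Phi 0) - 0 * (t - 0)| <= 0 * `|t - 0|.
  apply: (@mvt_bound R (fun s => Phi (s + l) - Phi s) (fun=> 0)).
    move=> w /andP[h _]; apply: dD; apply: lt_le_trans h.
    by rewrite lt_min B0 Bt.
  by move=> w _; rewrite subrr normr0.
move: K; rewrite !mul0r subr0 normr_le0 subr_eq0 add0r => /eqP K.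
have E u : B < u -> Phi (u + l) - Phi u = rint u (u + l) f.
  move=> Bu; rewrite /Phi (@rint_cat _ B (u + l) u)//; [by rewrite [LHS]addrAC subrr add0r|exact: ltW|by rewrite lerDl ltW].
by rewrite -E// K -[l in LHS]add0r -E// add0r.
Qed.

End PeriodicIntegral.

(** * Boundary curves, and Stokes' formula for small supports *)

Section Boundary.
Variables (R : realType) (M : topologicalType) (A : oriented_atlas R M).
Hypothesis hausM : hausdorff_space M.
Local Notation V := 'rV[R]_2.
Variables (x : M -> 'rV[R]_3) (g : arclength_boundary A x).
Implicit Types (c : chart R M) (p : M) (i : 'I_(ncomp g)) (s t : R).

Lemma curve_bd i s : surface_boundary A (curve i s).
Proof. by apply/(curve_cover g); exists i, s. Qed.

Lemma curve_chart c i s : charts A c -> cdom c (curve i s) -> cmap c (curve i s) 0 1 = 0.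
Proof.
move=> Ac cs; have [c' [Ac' c's b']] := curve_bd i s.
exact: (boundary_chart Ac' Ac c's cs).
Qed.

Lemma curve_periodn i s n : curve i (s + n%:R * clen i) = curve i s.
Proof.
elim: n => [|n IH]; first by rewrite mul0r addr0.
by rewrite -natr1 mulrDl mul1r addrA curve_periodic.
Qed.

Lemma curve_periodz i s (n : int) : curve i (s + n%:~R * clen i) = curve i s.
Proof.
case: n => n; first exact: curve_periodn.
rewrite NegzE mulrNz mulNr -[in RHS](subrK (n.+1%:R * clen i) s).
by rewrite curve_periodn.
Qed.

Lemma curve_reduce i s : exists (s' : R) (n : int),
  [/\ 0 <= s' < clen i, s = s' + n%:~R * clen i & curve i s = curve i s'].
Proof.
have l0 := clen_gt0 i.
pose n := Num.floor (s / clen i); exists (s - n%:~R * clen i), n.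
have E : s = s - n%:~R * clen i + n%:~R * clen i by rewrite subrK.
split => //; last by rewrite {1}E curve_periodz.
have /andP[h1 h2] := real_floor_itv (num_real (s / clen i)).
rewrite subr_ge0 -ler_pdivlMr// h1/= ltrBlDr -[X in X + _]mul1r -mulrDl -ltr_pdivrMr//.
by move: h2; rewrite intrD addrC.
Qed.

(** Reduced to one period, the parameters coincide by injectivity, so [s - t] is an integer multiple
    of the period. *)
Lemma curve_eq i j s t : curve i s = curve j t ->
  i = j /\ (0 < s - t < clen i -> False).
Proof.
have [s' [n [hs Es es]]] := curve_reduce i s; have [t' [m [ht Et et]]] := curve_reduce j t.
rewrite es et => /curve_inj[]// ij st; split => //; subst j.
rewrite Es Et st opprD addrACA subrr add0r -mulrBl -mulrzBr.
have l0 := clen_gt0 i.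
rewrite pmulr_lgt0// gtr_pMl// ltr0z ltrz1.
by case: (n - m)%R => -[|[|k]].
Qed.

Definition dc c i s : V := 'D_1 (cmap c \o curve i : R^o -> V) s.

Lemma gamma_derive c i s j : charts A c -> cdom c (curve i s) ->
  is_derive s 1 (fun s => cmap c (curve i s) 0 j) (dc c i s 0 j).
Proof.
move=> Ac cs; have := @curve_smooth _ _ _ _ g i c Ac [::] s cs.
rewrite /= => d; have dv : derivable (cmap c \o curve i : R^o -> V) s 1 by exact: diff_derivable.
split; first by move/derivable_mxP : dv => /(_ 0 j).
by rewrite /dc derive_mx// mxE.
Qed.

Lemma curve_near c i s : cdom c (curve i s) -> \forall t \near s, cdom c (curve i t).
Proof. by move=> cs; exact: (@curve_continuous _ _ _ _ g i s _ (dom_near cs)). Qed.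

Lemma dc_cont c i s j : charts A c -> cdom c (curve i s) -> {for s, continuous (fun t => dc c i t 0 j)}.
Proof.
move=> Ac cs; have := @curve_smooth _ _ _ _ g i c Ac [:: (1 : R^o)] s cs => /= d.
have h : {for s, continuous (fun t => dc c i t)} by exact: differentiable_continuous d.
exact: (cvg_comp _ _ h (@coord_continuous _ _ _ 0 j (dc c i s))).
Qed.

Lemma gamma_pt c i s : charts A c -> cdom c (curve i s) ->
  cmap c (curve i s) = pt (cmap c (curve i s) 0 0) 0.
Proof. by move=> Ac cs; rewrite -[LHS]ptE curve_chart. Qed.

Lemma loc_curve_cont c i s (F : V -> R) : charts A c -> cdom c (curve i s) ->
  cont (cimg c) F (cmap c (curve i s)) -> {for s, continuous (fun t => F (cmap c (curve i t)))}.
Proof.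
move=> Ac cs cF U /cF h.
have {}h : nbhs (cmap c (curve i s)) (fun q => cimg c q -> U (F q)) by exact: h.
have n := @curve_continuous _ _ _ _ g i s _ (map_near cs h).
have {}n : nbhs s (fun t => cdom c (curve i t) /\ (cimg c (cmap c (curve i t)) -> U (F (cmap c (curve i t))))) by exact: n.
suff : nbhs s (fun t => U (F (cmap c (curve i t)))) by [].
by apply: filterS n => t [ct]; apply; exact: cimgP.
Qed.

Variables P Q : chart R M -> V -> R.
Hypothesis P_C1 : forall c, charts A c -> C1 (cimg c) (P c).
Hypothesis Q_C1 : forall c, charts A c -> C1 (cimg c) (Q c).
Hypothesis closedPQ : forall c q, charts A c -> cimg c q -> pd 0 (Q c) q = pd 1 (P c) q.
Variable e : 'I_(ncomp g) -> R -> R.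
Hypothesis eE : forall c i s, charts A c -> cdom c (curve i s) ->
  e i s = P c (cmap c (curve i s)) * dc c i s 0 0.
Hypothesis dc_gt0 : forall c i s, charts A c -> cdom c (curve i s) -> 0 < dc c i s 0 0.
Hypothesis e_periodic : forall i s, e i (s + clen i) = e i s.

(** Continuity is local, and in a chart [e] is a continuous coefficient times a velocity coordinate.
    With other coefficients [P] the same argument serves for the velocity in space. *)
Lemma e_cont i : continuous (e i).
Proof.
move=> s; have [c Ac cs] := charts_cover A (curve i s).
have h : {for s, continuous (fun t => P c (cmap c (curve i t)) * dc c i t 0 0)}.
  apply: cvgM; last exact: dc_cont.
  by apply: loc_curve_cont => //; apply: C1_cont => //; [exact: P_C1|exact: cimgP].
rewrite /continuous_at (eE Ac cs); apply: cvg_trans h; apply: near_eq_cvg.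
by apply: filterS (curve_near cs) => t ct; rewrite (eE Ac ct).
Qed.

Lemma th_cont i th : MC2 A th -> continuous (fun s => th (curve i s)).
Proof.
by move=> cth s U /(MC2_continuous cth (x := curve i s)) h; exact: (@curve_continuous _ _ _ _ g i s _ h).
Qed.

Lemma image_closed i (a b : R) : closed (curve i @` `[a, b]).
Proof.
apply: compact_closed => //; apply: continuous_compact; last exact: segment_compact.
by apply: continuous_subspaceT; exact: curve_continuous.
Qed.

(** The other components and the complementary arc of a period are compact, hence closed, and by
    injectivity they avoid the point; so near it only the arc of parameters within [dl] of [s0]
    occurs. *)
Lemma isolate i0 (s0 dl : R) : 0 < dl -> 2 * dl < clen i0 ->
  nbhs (curve i0 s0) [set p | (forall i s, i != i0 -> curve i s <> p) /\
     (forall s, s0 + dl <= s <= s0 + clen i0 - dl -> curve i0 s <> p)].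
Proof.
move=> d0 dl0.
have n1 : nbhs (curve i0 s0) [set p | forall i, i != i0 -> ~ (curve i @` `[0, clen i]%classic) p].
  apply: filter_forall => i; have [->|ii] := eqVneq i i0.
    by apply: filterE => p; rewrite /= ?eqxx.
  have : nbhs (curve i0 s0) (~` (curve i @` `[0, clen i]%classic)).
    apply: open_nbhs_nbhs; split; first by apply: closed_openC; exact: image_closed.
    by move=> [s _ /curve_eq[/eqP]]; rewrite (negPf ii).
  by apply: filterS => p h _.
have n2 : nbhs (curve i0 s0) (~` (curve i0 @` `[s0 + dl, s0 + clen i0 - dl]%classic)).
  apply: open_nbhs_nbhs; split; first by apply: closed_openC; exact: image_closed.
  move=> [s /=]; rewrite in_itv/= => /andP[h1 h2] /curve_eq[_]; apply.
  by apply/andP; split; move: h1 h2; lra.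
apply: filterS2 n1 n2 => p h1 h2; split.
  move=> i s ii sp; apply: (h1 i ii); have [s' [n [hs _ es]]] := curve_reduce i s.
  by exists s'; [rewrite /= in_itv/=; case/andP: hs => -> /ltW ->|rewrite -es].
by move=> s hs sp; apply: h2; exists s => //; rewrite /= in_itv.
Qed.

(** The boundary integral of [th (P du + Q dv)]: along the boundary [dv = 0], and [e] is the
    remaining coefficient. *)
Definition bint th : R := \sum_i rint 0 (clen i) (fun s => th (curve i s) * e i s).

Lemma cell_pd_zero c q r (f : V -> R) j q' : cimg c q' -> ~ cell q r q' ->
  (forall w, cimg c w -> f w != 0 -> cell q r w) -> pd j f q' = 0.
Proof.
move=> cq nc fc; apply: (pd_zero _ (@cimg_adm R M c) cq).
apply: filterS (cell_out nc) => w nw cw; apply/eqP; apply: contraT => h.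
by case: (nw (fc _ cw h)).
Qed.

Lemma cell_wform c q r th q' : (forall w, cimg c w -> loc c th w != 0 -> cell q r w) ->
  cimg c q' -> wform P Q c th q' != 0 -> cell q r q'.
Proof.
move=> hth cq; have [//|nc] := pselect (cell q r q').
by rewrite /wform !(cell_pd_zero _ cq nc hth) !mul0r subrr eqxx.
Qed.

(** As the form is closed, [d th /\ (P du + Q dv)] is the differential of [th (P du + Q dv)].
    Green's formula on a square wider than the support leaves only the bottom edge, when it lies on
    the boundary line, with the orientation of increasing [u]. *)
Lemma green_local c q (r r0 : R) th : charts A c -> MC2 A th -> 0 < r -> r < r0 -> good c q r0 -> 0 <= q 0 1 ->
  (q 0 1 = 0 \/ r0 <= q 0 1) -> (forall w, cimg c w -> loc c th w != 0 -> cell q r w) ->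
  dint (ext c (wform P Q c th)) =
    if q 0 1 == 0 then rint (q 0 0 - r0) (q 0 0 + r0) (fun u => loc c th (pt u 0) * P c (pt u 0)) else 0.
Proof.
move=> Ac cth rp rr [r0p gd] qU hq hth; have aC := @cimg_adm R M c.
have [cth' _ _] := cth c Ac.
set u := q 0 0; set v := q 0 1 in qU hq *.
(* A square centred on the boundary line is cut along it; any other one stays in the half-plane by
   [hq]. *)
pose c0 := if v == 0 then 0 else v - r0.
have c0E : (v = 0 /\ c0 = 0) \/ [/\ v != 0, c0 = v - r0 & r0 <= v].
  rewrite /c0; case: eqP => [|/eqP v0]; first by left.
  by right; split => //; case: hq => // h; rewrite h eqxx in v0.
have c00 : 0 <= c0 by case: c0E => [[_ ->]|[_ -> h]]; rewrite // subr_ge0.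
have c0v : v - r0 <= c0.
  case: c0E => [[v0 ->]|[_ -> h]]; last by [].
  by rewrite v0 sub0r oppr_le0 ltW.
have c0d : c0 <= v + r0.
  case: c0E => [[v0 ->]|[_ -> h]]; first by rewrite v0 add0r ltW.
  by rewrite lerD2l ge0_cp// ltW.
have Bcell w : box (u - r0) (u + r0) c0 (v + r0) w -> cimg c w.
  move=> [h1 /andP[h2 h3]]; apply: gd; first exact: le_trans h2.
    by rewrite ler_distl.
  by rewrite ler_distl h3 (le_trans c0v h2).
have supp w : ext c (wform P Q c th) w != 0 -> box (u - r0) (u + r0) c0 (v + r0) w.
  move=> /ext_neq0[cw /(cell_wform hth cw)[h1 h2]].
  have h1' := le_trans h1 (ltW rr); have h2' := le_trans h2 (ltW rr).
  rewrite !ler_distl in h1' h2'; split => //; case/andP: h2' => h3 h4; rewrite h4 andbT.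
  by case: c0E => [[_ ->]|[_ -> _]] //; exact: (cimg_upper cw).
rewrite (dint_box supp).
have [tP tP0 tP1] := C1M aC cth' (P_C1 Ac); have [tQ tQ0 tQ1] := C1M aC cth' (Q_C1 Ac).
have -> : rint2 (u - r0) (u + r0) c0 (v + r0) (ext c (wform P Q c th)) =
  rint2 (u - r0) (u + r0) c0 (v + r0) (fun w => pd 0 (fun w => loc c th w * Q c w) w
     - pd 1 (fun w => loc c th w * P c w) w).
  apply: rint_ext => y yy; apply: rint_ext => z zz.
  have cw : cimg c (pt y z) by apply: Bcell; exact/box_pt.
  by rewrite ext_in// tQ0// tP1// closedPQ// /wform; ring.
rewrite (green aC Bcell)//; last by rewrite lerD2l ge0_cp// ltW.
have z0 w : cimg c w -> ~ cell q r w -> loc c th w = 0.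
  by move=> cw nc; apply/eqP; apply: contraT => /(hth _ cw).
have e1 (y z : R) : cimg c (pt y z) -> r < `|y - u| \/ r < `|z - v| -> loc c th (pt y z) = 0.
  by move=> cw h; apply: z0 => //; rewrite /cell/= pt0 pt1 => -[h1 h2]; case: h; rewrite ltNge ?h1 ?h2.
have nr : r < `|u + r0 - u| by rewrite addrAC subrr add0r gtr0_norm.
have nr' : r < `|u - r0 - u| by rewrite addrAC subrr add0r normrN gtr0_norm.
have nv : r < `|v + r0 - v| by rewrite addrAC subrr add0r gtr0_norm.
have nv' : r < `|v - r0 - v| by rewrite addrAC subrr add0r normrN gtr0_norm.
have uu : u - r0 <= u + r0 by rewrite lerD2l ge0_cp// ltW.
rewrite [rint c0 _ _]rint0; last first.
  move=> z zz; rewrite e1 ?mul0r//; [|by left].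
  by apply: Bcell; apply/box_pt; rewrite lexx andbT uu.
rewrite [rint c0 _ _]rint0; last first.
  move=> z zz; rewrite e1 ?mul0r//; [|by left].
  by apply: Bcell; apply/box_pt; rewrite lexx uu.
rewrite [X in _ - (X - _)]rint0; last first.
  move=> y yy; rewrite e1 ?mul0r//; [|by right].
  by apply: Bcell; apply/box_pt; rewrite lexx c0d.
rewrite subr0 !sub0r opprK; case: c0E => [[v0 cE]|[v0 cE vr]].
  by rewrite v0 eqxx cE.
rewrite (negPf v0).
apply: rint0 => y yy; rewrite e1 ?mul0r//; [|by right; rewrite cE].
by apply: Bcell; apply/box_pt; rewrite lexx c0d.
Qed.

Lemma good_le c q (r r' : R) : 0 < r' -> r' <= r -> good c q r -> good c q r'.
Proof.
move=> r0 rr [_ h]; split => // w h0 h1 h2.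
by apply: h => //; [exact: le_trans rr|exact: le_trans rr].
Qed.

Lemma cbox_cell c q r th : (forall p, th p != 0 -> cbox c q r p) ->
  forall w, cimg c w -> loc c th w != 0 -> cell q r w.
Proof. by move=> h w cw /h[_]; rewrite invK. Qed.

(** In a cell off the boundary line both sides vanish. *)
Lemma local_stokes_interior c p : charts A c -> cdom c p -> cmap c p 0 1 != 0 ->
  exists r, good c (cmap c p) r /\ forall th, MC2 A th ->
    (forall p', th p' != 0 -> cbox c (cmap c p) r p') -> bint th = dint (ext c (wform P Q c th)).
Proof.
move=> Ac cp v0; set q := cmap c p.
have qU : 0 <= q 0 1 by exact: (cimg_upper (cimgP cp)).
have qp : 0 < q 0 1 by rewrite lt_neqAle eq_sym v0.
have nP : nbhs q (fun w : V => 0 <= w 0 1 -> 0 < w 0 1).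
  by apply/near_ptP; exists (q 0 1) => // w _; rewrite ltr_distl subrr => /andP[].
have [r0 g0 hr] := good_ex (cimgP cp) nP.
have r0p : 0 < r0 by case: g0.
(* Otherwise the square would contain a point of the boundary line, where [hr] claims a positive
   height. *)
have rv : r0 <= q 0 1.
  rewrite leNgt; apply/negP => h; have := hr (pt (q 0 0) 0).
  rewrite pt0 pt1 lexx subrr normr0 sub0r normrN (ger0_norm qU) ltxx (ltW r0p) (ltW h).
  by move=> /(_ isT isT isT).
have r2 : 0 < r0 / 2 by rewrite divr_gt0.
have rr : r0 / 2 < r0 by rewrite ltr_pdivrMr// ltr_pMr// ltr1n.
exists (r0 / 2); split; first exact: good_le (ltW rr) g0.
move=> th cth sth.
rewrite (green_local Ac cth r2 rr g0 qU (or_intror rv) (cbox_cell sth)) (negPf v0).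
rewrite /bint big1// => i _; apply: rint0 => s _.
apply/eqP; rewrite mulf_eq0; apply/orP; left; apply: contraT => /sth[cs [_]].
rewrite curve_chart// sub0r normrN (ger0_norm qU) => h.
by have := le_trans rv h; rewrite leNgt rr.
Qed.

(** Along a short arc the first chart coordinate increases with the parameter, and it serves as
    substitution between the arc and the bottom edge of the square; the rest of the boundary is kept
    away from the support. *)
Lemma local_stokes_boundary c p : charts A c -> cdom c p -> cmap c p 0 1 = 0 ->
  exists r, good c (cmap c p) r /\ forall th, MC2 A th ->
    (forall p', th p' != 0 -> cbox c (cmap c p) r p') -> bint th = dint (ext c (wform P Q c th)).
Proof.
move=> Ac cp v0; have [i [s0 sp]] : exists i s, curve i s = p.
  by apply/(curve_cover g); exists c.
have cs0 : cdom c (curve i s0) by rewrite sp.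
have [d1 /= d10 hd1] := (nbhs_normP _ _).1 (curve_near cs0).
have L0 := clen_gt0 i; set L := clen i in L0.
(* [d1 / 2] keeps the arc in the chart domain, and [L / 4] leaves a complementary arc to be
   avoided. *)
pose dl := Num.min (d1 / 2) (L / 4).
have dl0 : 0 < dl by rewrite lt_min !divr_gt0.
have dl1 : dl < d1 by rewrite gt_min ltr_pdivrMr// ltr_pMr// ltr1n.
have dlL : 2 * dl < L.
  have : dl <= L / 4 by rewrite ge_min lexx orbT.
  by move: L0; lra.
have cs s : s0 - dl <= s <= s0 + dl -> cdom c (curve i s).
  by rewrite -ler_distl => h; apply: hd1; rewrite /= distrC; exact: le_lt_trans dl1.
pose gam s := cmap c (curve i s) 0 0.
have dgam s : s0 - dl <= s <= s0 + dl -> is_derive s 1 gam (dc c i s 0 0).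
  by move=> /cs h; exact: gamma_derive.
have inc a b : s0 - dl <= a -> a < b -> b <= s0 + dl -> gam a < gam b.
  move=> ha ab hb.
  have hab s : a <= s <= b -> s0 - dl <= s <= s0 + dl.
    by move=> /andP[h1 h2]; rewrite (le_trans ha h1) (le_trans h2 hb).
  have [||w] := @MVT_segment R gam (fun s => dc c i s 0 0) a b (ltW ab).
  - by move=> w; rewrite in_itv/= => /andP[/ltW h1 /ltW h2]; apply/dgam/hab; rewrite h1.
  - by apply: cont_on_derive => w /hab; exact: dgam.
  rewrite in_itv/= => /hab/cs cw E.
  by rewrite -subr_gt0 E mulr_gt0 ?subr_gt0//; exact: dc_gt0.
set q := cmap c p.
have gq : gam s0 = q 0 0 by rewrite /gam sp.
have g1 : gam (s0 - dl) < q 0 0 by rewrite -gq; apply: inc => //; [rewrite gtrBl|rewrite lerDl ltW].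
have g2 : q 0 0 < gam (s0 + dl) by rewrite -gq; apply: inc => //; [rewrite gerBl ltW|rewrite ltrDl].
have nI := isolate s0 dl0 dlL; rewrite sp -(cmapK cp) in nI.
have [r1 gr1 hr1] := good_ex (cimgP cp) (inv_near (cimgP cp) nI).
have r10 : 0 < r1 by case: gr1.
(* The square must fit in the neighbourhood that isolates the arc, and the image of the arc must
   cover its bottom edge. *)
pose r0 := Num.min r1 (Num.min ((q 0 0 - gam (s0 - dl)) / 2) ((gam (s0 + dl) - q 0 0) / 2)).
have r0p : 0 < r0 by rewrite !lt_min r10 !divr_gt0// subr_gt0.
have r01 : r0 <= r1 by rewrite ge_min lexx.
have r02 : gam (s0 - dl) < q 0 0 - r0.
  have : r0 <= (q 0 0 - gam (s0 - dl)) / 2 by rewrite !ge_min lexx orbT.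
  by move: g1; lra.
have r03 : q 0 0 + r0 <= gam (s0 + dl).
  have : r0 <= (gam (s0 + dl) - q 0 0) / 2 by rewrite !ge_min lexx !orbT.
  by move: g2; lra.
have gr0 := good_le r0p r01 gr1.
have r2 : 0 < r0 / 2 by rewrite divr_gt0.
have rr : r0 / 2 < r0 by rewrite ltr_pdivrMr// ltr_pMr// ltr1n.
exists (r0 / 2); split; first exact: good_le (ltW rr) gr0.
move=> th cth sth; have hth := cbox_cell sth.
have qU : 0 <= q 0 1 by rewrite v0.
rewrite (green_local Ac cth r2 rr gr0 qU (or_introl v0) hth) v0 eqxx.
have sI p' : th p' != 0 -> (forall j s, j != i -> curve j s <> p') /\
     (forall s, s0 + dl <= s <= s0 + L - dl -> curve i s <> p').
  move=> /sth[cp' [h1 h2]]; rewrite -(cmapK cp'); apply: hr1.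
  - exact: (cimg_upper (cimgP cp')).
  - by apply: le_trans h1 (le_trans (ltW rr) r01).
  - by apply: le_trans h2 (le_trans (ltW rr) r01).
rewrite /bint (bigD1 i)//= [X in _ + X]big1 ?addr0; last first.
  move=> j ji; apply: rint0 => s _; apply/eqP; rewrite mulf_eq0; apply/orP; left.
  by apply: contraT => /sI[/(_ j s ji)].
(* The period is made to start at [s0 - dl], lest the arc be cut at the parameter 0. *)
rewrite (@rint_periodic _ _ (s0 - dl))//; first last.
- by move=> s; rewrite curve_periodic e_periodic.
- by move=> s; apply: cvgM; [exact: th_cont|exact: e_cont].
rewrite (@rint_sub _ _ _ (s0 - dl) (s0 + dl))//; first last.
- move=> s /andP[h1 h2] h3; rewrite h1/= leNgt; apply/negP => h4.
  move: h3; rewrite mulf_eq0 negb_or => /andP[/sI[_ /(_ s)] + _]; apply => //.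
  by rewrite (ltW h4) addrAC.
- by rewrite -/L -addrA lerD2l; move: dlL; lra.
pose k w := ext c (fun q => loc c th q * P c q) (pt w 0).
have cpt w : q 0 0 - r0 <= w <= q 0 0 + r0 -> cimg c (pt w 0).
  move=> h; case: gr0 => _; apply; [by rewrite pt1|by rewrite pt0 ler_distl|].
  by rewrite pt1 v0 subrr normr0 ltW.
have FK w : cimg c w -> loc c th w * P c w != 0 -> cell q r0 w.
  move=> cw; rewrite mulf_eq0 negb_or => /andP[/(hth _ cw)[h1 h2] _].
  by split; [exact: le_trans (ltW rr)|exact: le_trans (ltW rr)].
transitivity (rint (q 0 0 - r0) (q 0 0 + r0) k); last first.
  by apply: rint_ext => w /cpt cw; rewrite /k ext_in.
rewrite -(@rint_ext _ _ _ (fun s => k (gam s) * dc c i s 0 0)); last first.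
  move=> s /cs css; rewrite (eE Ac css) /k -gamma_pt// ext_in; last exact: cimgP.
  by rewrite /loc/= cmapK// mulrA.
have ds0 : s0 - dl <= s0 + dl by rewrite lerD2l ge0_cp// ltW.
have rr0 : q 0 0 - r0 <= q 0 0 + r0 by rewrite lerD2l ge0_cp// ltW.
apply: (@subst1 R k gam (fun s => dc c i s 0 0)) => //.
- have [cth' _ _] := cth c Ac.
  have [cF _ _] := C1M (@cimg_adm R M c) cth' (P_C1 Ac).
  have cK : forall w, upper 0 w -> cont (upper 0) (ext c (fun q => loc c th q * P c q)) w.
    apply: (@ext_cont _ _ (cell q r0)) => //; first exact: cell_out.
      by move=> w h [h1 h2]; case: gr0 => _; exact.
    by move=> w cw; exact: C1_cont.
  move=> w; have ww : w - 1 < w + 1 by lra.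
  have H u : w - 1 <= u <= w + 1 -> upper 0 (pt u 0) by rewrite /upper/= pt1.
  have /(within_continuous_continuous ww) := @slice0_cont R (upper 0) _ (w - 1) (w + 1) 0 H cK; apply.
  by rewrite in_itv/=; apply/andP; split; lra.
- by move=> w /ext_neq0[cw /(FK _ cw)[]]; rewrite pt0 ler_distl.
- apply/cont_onP => s /cs css; apply: cvg_within_filter; exact: dc_cont.
Qed.

Lemma local_stokes p : exists c (r : R), [/\ charts A c, cdom c p, good c (cmap c p) r &
  forall th, MC2 A th -> (forall p', th p' != 0 -> cbox c (cmap c p) r p') ->
    bint th = dint (ext c (wform P Q c th))].
Proof.
have [c Ac cp] := charts_cover A p; exists c.
have [v0|v0] := eqVneq (cmap c p 0 1) 0.
  by have [r [gr h]] := local_stokes_boundary Ac cp v0; exists r.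
by have [r [gr h]] := local_stokes_interior Ac cp v0; exists r.
Qed.

End Boundary.

(** * From small supports to the whole surface *)

Section Stokes.
Variables (R : realType) (M : topologicalType) (A : oriented_atlas R M).
Hypothesis hausM : hausdorff_space M.
Hypothesis compM : compact [set: M].
Local Notation V := 'rV[R]_2.
Variables (x : M -> 'rV[R]_3) (g : arclength_boundary A x).
Implicit Types (c : chart R M) (p : M) (i : 'I_(ncomp g)) (s t : R).
Variables P Q : chart R M -> V -> R.
Hypothesis P_C1 : forall c, charts A c -> C1 (cimg c) (P c).
Hypothesis Q_C1 : forall c, charts A c -> C1 (cimg c) (Q c).
Hypothesis closedPQ : forall c q, charts A c -> cimg c q -> pd 0 (Q c) q = pd 1 (P c) q.
Hypothesis P_trans : forall c c' q, charts A c -> charts A c' -> ovl c c' q ->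
  P c q = P c' (trans c c' q) * pd 0 (fun q => trans c c' q 0 0) q
        + Q c' (trans c c' q) * pd 0 (fun q => trans c c' q 0 1) q.
Hypothesis Q_trans : forall c c' q, charts A c -> charts A c' -> ovl c c' q ->
  Q c q = P c' (trans c c' q) * pd 1 (fun q => trans c c' q 0 0) q
        + Q c' (trans c c' q) * pd 1 (fun q => trans c c' q 0 1) q.
Variable e : 'I_(ncomp g) -> R -> R.
Hypothesis eE : forall c i s, charts A c -> cdom c (curve i s) ->
  e i s = P c (cmap c (curve i s)) * dc c i s 0 0.
Hypothesis dc_gt0 : forall c i s, charts A c -> cdom c (curve i s) -> 0 < dc c i s 0 0.
Hypothesis e_periodic : forall i s, e i (s + clen i) = e i s.

Lemma tame_ext c q (r : R) (F : V -> R) : good c q r ->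
  (forall w, cimg c w -> F w != 0 -> cell q r w) ->
  (forall w, cimg c w -> cont (cimg c) F w) -> tame (ext c F).
Proof.
move=> [r0 gd] FK cF; split.
  exists (`|q 0 0| + `|q 0 1| + r) => w /ext_neq0[cw /(FK _ cw)[h1 h2]].
  have U := cimg_upper cw.
  have n0 := normr_ge0 (q 0 0); have n1 := normr_ge0 (q 0 1).
  have b0 : `|w 0 0| <= `|q 0 0| + `|q 0 1| + r.
    rewrite -(subrK (q 0 0) (w 0 0)); apply: le_trans (ler_normD _ _) _.
    by move: h1 n1; lra.
  have b1 : `|w 0 1| <= `|q 0 0| + `|q 0 1| + r.
    rewrite -(subrK (q 0 1) (w 0 1)); apply: le_trans (ler_normD _ _) _.
    by move: h2 n0; lra.
  split; first by rewrite -ler_norml.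
  by apply/andP; split; [exact: U|exact: le_trans (ler_norm _) b1].
apply: (@ext_cont _ _ (cell q r)) => //; first exact: cell_out.
by move=> w h [h1 h2]; exact: gd.
Qed.

Lemma wform_zero c f q : cimg c q -> nbhs (chart_inv c q) (fun p => f p = 0) -> wform P Q c f q = 0.
Proof.
move=> cq n; have z j : pd j (loc c f) q = 0.
  apply: (pd_zero _ (@cimg_adm R M c) cq); apply: filterS (inv_near cq n) => w h cw.
  by apply: h; exact: (cimg_upper cw).
by rewrite /wform !z !mul0r subrr.
Qed.

(** The point [p] may lie outside the domain of [c]: away from the closed box that carries [f], the
    differential of [f] is 0 and both integrals vanish. *)
Lemma compare_supp c c' p z (r : R) f : charts A c -> charts A c' -> good c z r ->
  (forall p, f p != 0 -> cbox c z r p) -> MC2 A f -> cdom c' p ->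
  exists W : set M, nbhs p W /\ forall th, MC2 A th -> (forall p', th p' != 0 -> W p') ->
    dint (ext c (fun q => loc c th q * wform P Q c f q))
    = dint (ext c' (fun q => loc c' th q * wform P Q c' f q)).
Proof.
move=> Ac Ac' gz fz cf c'p; have [[cp _]|ncb] := pselect (cbox c z r p).
  have [W [nW h]] := compare P_C1 Q_C1 P_trans Q_trans Ac Ac' cp c'p.
  by exists W; split; [exact: nW|move=> th cth sth; exact: h].
have oC p' : ~ cbox c z r p' -> nbhs p' (~` cbox c z r).
  by move=> h; apply: open_nbhs_nbhs; split => //; exact/closed_openC/cbox_closed.
exists (~` cbox c z r); split; first exact: oC.
move=> th cth sth.
have E c0 : ext c0 (fun q => loc c0 th q * wform P Q c0 f q) = fun=> 0.
  apply/funext => q; apply/eqP; apply: contraT => /ext_neq0[cq].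
  rewrite mulf_eq0 negb_or => /andP[/sth/oC n]; rewrite wform_zero ?eqxx//.
  by apply: filterS n => p' np'; apply/eqP; apply: contraT => /fz.
by rewrite !E.
Qed.

(* A partition of unity [rho] turns the boundary integral of the closed form [P du + Q dv]
   into [\sum_j] of the integrals of [d rho_j /\ (P du + Q dv)]. A second partition moves
   these terms to charts that do not depend on [j], where [\sum_j d rho_j = 0]. *)
Lemma stokes : \sum_i rint 0 (clen i) (e i) = 0.
Proof.
have LS := local_stokes hausM P_C1 Q_C1 closedPQ eE dc_gt0 e_periodic.
have [cc hcc] := choice LS; have {hcc}[rr hr] := choice hcc.
pose B p := cbox (cc p) (cmap (cc p) p) (rr p).
have nB p : nbhs p (B p).
  by have [Ac cp [r0 _] _] := hr p; exact: cbox_nbhs.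
have [n [z [rho [crho srho rho1]]]] := partition_of_unity A hausM compM nB.
have s1 : \sum_i rint 0 (clen i) (e i) = \sum_j bint e (rho j).
  rewrite /bint exchange_big/=; apply: eq_bigr => i _.
  have cfe j : cont_on 0 (clen i) (fun s => rho j (curve i s) * e i s).
    apply: continuous_cont_on => s; apply: cvgM; first exact: th_cont (crho j) s.
    exact: (e_cont P_C1 eE).
  have [_ <-] := rint_sum cfe.
  by apply: rint_ext => s _; rewrite -mulr_suml rho1 mul1r.
rewrite s1.
pose c_ j := cc (z j).
have Ac_ j : charts A (c_ j) by have [] := hr (z j).
have gz j : good (c_ j) (cmap (c_ j) (z j)) (rr (z j)) by have [] := hr (z j).
have s2 : \sum_j bint e (rho j) = \sum_j dint (ext (c_ j) (wform P Q (c_ j) (rho j))).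
  by apply: eq_bigr => j _; have [_ _ _ h] := hr (z j); apply: h => //; exact: srho.
rewrite s2.
(* One chart [c] at [p] and one neighbourhood [W] for which the comparisons with all the charts
   [c_ j] hold at the same time; there are finitely many of them. *)
pose K p (W : set M) c := [/\ nbhs p W, charts A c, cdom c p,
   exists2 r : R, good c (cmap c p) r & W `<=` cbox c (cmap c p) r &
   forall j th, MC2 A th -> (forall p', th p' != 0 -> W p') ->
    dint (ext (c_ j) (fun q => loc (c_ j) th q * wform P Q (c_ j) (rho j) q))
    = dint (ext c (fun q => loc c th q * wform P Q c (rho j) q))].
have HK p : exists Wc : set M * chart R M, K p Wc.1 Wc.2.
  have [c Ac cp] := charts_cover A p.
  have [r gr _] := good_ex (cimgP cp) (cimg_full (cimgP cp)).
  have r0 : 0 < r by case: gr.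
  have H j := compare_supp (Ac_ j) Ac (gz j) (srho j) (crho j) cp.
  have [W hW] := choice H.
  exists ([set p' | cbox c (cmap c p) r p' /\ forall j, W j p'], c); split; [|exact: Ac|exact: cp| |].
  - apply: filterI; first exact: cbox_nbhs.
    by apply: filter_forall => j; have [] := hW j.
  - by exists r => // p' [].
  - move=> j th cth sth; have [_ h] := hW j; apply: h => // p' /sth[_]; exact.
have [Wc hWc] := choice HK.
have nW p : nbhs p (Wc p).1 by have [] := hWc p.
have [m [y [th [cth sth th1]]]] := partition_of_unity A hausM compM nW.
pose d_ k := (Wc (y k)).2.
have Ad_ k : charts A (d_ k) by have [] := hWc (y k).
have cw c f h : charts A c -> MC2 A f -> MC2 A h ->
    forall w, cimg c w -> cont (cimg c) (fun q => loc c f q * wform P Q c h q) w.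
  move=> Ac cf ch w cw; have [cf' _ _] := cf c Ac.
  by apply: contM; [exact: (C1_cont cf' cw)|exact: (C1_cont (wform_C1 P_C1 Q_C1 Ac ch) cw)].
have s3 j : dint (ext (c_ j) (wform P Q (c_ j) (rho j))) =
    \sum_k dint (ext (d_ k) (fun q => loc (d_ k) (th k) q * wform P Q (d_ k) (rho j) q)).
  have t k : tame (ext (c_ j) (fun q => loc (c_ j) (th k) q * wform P Q (c_ j) (rho j) q)).
    apply: (tame_ext (gz j)); last exact: cw.
    move=> w cjw; rewrite mulf_eq0 negb_or => /andP[_].
    exact: (cell_wform (cbox_cell (srho j)) cjw).
  transitivity (\sum_k dint (ext (c_ j) (fun q => loc (c_ j) (th k) q * wform P Q (c_ j) (rho j) q))).
    have [_ <-] := dint_sum t; apply: dint_ext => q; rewrite /ext; case: asboolP => _.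
      by rewrite -mulr_suml /loc/= th1 mul1r.
    by rewrite big1.
  apply: eq_bigr => k _; have [_ _ _ _ h] := hWc (y k); apply: h => //; exact: sth.
rewrite (eq_bigr _ (fun j _ => s3 j)) exchange_big/= big1// => k _.
have [_ _ _ [r gr Wr] _] := hWc (y k).
have t j : tame (ext (d_ k) (fun q => loc (d_ k) (th k) q * wform P Q (d_ k) (rho j) q)).
  apply: (tame_ext gr); last exact: (cw _ _ _ (Ad_ k) (cth k) (crho j)).
  move=> w dw; rewrite mulf_eq0 negb_or => /andP[h _].
  by apply: (cbox_cell _ dw h) => p' /sth; exact: Wr.
have [_ <-] := dint_sum t.
rewrite (@dint_ext _ _ (fun=> 0)); first by have [] := tame0 R.
move=> q; rewrite /ext; case: asboolP => [dq|_]; last by rewrite big1.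
by rewrite -mulr_sumr (wform_sum _ _ (Ad_ k) crho rho1 dq) mulr0.
Qed.

End Stokes.

(** * The conormal form of a rotating surface *)

Section VectorAlgebra.
Variable R : realType.
Implicit Types u v w N : 'rV[R]_3.

Lemma ord3P (P : 'I_3 -> Prop) : P 0 -> P 1 -> P 2 -> forall k, P k.
Proof.
move=> P0 P1 P2 [[|[|[|m]]] hm]//.
- by rewrite (_ : Ordinal hm = 0)//; exact: val_inj.
- by rewrite (_ : Ordinal hm = 1)//; exact: val_inj.
- by rewrite (_ : Ordinal hm = 2)//; exact: val_inj.
Qed.

Lemma sum_ord3 (F : 'I_3 -> R) : \sum_k F k = F 0 + F 1 + F 2.
Proof.
rewrite !big_ord_recl big_ord0 addr0 addrA.
by congr (F _ + F _ + F _); exact: val_inj.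
Qed.

Lemma dotE u v : dot u v = u 0 0 * v 0 0 + u 0 1 * v 0 1 + u 0 2 * v 0 2.
Proof.
by rewrite /dot mxE sum_ord3 !mxE.
Qed.

Lemma dotC u v : dot u v = dot v u.
Proof. by rewrite !dotE; ring. Qed.

Lemma dotZl (k : R) u v : dot (k *: u) v = k * dot u v.
Proof. by rewrite !dotE !mxE; ring. Qed.

Lemma cross0 u v : cross u v 0 0 = u 0 1 * v 0 2 - u 0 2 * v 0 1.
Proof. by rewrite mxE. Qed.

Lemma cross1 u v : cross u v 0 1 = u 0 2 * v 0 0 - u 0 0 * v 0 2.
Proof. by rewrite mxE. Qed.

Lemma cross2 u v : cross u v 0 2 = u 0 0 * v 0 1 - u 0 1 * v 0 0.
Proof. by rewrite mxE. Qed.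

Lemma dot_E3 u : dot u E3 = u 0 2.
Proof. by rewrite dotE /E3 /vec3 !mxE/= !mulr0 mulr1 !add0r. Qed.

Lemma enorm1 u : enorm u = 1 -> dot u u = 1.
Proof.
move=> h; have d0 : 0 <= dot u u by rewrite dotE -!expr2 !addr_ge0// sqr_ge0.
by rewrite -(sqr_sqrtr d0) -/(enorm u) h expr1n.
Qed.

(** The components of the vector product are the 2x2 minors of [T] up to sign. If they all vanished,
    Cauchy-Binet would give determinant 0 to the product of [T] and its right inverse. *)
Lemma cross_row_free (T : 'M[R]_(2, 3)) : row_free T ->
  0 < dot (cross (row 0 T) (row 1 T)) (cross (row 0 T) (row 1 T)).
Proof.
move=> /row_freeP[B TB].
set n := cross _ _.
have n2 : 0 <= dot n n by rewrite dotE -!expr2 !addr_ge0// sqr_ge0.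
rewrite lt_neqAle n2 andbT; apply/eqP => n0.
have z k : n 0 k = 0.
  move: n0; rewrite dotE -!expr2 => /esym/eqP; rewrite !paddr_eq0 ?addr_ge0 ?sqr_ge0//.
  rewrite !sqrf_eq0 => /andP[/andP[/eqP h0 /eqP h1] /eqP h2].
  by move: k; apply: ord3P.
have H i j : (T *m B) i j = T i 0 * B 0 j + T i 1 * B 1 j + T i 2 * B 2 j.
  by rewrite mxE sum_ord3.
have E : (T *m B) 0 0 * (T *m B) 1 1 - (T *m B) 0 1 * (T *m B) 1 0 = 0.
  rewrite !H; have := z 0; have := z 1; have := z 2; rewrite cross0 cross1 cross2 !mxE => z2 z1 z0.
  transitivity ((T 0 1 * T 1 2 - T 0 2 * T 1 1) * (B 1 0 * B 2 1 - B 2 0 * B 1 1)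
    + (T 0 2 * T 1 0 - T 0 0 * T 1 2) * (B 2 0 * B 0 1 - B 0 0 * B 2 1)
    + (T 0 0 * T 1 1 - T 0 1 * T 1 0) * (B 0 0 * B 1 1 - B 1 0 * B 0 1)); first by ring.
  by rewrite z0 z1 z2 !mul0r !addr0.
by move: E; rewrite TB !mxE/= mulr1 mulr0 subr0 => /eqP; rewrite oner_eq0.
Qed.

(** The difference quotient of [1 / sqrt] between [z] and [y] is
    [- 1 / (sqrt z sqrt y (sqrt z + sqrt y))]; the derivative is left in this shape, at [z = y]. *)
Lemma inv_sqrt_derive (y : R) : 0 < y ->
  is_derive y 1 (fun t : R => (Num.sqrt t)^-1) (- (Num.sqrt y * Num.sqrt y * (Num.sqrt y + Num.sqrt y))^-1).
Proof.
move=> y0; have s0 : 0 < Num.sqrt y by rewrite sqrtr_gt0.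
have cs (z : R) : Num.sqrt t @[t --> z] --> Num.sqrt z by exact: sqrt_continuous.
apply: (@caratheodory_derive R _ (fun z => - (Num.sqrt z * Num.sqrt y * (Num.sqrt z + Num.sqrt y))^-1)).
  near=> z; have z0 : 0 < z by near: z; exact: lt_nbhsr.
  have sz : 0 < Num.sqrt z by rewrite sqrtr_gt0.
  have Ez := sqr_sqrtr (ltW z0); have Ey := sqr_sqrtr (ltW y0).
  have -> : z - y = Num.sqrt z ^+ 2 - Num.sqrt y ^+ 2 by rewrite Ez Ey.
  by field; rewrite !lt0r_neq0// addr_gt0.
apply: cvgN; apply: cvgV; first by rewrite lt0r_neq0// !mulr_gt0// addr_gt0.
apply: cvgM; first by apply: cvgM; [exact: cs|exact: cvg_cst].
by apply: cvgD; [exact: cs|exact: cvg_cst].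
Unshelve. all: by end_near. Qed.

Lemma inv_sqrt_derive_cont (y : R) : 0 < y ->
  {for y, continuous (fun t : R => - (Num.sqrt t * Num.sqrt t * (Num.sqrt t + Num.sqrt t))^-1)}.
Proof.
move=> y0; have s0 : 0 < Num.sqrt y by rewrite sqrtr_gt0.
have cs : Num.sqrt t @[t --> y] --> Num.sqrt y by exact: sqrt_continuous.
apply: cvgN; apply: cvgV; first by rewrite lt0r_neq0// !mulr_gt0// addr_gt0.
by apply: cvgM; [apply: cvgM|apply: cvgD]; exact: cs.
Qed.

End VectorAlgebra.

(** * Derivatives along a curve *)

Section CurveChain.
Variable R : realType.
Local Notation V := 'rV[R]_2.

(** A chain rule for functions differentiable only within [S]: the boundary curves run on the
    boundary line of the chart image. *)
Lemma wd_curve (S : set V) (f : V -> R) (gam : R -> V) (s a b d1 d2 : R) :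
  (\forall t \near s, S (gam t)) -> wd S f (gam s) a b ->
  is_derive s 1 (fun t => gam t 0 0) d1 -> is_derive s 1 (fun t => gam t 0 1) d2 ->
  is_derive s 1 (f \o gam) (a * d1 + b * d2).
Proof.
move=> nS [phi [psi [c c' <- <- h]]] h1 h2.
have [k1 [E1 ck1 <-]] := (is_derive1_caratheodory _ _ _).1 h1.
have [k2 [E2 ck2 <-]] := (is_derive1_caratheodory _ _ _).1 h2.
have cg : gam @ s --> gam s.
  apply/(@cvgrPdist_lt _ _ _ _ _) => e e0.
  have c1 : {for s, continuous (fun t => gam t 0 0)} by exact: is_derive_continuous h1.
  have c2 : {for s, continuous (fun t => gam t 0 1)} by exact: is_derive_continuous h2.
  have n1 : nbhs s (fun t => `|gam s 0 0 - gam t 0 0| < e) by exact: (@cvgrPdist_lt _ _ _ _ _ _ _).1 c1 _ e0.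
  have n2 : nbhs s (fun t => `|gam s 0 1 - gam t 0 1| < e) by exact: (@cvgrPdist_lt _ _ _ _ _ _ _).1 c2 _ e0.
  suff : nbhs s (fun t => `|gam s - gam t| < e) by [].
  by apply: filterS2 n1 n2 => t t1 t2; apply: norm_lt_coord; rewrite !mxE.
have lift_cont (F : V -> R) : cont S F (gam s) -> {for s, continuous (fun t => F (gam t))}.
  move=> cF U /cF hU; have {}hU : nbhs (gam s) (fun q => S q -> U (F q)) by exact: hU.
  have {}hU : nbhs s (fun t => S (gam t) -> U (F (gam t))) by exact: cg hU.
  suff : nbhs s (fun t => U (F (gam t))) by [].
  by apply: filterS2 nS hU => t St; exact.
apply: (@caratheodory_derive R (f \o gam) (fun t => phi (gam t) * k1 t + psi (gam t) * k2 t)).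
  have {}h : nbhs s (fun t => S (gam t) -> f (gam t) = f (gam s)
      + phi (gam t) * (gam t 0 0 - gam s 0 0) + psi (gam t) * (gam t 0 1 - gam s 0 1)) by exact: cg h.
  by apply: filterS2 nS h => t St /(_ St) /= ->; rewrite E1 E2; ring.
by apply: cvgD; apply: cvgM; [exact: lift_cont c|exact: ck1|exact: lift_cont c'|exact: ck2].
Qed.

End CurveChain.

(** * Vector-valued maps and the Weingarten equations *)

Section VectorCalculus.
Variable R : realType.
Local Notation V := 'rV[R]_2.
Implicit Types (S : set V) (F G : V -> 'rV[R]_3).

Definition pdv i F q : 'rV[R]_3 := \row_k pd i (fun q => F q 0 k) q.
Definition C1v S F := forall k, C1 S (fun q => F q 0 k).

Lemma C1_dot S F G : adm S -> C1v S F -> C1v S G ->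
  C1 S (fun q => dot (F q) (G q)) /\
  forall i q, S q -> pd i (fun q => dot (F q) (G q)) q = dot (pdv i F q) (G q) + dot (F q) (pdv i G q).
Proof.
move=> aS cF cG.
rewrite (_ : (fun q => dot (F q) (G q)) = (fun q => F q 0 0 * G q 0 0 + F q 0 1 * G q 0 1 + F q 0 2 * G q 0 2)); last first.
  by apply/funext => q; rewrite dotE.
have [c0 c00 c01] := C1M aS (cF 0) (cG 0); have [c1 c10 c11] := C1M aS (cF 1) (cG 1).
have [c2 c20 c21] := C1M aS (cF 2) (cG 2); have [d d0 d1] := C1D aS c0 c1.
have [e e0 e1] := C1D aS d c2; split; first exact: e.
apply: ord2P => q Sq.
  by rewrite e0// d0// c00// c10// c20// !dotE !mxE; ring.
by rewrite e1// d1// c01// c11// c21// !dotE !mxE; ring.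
Qed.

Lemma C1_cross S F G : adm S -> C1v S F -> C1v S G ->
  C1v S (fun q => cross (F q) (G q)) /\
  forall i q, S q -> pdv i (fun q => cross (F q) (G q)) q = cross (pdv i F q) (G q) + cross (F q) (pdv i G q).
Proof.
move=> aS cF cG.
have H j k : C1 S (fun q => F q 0 j * G q 0 k - F q 0 k * G q 0 j) /\ forall i q, S q ->
    pd i (fun q => F q 0 j * G q 0 k - F q 0 k * G q 0 j) q =
    (pdv i F q 0 j * G q 0 k - pdv i F q 0 k * G q 0 j) + (F q 0 j * pdv i G q 0 k - F q 0 k * pdv i G q 0 j).
  have [c0 c00 c01] := C1M aS (cF j) (cG k); have [c1 c10 c11] := C1M aS (cF k) (cG j).
  have [d d0 d1] := C1B aS c0 c1; split; first exact: d.
  by apply: ord2P => q Sq; rewrite ?d0 ?d1// ?c00 ?c01// ?c10 ?c11// !mxE; ring.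
have E0 : (fun q => cross (F q) (G q) 0 0) = (fun q => F q 0 1 * G q 0 2 - F q 0 2 * G q 0 1) by apply/funext => q; rewrite cross0.
have E1 : (fun q => cross (F q) (G q) 0 1) = (fun q => F q 0 2 * G q 0 0 - F q 0 0 * G q 0 2) by apply/funext => q; rewrite cross1.
have E2 : (fun q => cross (F q) (G q) 0 2) = (fun q => F q 0 0 * G q 0 1 - F q 0 1 * G q 0 0) by apply/funext => q; rewrite cross2.
have [h0 k0] := H 1 2; have [h1 k1] := H 2 0; have [h2 k2] := H 0 1.
split; first by apply: ord3P; rewrite ?E0 ?E1 ?E2.
move=> i q Sq; apply/rowP; apply: ord3P.
- by rewrite [RHS]mxE !cross0 [LHS]mxE E0 k0.
- by rewrite [RHS]mxE !cross1 [LHS]mxE E1 k1.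
- by rewrite [RHS]mxE !cross2 [LHS]mxE E2 k2.
Qed.

Lemma C1_vscale S (f : V -> R) F : adm S -> C1 S f -> C1v S F -> C1v S (fun q => f q *: F q).
Proof.
move=> aS cf cF k; have [c _ _] := C1M aS cf (cF k).
by apply: (C1_ext aS _ c) => q _; rewrite mxE.
Qed.

(** The right-hand side is the trace of the adjugate of [I] times [B]; with [B = I T] it becomes a
    polynomial identity free of inverses. *)
Lemma trace_shape (I B : 'M[R]_2) : \det I != 0 ->
  \tr (invmx I *m B) * \det I = I 1 1 * B 0 0 - I 0 1 * B 1 0 - I 1 0 * B 0 1 + I 0 0 * B 1 1.
Proof.
move=> I0; have uI : I \in unitmx by rewrite unitmxE unitfE.
set T := invmx I *m B; have BE : B = I *m T by rewrite mulKVmx.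
have E i j : B i j = I i 0 * T 0 j + I i 1 * T 1 j.
  by rewrite {1}BE mxE sum_ord2.
by rewrite !E det2 /mxtrace sum_ord2; ring.
Qed.

Lemma lagrange (p q r s : 'rV[R]_3) : dot (cross p q) (cross r s) = dot p r * dot q s - dot p s * dot q r.
Proof. by rewrite !dotE !cross0 !cross1 !cross2; ring. Qed.

(** As [p] and [q] are orthogonal to [N], the double product [N x ((p x q) x N)] vanishes; expanded,
    it is the difference of the two sides. *)
Lemma cross_normal (N p q : 'rV[R]_3) k : dot p N = 0 -> dot q N = 0 ->
  cross p q 0 k * dot N N = N 0 k * dot (cross p q) N.
Proof.
move=> pN qN.
have E j l : N 0 j * (q 0 l * dot p N - p 0 l * dot q N) = 0 by rewrite pN qN !mulr0 subrr mulr0.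
apply/eqP; rewrite -subr_eq0; apply/eqP; move: k; apply: ord3P.
- by rewrite -[RHS](subrr 0) -{1}(E 1 2) -(E 2 1) !dotE !cross0 !cross1 !cross2; ring.
- by rewrite -[RHS](subrr 0) -{1}(E 2 0) -(E 0 2) !dotE !cross0 !cross1 !cross2; ring.
- by rewrite -[RHS](subrr 0) -{1}(E 0 1) -(E 1 0) !dotE !cross0 !cross1 !cross2; ring.
Qed.

(* [N_u x X_v - N_v x X_u = - 2H X_u x X_v]: both sides are normal, and pairing them
   with [X_u x X_v] gives the trace of the shape operator. *)
Lemma weingarten_cross (rho h : R) (u v N Nu Nv : 'rV[R]_3) (n := cross u v) :
  N = rho *: n -> dot N N = 1 -> dot N u = 0 -> dot N v = 0 -> dot Nu N = 0 -> dot Nv N = 0 ->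
  h * dot n n = - (dot v v * dot Nu u - dot u v * dot Nv u - dot u v * dot Nu v + dot u u * dot Nv v) ->
  cross Nu v 0 2 - cross Nv u 0 2 = - h * n 0 2.
Proof.
move=> NE NN uN vN NuN NvN hn.
rewrite dotC in uN; rewrite dotC in vN.
have := cross_normal 2 NuN vN; have := cross_normal 2 NvN uN; rewrite NN !mulr1 => -> ->.
have nN w : dot w N = rho * dot w n by rewrite NE dotC dotZl dotC.
have r1 : rho ^+ 2 * dot n n = 1 by rewrite -NN {1}NE dotZl nN mulrA.
rewrite -mulrBr !nN !lagrange {1}NE mxE.
rewrite -[RHS]mulr1 -r1; rewrite !(mulrA (- h * _)).
transitivity (rho ^+ 2 * n 0 2 * - (h * dot n n)); last by ring.
by rewrite hn (dotC v u); ring.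
Qed.

End VectorCalculus.

(** * Closedness of the form on a parametrized surface *)

Section LocalSurface.
Variable R : realType.
Local Notation V := 'rV[R]_2.
Variables (S : set V) (X : V -> 'rV[R]_3) (N : V -> 'rV[R]_3) (a b : R).
Hypothesis aS : adm S.
Hypothesis cX : forall k, C2 S (fun q => X q 0 k).
Let u := pdv 0 X.
Let v := pdv 1 X.
Let n q := cross (u q) (v q).
Hypothesis regX : forall q, S q -> 0 < dot (n q) (n q).
Hypothesis NE : forall q, S q -> N q = (enorm (n q))^-1 *: n q.

Lemma pdv_C1 i : C1v S (pdv i X).
Proof.
move=> k; have [_ h0 h1] := cX k.
rewrite (_ : (fun q => pdv i X q 0 k) = pd i (fun q => X q 0 k)); last by apply/funext => q; rewrite mxE.
by move: i; apply: ord2P.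
Qed.

Lemma pdv_swap q : S q -> pdv 0 v q = pdv 1 u q.
Proof.
move=> Sq; apply/rowP => k; rewrite !mxE.
have E i : (fun q => pdv i X q 0 k) = pd i (fun q => X q 0 k) by apply/funext => q'; rewrite mxE.
by rewrite !E (schwarz aS Sq (cX k)).
Qed.

Lemma normal_C1 : C1v S N.
Proof.
have [cn _] := C1_cross aS (pdv_C1 0) (pdv_C1 1).
have [cnn _] := C1_dot aS cn cn.
have [ck _ _] := @C1_comp1 _ S _ (fun t => (Num.sqrt t)^-1)
  (fun t => - (Num.sqrt t * Num.sqrt t * (Num.sqrt t + Num.sqrt t))^-1) aS cnn
  (fun q Sq => inv_sqrt_derive (regX Sq)) (fun q Sq => inv_sqrt_derive_cont (regX Sq)).
have c := C1_vscale aS ck cn.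
by move=> k; apply: (C1_ext aS _ (c k)) => q Sq; rewrite NE.
Qed.

Lemma normal_unit q : S q -> dot (N q) (N q) = 1.
Proof.
move=> Sq; rewrite NE// dotZl dotC dotZl mulrA -expr2.
by rewrite -[X in _ * X]sqr_sqrtr ?(ltW (regX Sq))// -exprMn mulVf ?expr1n// gt_eqF// sqrtr_gt0 regX.
Qed.

Lemma normal_u q : S q -> dot (N q) (u q) = 0.
Proof. by move=> Sq; rewrite NE// dotZl /n !dotE !cross0 !cross1 !cross2; ring. Qed.

Lemma normal_v q : S q -> dot (N q) (v q) = 0.
Proof. by move=> Sq; rewrite NE// dotZl /n !dotE !cross0 !cross1 !cross2; ring. Qed.

Lemma pdv_normal i q : S q -> dot (pdv i N q) (N q) = 0.
Proof.
move=> Sq; have [c h] := C1_dot aS normal_C1 normal_C1.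
have [_ z0 z1] := C1_cst (1 : R) aS.
have [_ e0 e1] := C1_extE aS c normal_unit.
have : dot (pdv i N q) (N q) + dot (N q) (pdv i N q) = 0.
  by rewrite -h//; move: i; apply: ord2P; rewrite -?e0 -?e1 ?z0 ?z1.
by rewrite (dotC (N q)) -mulr2n => /eqP; rewrite mulrn_eq0 => /eqP.
Qed.

Lemma weingarten i j q : S q -> dot (pdv i N q) (pdv j X q) = - dot (pdv i (pdv j X) q) (N q).
Proof.
move=> Sq; have [c h] := C1_dot aS normal_C1 (pdv_C1 j).
have [_ z0 z1] := C1_cst (0 : R) aS.
have E0 w : S w -> dot (N w) (pdv j X w) = 0.
  by move=> Sw; move: j {c h}; apply: ord2P; [exact: normal_u|exact: normal_v].
have [_ e0 e1] := C1_extE aS c E0.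
have : dot (pdv i N q) (pdv j X q) + dot (N q) (pdv i (pdv j X) q) = 0.
  by rewrite -h//; move: i; apply: ord2P; rewrite -?e0 -?e1 ?z0 ?z1.
by move=> /eqP; rewrite addr_eq0 => /eqP ->; rewrite !dotE; congr (- _); ring.
Qed.

Let wt q := a / 4 * (X q 0 0 ^+ 2 + X q 0 1 ^+ 2) + b / 2.

(** The value of the 1-form of the overview on a tangent vector [t] at the point [y]; the third
    component stands for the product with [E3]. *)
Definition weighted_form (N y t : 'rV[R]_3) :=
  cross N t 0 2 + (a / 4 * (y 0 0 ^+ 2 + y 0 1 ^+ 2) + b / 2) * cross y t 0 2.

Lemma weighted_C1 i : C1 S (fun q => weighted_form (N q) (X q) (pdv i X q)) /\
  forall j q, S q -> pd j (fun q => weighted_form (N q) (X q) (pdv i X q)) q =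
   cross (pdv j N q) (pdv i X q) 0 2 + cross (N q) (pdv j (pdv i X) q) 0 2
   + a / 2 * (X q 0 0 * pdv j X q 0 0 + X q 0 1 * pdv j X q 0 1) * cross (X q) (pdv i X q) 0 2
   + wt q * (cross (pdv j X q) (pdv i X q) 0 2 + cross (X q) (pdv j (pdv i X) q) 0 2).
Proof.
have cX1 k : C1 S (fun q => X q 0 k) by have [] := cX k.
have [c1 h1] := C1_cross aS normal_C1 (pdv_C1 i).
have [c2 h2] := C1_cross aS cX1 (pdv_C1 i).
have [d0 d00 d01] := C1M aS (cX1 0) (cX1 0); have [d1 d10 d11] := C1M aS (cX1 1) (cX1 1).
have [d d'0 d'1] := C1D aS d0 d1; have [e e0 e1] := C1Z (a / 4) aS d.
have [z z0 z1] := C1_cst (b / 2) aS; have [w w0 w1] := C1D aS e z.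
have [m m0 m1] := C1M aS w (c2 2); have [s s0 s1] := C1D aS (c1 2) m.
have E : (fun q => weighted_form (N q) (X q) (pdv i X q)) =
   (fun q => cross (N q) (pdv i X q) 0 2
   + (a / 4 * (X q 0 0 * X q 0 0 + X q 0 1 * X q 0 1) + b / 2) * cross (X q) (pdv i X q) 0 2).
  by apply/funext => q; rewrite /weighted_form !expr2.
rewrite E; split; first exact: s.
move=> j q Sq.
have g1 : pd j (fun q => cross (N q) (pdv i X q) 0 2) q =
    cross (pdv j N q) (pdv i X q) 0 2 + cross (N q) (pdv j (pdv i X) q) 0 2.
  by have /rowP/(_ 2) := h1 j q Sq; rewrite [LHS]mxE [RHS]mxE.
have g2 : pd j (fun q => cross (X q) (pdv i X q) 0 2) q =
    cross (pdv j X q) (pdv i X q) 0 2 + cross (X q) (pdv j (pdv i X) q) 0 2.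
  by have /rowP/(_ 2) := h2 j q Sq; rewrite [LHS]mxE [RHS]mxE.
have dj k : pdv j X q 0 k = pd j (fun q => X q 0 k) q by rewrite mxE.
rewrite !dj; move: j g1 g2 {dj}; apply: ord2P => g1 g2.
  rewrite s0// g1 m0// g2 w0// e0// z0// d'0// d00// d10// /wt.
  by set C := cross (X q) _ 0 2; field.
rewrite s1// g1 m1// g2 w1// e1// z1// d'1// d01// d11// /wt.
by set C := cross (X q) _ 0 2; field.
Qed.

Hypothesis curvX : forall q, S q -> (a * (X q 0 0 ^+ 2 + X q 0 1 ^+ 2) + b) * dot (n q) (n q) =
  dot (v q) (v q) * dot (pdv 0 (pdv 0 X) q) (N q) - dot (u q) (v q) * dot (pdv 1 (pdv 0 X) q) (N q)
  - dot (u q) (v q) * dot (pdv 0 (pdv 1 X) q) (N q) + dot (u q) (u q) * dot (pdv 1 (pdv 1 X) q) (N q).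

(** The second derivatives of [X] cancel by symmetry. The weight [a r^2 / 4 + b / 2] counts twice
    through [d<x /\ dx, E3>], and its own differential adds another [a r^2 / 2], whence the factor
    [a r^2 + b]. By [curvX] this is twice the mean curvature, which the derivatives of [N]
    compensate. *)
Lemma weighted_closed q : S q ->
  pd 0 (fun q => weighted_form (N q) (X q) (v q)) q = pd 1 (fun q => weighted_form (N q) (X q) (u q)) q.
Proof.
move=> Sq; have [_ h0] := weighted_C1 0; have [_ h1] := weighted_C1 1.
rewrite h0// h1// pdv_swap// -/u -/v; apply/eqP; rewrite -subr_eq0; apply/eqP.
have K : (a * (X q 0 0 ^+ 2 + X q 0 1 ^+ 2) + b) * dot (n q) (n q) =
  - (dot (v q) (v q) * dot (pdv 0 N q) (u q) - dot (u q) (v q) * dot (pdv 1 N q) (u q)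
   - dot (u q) (v q) * dot (pdv 0 N q) (v q) + dot (u q) (u q) * dot (pdv 1 N q) (v q)).
  rewrite curvX// (weingarten 0 0 Sq) (weingarten 0 1 Sq) (weingarten 1 0 Sq) (weingarten 1 1 Sq).
  by rewrite !mulrN !opprD !opprK.
have W := weingarten_cross (NE Sq) (normal_unit Sq) (normal_u Sq) (normal_v Sq) (pdv_normal 0 Sq) (pdv_normal 1 Sq) K.
transitivity (cross (pdv 0 N q) (v q) 0 2 - cross (pdv 1 N q) (u q) 0 2
  + (a * (X q 0 0 ^+ 2 + X q 0 1 ^+ 2) + b) * cross (u q) (v q) 0 2).
  rewrite /wt !cross2 /u /v; move: (pdv 1 (pdv 0 X) q) (pdv 0 N q) (pdv 1 N q) (N q) (pdv 0 X q) (pdv 1 X q) (X q).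
  move=> y n1 n2 n0 x0 x1 x2; move: (y 0 0) (y 0 1) (n1 0 0) (n1 0 1) (n2 0 0) (n2 0 1).
  move: (n0 0 0) (n0 0 1) (x0 0 0) (x0 0 1) (x1 0 0) (x1 0 1) (x2 0 0) (x2 0 1).
  by move=> *; field.
by rewrite W -/(n q); ring.
Qed.

End LocalSurface.

(** * The frame of normal, conormal and boundary tangent *)

Section Conormal.
Variable R : realType.
Implicit Types t nu v N : 'rV[R]_3.

Lemma cross_cross v nu : cross (cross nu v) v = dot nu v *: v - dot v v *: nu.
Proof. by apply/rowP; apply: ord3P; rewrite ?cross0 ?cross1 ?cross2 !dotE !mxE/= ?cross0 ?cross1 ?cross2; ring. Qed.

(** [- nu /\ v] is [w1 d n], and its positivity along [N] gives [0 < d]. It is a unit vector, as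
    [nu] and [v] are orthonormal, so it equals [N]; its product with [v] is then [nu]. *)
Lemma conormal_cross (t0 t1 : 'rV[R]_3) nu v N (w0 w1 d rho : R) (n := cross t0 t1) :
  0 < dot n n -> 0 < rho -> N = rho *: n -> dot N N = 1 ->
  0 < w1 -> nu = w0 *: t0 + w1 *: t1 -> v = d *: t0 ->
  dot nu t0 = 0 -> dot nu nu = 1 -> dot v v = 1 -> 0 < dot (cross (- nu) v) N ->
  0 < d /\ cross N v = nu.
Proof.
move=> n0 r0 NE NN w10 nuE vE nut nunu vv pos.
have E : cross (- nu) v = (w1 * d) *: n.
  by rewrite nuE vE; apply/rowP; apply: ord3P; rewrite [RHS]mxE ?cross0 ?cross1 ?cross2 !mxE; ring.
have nuv : dot nu v = 0 by rewrite vE dotC dotZl dotC nut mulr0.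
have m0 : 0 < w1 * d.
  by move: pos; rewrite E dotZl NE dotC dotZl mulrA pmulr_lgt0// pmulr_lgt0.
have d0 : 0 < d by rewrite -(pmulr_rgt0 _ w10).
split => //.
have q1 : (w1 * d) ^+ 2 * dot n n = 1.
  rewrite expr2 -mulrA -dotZl -E dotC -dotZl -E lagrange vv mulr1.
  rewrite (_ : dot (- nu) (- nu) = 1); last by rewrite -nunu !dotE !mxE; ring.
  by rewrite (_ : dot (- nu) v = 0) ?mul0r ?subr0// -[RHS]oppr0 -nuv !dotE !mxE; ring.
have q2 : rho ^+ 2 * dot n n = 1 by rewrite expr2 -mulrA -dotZl -NE dotC -dotZl -NE.
have mr : w1 * d = rho.
  have : (w1 * d) ^+ 2 == rho ^+ 2.
    by apply/eqP; apply: (mulIf (lt0r_neq0 n0)); rewrite q1 q2.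
  by rewrite eqf_sqr => /orP[/eqP//|/eqP h]; move: m0; rewrite h oppr_gt0 ltNge (ltW r0).
rewrite NE -mr -E cross_cross vv.
rewrite (_ : dot (- nu) v = 0); last by rewrite -[RHS]oppr0 -nuv !dotE !mxE; ring.
by rewrite scale0r sub0r scale1r opprK.
Qed.

End Conormal.

(** * The form on the immersed surface and along its boundary *)

Section Geometry.
Variables (R : realType) (M : topologicalType) (A : oriented_atlas R M).
Variables (x N nu : M -> 'rV[R]_3) (a b : R).
Hypothesis immx : smooth_immersion A x.
Hypothesis gaussN : gauss_map A x N.
Hypothesis statx : stationary_rotating A x N a b.
Local Notation V := 'rV[R]_2.
Implicit Types (c : chart R M) (q : V) (p : M).

Local Notation X c := (local_repr x c).

Lemma x_MC2 k : MC2 A (fun p => x p 0 k).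
Proof.
move=> c Ac; have [sx _] := immx.
exact: (@smooth_upto_C2 _ _ (X c) _ k (@cimg_adm R M c) (sx c Ac)).
Qed.

Lemma X_C2 c : charts A c -> forall k, C2 (cimg c) (fun q => X c q 0 k).
Proof. by move=> Ac k; exact: x_MC2 k c Ac. Qed.

Lemma X_C1 c k : charts A c -> C1 (cimg c) (fun q => X c q 0 k).
Proof. by move=> Ac; have [] := X_C2 Ac k. Qed.

Lemma partialE c i q : charts A c -> cimg c q -> partial i (X c) q = pdv i (X c) q.
Proof.
move=> Ac cq; apply/rowP => k; rewrite [RHS]mxE.
by apply: (partial_coord i k (@cimg_adm R M c) cq) => j; exact: X_C1.
Qed.

Lemma partial2E c i j q : charts A c -> cimg c q ->
  partial i (partial j (X c)) q = pdv i (pdv j (X c)) q.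
Proof.
move=> Ac cq; have aC := @cimg_adm R M c.
have cp k : C1 (cimg c) (fun q => pdv j (X c) q 0 k) by exact: pdv_C1 (X_C2 Ac) j k.
have E k q' : cimg c q' -> pdv j (X c) q' 0 k = partial j (X c) q' 0 k by move=> h; rewrite partialE.
apply/rowP => k; rewrite [RHS]mxE.
transitivity (pd i (fun q => partial j (X c) q 0 k) q).
  by apply: (partial_coord i k aC cq) => l; exact: C1_ext (E l) (cp l).
have [_ e0 e1] := C1_extE aC (cp k) (E k).
by move: i; apply: ord2P; [exact: e0|exact: e1].
Qed.

Lemma tangent_row c i p : charts A c -> cdom c p -> row i (tangent x c p) = pdv i (X c) (cmap c p).
Proof.
move=> Ac cp; rewrite -partialE//; last exact: cimgP.
by apply/rowP => k; rewrite !mxE.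
Qed.

Lemma normal_gt0 c p (n := cross (pdv 0 (X c) (cmap c p)) (pdv 1 (X c) (cmap c p))) :
  charts A c -> cdom c p -> 0 < dot n n.
Proof.
move=> Ac cp; have [_ rf] := immx.
by rewrite /n -!tangent_row//; apply: cross_row_free; exact: rf.
Qed.

Lemma gaussE c p (n := cross (pdv 0 (X c) (cmap c p)) (pdv 1 (X c) (cmap c p))) :
  charts A c -> cdom c p -> N p = (enorm n)^-1 *: n.
Proof. by move=> Ac cp; rewrite /n -!tangent_row//; exact: gaussN. Qed.

(** The classical formula for [2H (EG - F^2)] in terms of the two fundamental forms, with
    [EG - F^2 = <n, n>] by Lagrange's identity. *)
Lemma curvatureE c p (q := cmap c p) (u := pdv 0 (X c) q) (v := pdv 1 (X c) q) (n := cross u v) :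
  charts A c -> cdom c p ->
  (a * (x p 0 0 ^+ 2 + x p 0 1 ^+ 2) + b) * dot n n =
  dot v v * dot (pdv 0 (pdv 0 (X c)) q) (N p) - dot u v * dot (pdv 1 (pdv 0 (X c)) q) (N p)
  - dot u v * dot (pdv 0 (pdv 1 (X c)) q) (N p) + dot u u * dot (pdv 1 (pdv 1 (X c)) q) (N p).
Proof.
move=> Ac cp; have [H hH sH] := statx.
have I i j : first_form x c p i j = dot (row i (tangent x c p)) (row j (tangent x c p)).
  by rewrite /first_form /dot !mxE; apply: eq_bigr => k _; rewrite !mxE.
have IE i j : first_form x c p i j = dot (pdv i (X c) q) (pdv j (X c) q) by rewrite I !tangent_row.
have detI : \det (first_form x c p) = dot n n by rewrite det2 !IE /n lagrange (dotC v u).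
have B i j : second_form x N c p i j = dot (pdv i (pdv j (X c)) q) (N p).
  by rewrite mxE partial2E//; exact: cimgP.
have dI : \det (first_form x c p) != 0 by rewrite detI lt0r_neq0// normal_gt0.
have <- : axis_dist (x p) ^+ 2 = x p 0 0 ^+ 2 + x p 0 1 ^+ 2.
  by rewrite /axis_dist sqr_sqrtr// addr_ge0// sqr_ge0.
rewrite -sH (hH c p Ac cp) mulrA divff ?pnatr_eq0// mul1r -detI trace_shape//.
by rewrite !IE !B (dotC (pdv 1 _ _) (pdv 0 _ _)) -/u -/v; ring.
Qed.

(** The coefficients of [du] ([i = 0]) and [dv] ([i = 1]) of the form in the chart [c]. *)
Definition eta i c q := weighted_form a b (N (chart_inv c q)) (X c q) (pdv i (X c) q).

Section chart.
Variable c : chart R M.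
Hypothesis Ac : charts A c.
Let NX q := N (chart_inv c q).

Lemma NX_E q : cimg c q -> NX q = (enorm (cross (pdv 0 (X c) q) (pdv 1 (X c) q)))^-1 *:
  cross (pdv 0 (X c) q) (pdv 1 (X c) q).
Proof. by move=> cq; rewrite /NX (gaussE Ac (inv_dom cq)) invK. Qed.

Lemma NX_gt0 q : cimg c q ->
  0 < dot (cross (pdv 0 (X c) q) (pdv 1 (X c) q)) (cross (pdv 0 (X c) q) (pdv 1 (X c) q)).
Proof. by move=> cq; have := normal_gt0 Ac (inv_dom cq); rewrite invK. Qed.

Lemma eta_C1 i : C1 (cimg c) (eta i c).
Proof.
by have [] := weighted_C1 a b (@cimg_adm R M c) (X_C2 Ac) NX_gt0 NX_E i.
Qed.

Lemma eta_closed q : cimg c q -> pd 0 (eta 1 c) q = pd 1 (eta 0 c) q.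
Proof.
move=> cq; apply: (weighted_closed (@cimg_adm R M c) (X_C2 Ac) NX_gt0 NX_E _ cq) => q' cq'.
by have := curvatureE Ac (inv_dom cq'); rewrite invK.
Qed.

Lemma gauss_unit p : cdom c p -> dot (N p) (N p) = 1.
Proof.
move=> cp; have := normal_unit NX_gt0 NX_E (cimgP cp).
by rewrite /NX cmapK.
Qed.

End chart.

Lemma weighted_formD (m y t t' : 'rV[R]_3) (k k' : R) :
  weighted_form a b m y (k *: t + k' *: t') = k * weighted_form a b m y t + k' * weighted_form a b m y t'.
Proof. by rewrite /weighted_form !cross2 !mxE; ring. Qed.

(** The point and the normal do not depend on the chart, and the form is linear in the tangent
    vector, which the chain rule transforms. *)
Lemma eta_trans i c c' q : charts A c -> charts A c' -> ovl c c' q ->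
  eta i c q = eta 0 c' (trans c c' q) * pd i (fun q => trans c c' q 0 0) q
    + eta 1 c' (trans c c' q) * pd i (fun q => trans c c' q 0 1) q.
Proof.
move=> Ac Ac' Oq; have aO := @ovl_adm R M c c'; have aC := @cimg_adm R M c'.
have [t1 _ _] := trans_C2 0 Ac Ac'; have [t2 _ _] := trans_C2 1 Ac Ac'.
have XE w : ovl c c' w -> X c' (trans c c' w) = X c w by move=> Ow; rewrite /local_repr/= trans_inv.
have -> : eta i c q = weighted_form a b (N (chart_inv c' (trans c c' q))) (X c' (trans c c' q))
   (pd i (fun q => trans c c' q 0 0) q *: pdv 0 (X c') (trans c c' q)
    + pd i (fun q => trans c c' q 0 1) q *: pdv 1 (X c') (trans c c' q)).
  rewrite /eta trans_inv// XE//; congr (weighted_form _ _ _ _ _); apply/rowP => k.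
  have [m m0 m1] := C1_comp aO aC (@trans_ovl R M c c') t1 t2 (X_C1 k Ac').
  have E w : ovl c c' w -> ((fun q => X c' q 0 k) \o trans c c') w = X c w 0 k.
    by move=> Ow; rewrite /= XE.
  have [_ e0 e1] := C1_extE aO m E.
  move: i; apply: ord2P; rewrite [LHS]mxE [RHS]mxE.
    by rewrite e0// m0// !mxE; ring.
  by rewrite e1// m1// !mxE; ring.
by rewrite weighted_formD /eta; ring.
Qed.

Variable g : arclength_boundary A x.
Hypothesis conu : inward_conormal A x nu.
Hypothesis og : induced_orientation N nu g.
Implicit Types (i : 'I_(ncomp g)) (s : R).

Lemma dc1_0 c i s : charts A c -> cdom c (curve i s) -> dc c i s 0 1 = 0.
Proof.
move=> Ac cs; have h := gamma_derive 1 Ac cs.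
rewrite -(@derive_val _ _ _ _ _ _ _ h) (near_eq_derive (g := fun=> 0)) ?derive_cst//.
by apply: filterS (curve_near cs) => t ct; rewrite (curve_chart Ac ct).
Qed.

Lemma velocityE c i s : charts A c -> cdom c (curve i s) ->
  velocity i s = dc c i s 0 0 *: pdv 0 (X c) (cmap c (curve i s)).
Proof.
move=> Ac cs.
have D k : is_derive s 1 (fun t => x (curve i t) 0 k) (dc c i s 0 0 * pdv 0 (X c) (cmap c (curve i s)) 0 k).
  have nS : \forall t \near s, cimg c (cmap c (curve i t)).
    by apply: filterS (curve_near cs) => t; exact: cimgP.
  have := wd_curve nS (C1_wd (X_C1 k Ac) (cimgP cs)) (gamma_derive 0 Ac cs) (gamma_derive 1 Ac cs).
  rewrite dc1_0// mulr0 addr0 mxE mulrC; apply: near_eq_is_derive.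
  by apply: filterS (curve_near cs) => t ct; rewrite /local_repr/= cmapK.
rewrite /velocity derive1E derive_mx; last first.
  by apply/derivable_mxP => j k; rewrite (ord1 j); have [] := D k.
by apply/rowP => k; rewrite mxE [RHS]mxE; exact: (@derive_val _ _ _ _ _ _ _ (D k)).
Qed.

(** The induced orientation enters here: it makes the boundary run in the direction of increasing
    [u] in every chart, and it fixes the sign in the conormal identity. *)
Lemma curve_frame c i s : charts A c -> cdom c (curve i s) ->
  0 < dc c i s 0 0 /\ cross (N (curve i s)) (velocity i s) = nu (curve i s).
Proof.
move=> Ac cs; set p := curve i s.
have [[w w1 nuE] nut nun] := conu Ac cs (curve_bd i s).
have n0 := normal_gt0 Ac cs; rewrite -/p in n0.
apply: (conormal_cross n0 _ (gaussE Ac cs) (gauss_unit Ac cs) w1 _ (velocityE Ac cs)).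
- by rewrite invr_gt0 sqrtr_gt0.
- rewrite nuE -!tangent_row//; apply/rowP => k.
  by rewrite !mxE sum_ord2 !mxE.
- by rewrite -tangent_row.
- exact: enorm1.
- by apply: enorm1; exact: curve_speed.
- exact: og.
Qed.

Definition boundary_form i s :=
  weighted_form a b (N (curve i s)) (x (curve i s)) (velocity i s).

Lemma boundary_formE c i s : charts A c -> cdom c (curve i s) ->
  boundary_form i s = eta 0 c (cmap c (curve i s)) * dc c i s 0 0.
Proof.
move=> Ac cs; rewrite /boundary_form (velocityE Ac cs) /eta /local_repr/= !cmapK//.
by rewrite /weighted_form !cross2 !mxE; ring.
Qed.

Lemma boundary_form_conormal i s (p := curve i s) :
  boundary_form i s = nu p 0 2 + (a / 4 * axis_dist (x p) ^+ 2 + b / 2) * cross (x p) (velocity i s) 0 2.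
Proof.
have [c Ac cs] := charts_cover A p; have [_ E] := curve_frame Ac cs.
rewrite /boundary_form /weighted_form E /axis_dist sqr_sqrtr//.
by rewrite addr_ge0// sqr_ge0.
Qed.

Lemma velocity_periodic i s : velocity i (s + clen i) = velocity i s.
Proof.
rewrite /velocity /derive1.
rewrite (_ : (fun h => _) = fun h => h^-1 *: ((x \o curve i) (h + s) - (x \o curve i) s))//.
by apply/funext => h; rewrite /= addrA !curve_periodic.
Qed.

Lemma velocity_cont i k : continuous (fun s => velocity i s 0 k).
Proof.
apply: (@e_cont _ _ _ _ g (fun c q => pdv 0 (X c) q 0 k) _ (fun i s => velocity i s 0 k)).
  by move=> c Ac; exact: pdv_C1 (X_C2 Ac) 0 k.
by move=> c j s Ac cs; rewrite (velocityE Ac cs) mxE mulrC.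
Qed.

Lemma boundary_form_cont i : continuous (boundary_form i).
Proof.
apply: (@e_cont _ _ _ _ g (eta 0) _ boundary_form); first by move=> c Ac; exact: eta_C1.
by move=> c j s; exact: boundary_formE.
Qed.

Lemma boundary_form_sum : hausdorff_space M -> compact [set: M] ->
  \sum_i rint 0 (clen i) (boundary_form i) = 0.
Proof.
move=> hausM compM; apply: (stokes hausM compM (P := eta 0) (Q := eta 1)).
- by move=> c Ac; exact: eta_C1.
- by move=> c Ac; exact: eta_C1.
- by move=> c q Ac; exact: eta_closed.
- by move=> c c' q; exact: eta_trans.
- by move=> c c' q; exact: eta_trans.
- exact: boundary_formE.
- by move=> c i s Ac cs; have [] := curve_frame Ac cs.
- by move=> i s; rewrite /boundary_form velocity_periodic curve_periodic.
Qed.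

End Geometry.

(** * The integral formula and the length inequality *)

Theorem theorem3 (R : realType) (M : topologicalType) (A : oriented_atlas R M)
    (hausM : hausdorff_space M) (compM : compact [set: M])
    (connM : connected [set: M])
    (x N nu : M -> 'rV[R]_3) (a b : R)
    (immx : smooth_immersion A x)
    (gaussN : gauss_map A x N)
    (statx : stationary_rotating A x N a b)
    (bdM : surface_boundary A !=set0)
    (conu : inward_conormal A x nu)
    (alpha : arclength_boundary A x)
    (oalpha : induced_orientation N nu alpha) :
  boundary_integral alpha
    (fun p T => (a * axis_dist (x p) ^+ 2 + 2 * b) * dot (cross (x p) T) E3)
  = - 4 * boundary_integral alpha (fun p _ => dot (nu p) E3)
  /\
  a * boundary_integral alpha
        (fun p T => axis_dist (x p) ^+ 2 * dot (cross (x p) T) E3)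
  <= 4 * (boundary_length alpha - b * algebraic_area alpha).
Proof.
pose cr (i : 'I_(ncomp alpha)) s := dot (cross (x (curve i s)) (velocity i s)) E3 : R.
pose rr (i : 'I_(ncomp alpha)) s := axis_dist (x (curve i s)) ^+ 2 : R.
pose n3 (i : 'I_(ncomp alpha)) s := dot (nu (curve i s)) E3 : R.
pose bf (i : 'I_(ncomp alpha)) s := boundary_form N a b i s.
have cx (i : 'I_(ncomp alpha)) k : continuous (fun s => x (curve i s) 0 k).
  exact: th_cont (x_MC2 immx k).
have cv (i : 'I_(ncomp alpha)) k : continuous (fun s => velocity i s 0 k).
  exact: velocity_cont.
have ccr (i : 'I_(ncomp alpha)) : continuous (cr i).
  rewrite (_ : cr i = fun s => x (curve i s) 0 0 * velocity i s 0 1 - x (curve i s) 0 1 * velocity i s 0 0).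
    move=> s; apply: cvgB.
      by apply: cvgM; [exact: cx|exact: cv].
    by apply: cvgM; [exact: cx|exact: cv].
  by apply/funext => s; rewrite /cr dot_E3 cross2.
have crr i : continuous (rr i).
  rewrite (_ : rr i = fun s => x (curve i s) 0 0 * x (curve i s) 0 0 + x (curve i s) 0 1 * x (curve i s) 0 1).
    by move=> s; apply: cvgD; apply: cvgM; exact: cx.
  by apply/funext => s; rewrite /rr /axis_dist sqr_sqrtr ?addr_ge0 ?sqr_ge0// !expr2.
have bfE i s : n3 i s = bf i s - (a / 4 * (rr i s * cr i s) + b / 2 * cr i s).
  rewrite /bf (boundary_form_conormal a b immx gaussN conu oalpha) /n3 /cr !dot_E3 -/(rr i s).
  ring.
pose L (i : 'I_(ncomp alpha)) := clen i.
have cont f : continuous f -> forall i, cont_on 0 (L i) f by move=> cf i; exact: continuous_cont_on.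
have cbf i : cont_on 0 (L i) (bf i).
  by apply: cont; exact: (boundary_form_cont immx gaussN).
have cc i : cont_on 0 (L i) (cr i) by exact: cont.
have crc i : cont_on 0 (L i) (fun s => rr i s * cr i s) by apply: cont_onM; [exact: cont|exact: cc].
have c1 i : cont_on 0 (L i) (fun s => a / 4 * (rr i s * cr i s)) by apply: cont_onM; [exact: cont_on_cst|exact: crc].
have c2 i : cont_on 0 (L i) (fun s => b / 2 * cr i s) by apply: cont_onM; [exact: cont_on_cst|exact: cc].
have c12 i := cont_onD (c1 i) (c2 i).
(* The data on [nu] contain no continuity; on the boundary that of its third component comes from
   [bfE]. *)
have cn i : cont_on 0 (L i) (n3 i).
  by apply: cont_on_ext (cont_onB (cbf i) (c12 i)) => s _; rewrite bfE.
pose I1 := \sum_i rint 0 (L i) (fun s => rr i s * cr i s).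
pose I2 := \sum_i rint 0 (L i) (cr i).
pose I3 := \sum_i rint 0 (L i) (n3 i).
have E3E : I3 = - (a / 4 * I1 + b / 2 * I2).
  have h := boundary_form_sum immx gaussN statx conu oalpha hausM compM.
  rewrite -[RHS]add0r -h /I3 /I1 /I2 !mulr_sumr -big_split -sumrB; apply: eq_bigr => i _ /=.
  rewrite -!rintZ// -rintD// -rintB//.
  by apply: rint_ext => s _; rewrite bfE.
have F1 : boundary_integral alpha
    (fun p T => (a * axis_dist (x p) ^+ 2 + 2 * b) * dot (cross (x p) T) E3) = a * I1 + 2 * b * I2.
  rewrite /I1 /I2 !mulr_sumr -big_split; apply: eq_bigr => i _ /=.
  rewrite -!rintZ// -rintD; last 2 first.
  - by apply: cont_onM; [exact: cont_on_cst|exact: crc].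
  - by apply: cont_onM; [exact: cont_on_cst|exact: cc].
  by apply: rint_ext => s _; rewrite mulrDl mulrA.
have F2 : boundary_integral alpha (fun p _ => dot (nu p) E3) = I3 by [].
have F3 : boundary_integral alpha (fun p T => axis_dist (x p) ^+ 2 * dot (cross (x p) T) E3) = I1 by [].
have F4 : algebraic_area alpha = 2^-1 * I2 by [].
have F5 : - I3 <= boundary_length alpha.
  rewrite /I3 -sumrN; apply: ler_sum => i _; rewrite -rintN//.
  apply: le_rint; [exact: cont_onN|exact: cont_on_cst|move=> s _].
  have [c Ac cs] := charts_cover A (curve i s).
  have [_ _ /enorm1 n1] := conu c _ Ac cs (curve_bd i s).
  have : n3 i s ^+ 2 <= 1.
    by rewrite /n3 dot_E3 -n1 dotE -!expr2 lerDr addr_ge0// sqr_ge0.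
  by move: (n3 i s) => y; rewrite -subr_ge0 => h; nra.
split; first by rewrite F1 F2 E3E; field.
(* The bound [- I3 <= l] reads [a / 4 * I1 + b / 2 * I2 <= l]; multiplied by 4, its term in [I2] is
   4 [b] times the algebraic area [I2 / 2]. *)
rewrite F3 F4; move: F5; rewrite E3E; move: (boundary_length alpha) => l; clear; lra.
Qed.
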